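(* Let $(M,I,J,K)$ be a hypercomplex manifold with a hyperhermitian metric $g$, let $Z=M\times S^2$ be its twistor space with holomorphic projection $\pi:Z\to S^2\cong\mathbb{CP}^1$, and let $\mathcal P$ be the bivector field on $Z$ with $\mathcal P_{(x,\mathbf a)}=\big((s_{\mathbf a})_*P_I\big)^{(2,0)}$ (the $(2,0)$-component taken with respect to the complex structure of $Z$ at $(x,\mathbf a)$). (1) If $(M,I,J,K,g)$ is hyperk\''ahler, then $\mathcal P$ is a holomorphic Poisson structure on $Z$ which vanishes on the two fibers of $\pi$ corresponding to $I$ and $-I$, i.e. $\lambda=\infty$ and $\lambda=0$. The leaves of its symplectic foliation are the fibers of $\pi: Z\setminus\pi^{-1}(\{0,\infty\})\to\mathbb{CP}^1\setminus\{0,\infty\}$ and the points of $\pi^{-1}(0)$ and $\pi^{-1}(\infty)$. (2) Conversely, if $g$ is a hyperhermitian metric on $M$ and $\mathcal P$ is a holomorphic Poisson structure on $Z$, then $g$ is hyperk\''ahler.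
   Context: Manifolds are assumed connected. A hypercomplex structure on $M$ is a triple $I,J,K$ of (integrable) complex structures with $IJ=-JI=K$; a Riemannian metric $g$ is hyperhermitian if it is Hermitian for $I,J,K$, and hyperk\''ahler if moreover $\omega_I,\omega_J,\omega_K$ are closed, where $\omega_A(X,Y)=g(AX,Y)$. $P_I=\omega_I^{-1}$ is the bivector dual to $\omega_I$: $\omega_I^{-1}(\alpha,\beta)=\beta(\omega_I^{-1}(\alpha))$, where $\omega_I^{-1}:T^*M\to TM$ is the inverse of $X\mapsto i_X\omega_I$. Twistor space: for $\mathbf a=(a,b,c)\in S^2$ put $I_{\mathbf a}=aI+bJ+cK$. On $Z=M\times S^2$ the integrable complex structure is $\mathcal I_{(x,\mathbf a)}=(I_{\mathbf a},I_{S^2})$, where $I_{S^2}$ is the canonical complex structure of $S^2\cong\mathbb{CP}^1=\mathbb C\cup\{\infty\}$, the identification being by the stereographic projection $$\lambda\mapsto\mathbf a=\left(\frac{|\lambda|^2-1}{1+|\lambda|^2},\frac{i(\overline\lambda-\lambda)}{1+|\lambda|^2},\frac{\lambda+\overline\lambda}{1+|\lambda|^2}\right),$$ so that $\lambda=\infty$ corresponds to $I$ and $\lambda=0$ to $-I$. The map $\pi(x,\mathbf a)=\mathbf a$ is holomorphic. For $\mathbf a\in S^2$, $s_{\mathbf a}:M\to Z$ is $s_{\mathbf a}(x)=(x,\mathbf a)$. A holomorphic Poisson structure on a complex manifold is a holomorphic section $Q$ of $\Lambda^2T^{1,0}$ with vanishing Schouten bracket $[Q,Q]=0$; its symplectic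 foliation is the (singular) holomorphic foliation whose leaves are tangent to the image of $Q:\Lambda^{1,0}\to T^{1,0}$. *)

(* Defs.v *)
From HB Require Import structures.
From mathcomp Require Import all_boot all_order all_algebra.
From mathcomp Require Import all_classical all_reals all_analysis.
From mathcomp Require Import complex.
From mathcomp Require Import ring.

Set Implicit Arguments.
Unset Strict Implicit.
Unset Printing Implicit Defensive.

Import Order.TTheory GRing.Theory Num.Theory.
Import numFieldNormedType.Exports.

Local Open Scope classical_set_scope.
Local Open Scope ring_scope.
Local Open Scope complex_scope.

(** * Smooth manifolds

    Points of R^n are columns.  A manifold is a topological space with an
    atlas: [chart c] is the chart with domain [dom c], and [param c] is its
    inverse parametrization. *)

Fixpoint Ck (R : realType) (n : nat) (U : set 'cV[R]_n) (k : nat)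
    (f : 'cV[R]_n -> R) : Prop :=
  match k with
  | 0 => forall v, U v -> {for v, continuous f}
  | k'.+1 => (forall i v, U v -> derivable f v (delta_mx i 0)) /\
             (forall i, Ck U k' (fun v => 'D_(delta_mx i 0) f v))
  end.

Definition smooth_on (R : realType) (n : nat) (U : set 'cV[R]_n)
    (f : 'cV[R]_n -> R) : Prop := forall k, Ck U k f.

Record atlas (R : realType) (n : nat) (T : Type) := Atlas {
  idx : Type;
  dom : idx -> set T;
  chart : idx -> T -> 'cV[R]_n;
  param : idx -> 'cV[R]_n -> T }.
Arguments idx {R n T} _.
Arguments dom {R n T} _ _ _.
Arguments chart {R n T} _ _ _.
Arguments param {R n T} _ _ _.

(* As usual for manifolds: Hausdorff, second countable; moreover all manifolds
   here are nonempty and connected. *)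
Record is_manifold (R : realType) (n : nat) (T : topologicalType)
    (A : atlas R n T) : Prop := IsManifold {
  mfd_nonempty : [set: T] !=set0;
  mfd_connected : connected [set: T];
  mfd_hausdorff : hausdorff_space T;
  mfd_second_countable : @second_countable T;
  mfd_cover : forall x, exists c, dom A c x;
  mfd_dom_open : forall c, open (dom A c);
  mfd_codom_open : forall c, open (chart A c @` dom A c);
  mfd_chartK : forall c x, dom A c x -> param A c (chart A c x) = x;
  mfd_chart_cont : forall c x, dom A c x -> {for x, continuous (chart A c)};
  mfd_param_cont : forall c v, (chart A c @` dom A c) v ->
    {for v, continuous (param A c)};
  mfd_smooth : forall c d i,
    smooth_on (chart A c @` (dom A c `&` dom A d))
              (fun v => chart A d (param A c v) i 0) }.

Section Charts.
Variables (R : realType) (n : nat) (T : Type) (A : atlas R n T).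

(* The partial derivative of [f] at [x] along the [i]-th coordinate of [c]. *)
Definition pder (c : idx A) (i : 'I_n) (f : T -> R) (x : T) : R :=
  'D_(delta_mx i 0) (fun v => f (param A c v)) (chart A c x).

Definition cpder (c : idx A) (i : 'I_n) (f : T -> R[i]) (x : T) : R[i] :=
  pder c i (fun y => complex.Re (f y)) x +i* pder c i (fun y => complex.Im (f y)) x.

Definition smooth (c : idx A) (f : T -> R) : Prop :=
  smooth_on (chart A c @` dom A c) (fun v => f (param A c v)).

Definition csmooth (c : idx A) (f : T -> R[i]) : Prop :=
  smooth c (fun y => complex.Re (f y)) /\ smooth c (fun y => complex.Im (f y)).

End Charts.

(* The matrix of the differential of [f] at [x] in the charts [c] and [d];
   it acts on columns. *)
Definition jac (R : realType) (m n : nat) (S T : Type)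
    (B : atlas R m S) (A : atlas R n T) (f : S -> T) (c : idx B) (d : idx A)
    (x : S) : 'M[R]_(n, m) :=
  \matrix_(i, j) pder c j (fun y => chart A d (f y) i 0) x.
Arguments jac {R m n S T} B A f c d x.

Definition smooth_map (R : realType) (m n : nat) (S T : topologicalType)
    (B : atlas R m S) (A : atlas R n T) (f : S -> T) : Prop :=
  continuous f /\
  forall c d i, smooth_on (chart B c @` (dom B c `&` f @^-1` dom A d))
                          (fun v => chart A d (f (param B c v)) i 0).

Notation toC := (map_mx (real_complex _)).

(** * Tensor fields with two indices

    [X c x] is the matrix of components of [X] at [x] in the chart [c]; it is
    meaningful for [x] in [dom A c] only. *)

Definition field (R : realType) (n : nat) (T : Type) (A : atlas R n T)
    (S : Type) : Type := idx A -> T -> 'M[S]_n.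

Section Tensors.
Variables (R : realType) (n : nat) (T : Type) (A : atlas R n T).

Definition field_smooth (X : field A R) : Prop :=
  forall c i j, smooth c (fun x => X c x i j).

Definition field_csmooth (X : field A R[i]) : Prop :=
  forall c i j, csmooth c (fun x => X c x i j).

Definition transition (c d : idx A) (x : T) : 'M[R]_n := jac A A id c d x.

Definition is_endomorphism (X : field A R) : Prop :=
  field_smooth X /\
  forall c d x, dom A c x -> dom A d x ->
    transition c d x *m X c x = X d x *m transition c d x.

Definition is_metric (g : field A R) : Prop :=
  [/\ field_smooth g,
      forall c d x, dom A c x -> dom A d x ->
        g c x = (transition c d x)^T *m g d x *m transition c d x,
      forall c x, dom A c x -> (g c x)^T = g c x &
      forall c x (v : 'cV[R]_n), dom A c x -> v != 0 ->
        0 < (v^T *m g c x *m v) 0 0].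

Definition is_cbivector (Q : field A R[i]) : Prop :=
  [/\ field_csmooth Q,
      forall c d x, dom A c x -> dom A d x ->
        Q d x = toC (transition c d x) *m Q c x *m (toC (transition c d x))^T &
      forall c x, dom A c x -> (Q c x)^T = - Q c x].

(* The [i]-th component of N(d_j, d_k), where d_j, d_k are coordinate fields
   and N(X, Y) = [FX, FY] - F[FX, Y] - F[X, FY] + F^2[X, Y]. *)
Definition nijenhuis (F : field A R) (c : idx A) (x : T) (i j k : 'I_n) : R :=
  \sum_l (F c x l j * pder c l (fun y => F c y i k) x
          - F c x l k * pder c l (fun y => F c y i j) x
          + F c x i l * pder c k (fun y => F c y l j) x
          - F c x i l * pder c j (fun y => F c y l k) x).

Definition complex_structure (F : field A R) : Prop :=
  [/\ is_endomorphism F,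
      forall c x, dom A c x -> F c x *m F c x = - 1%:M &
      forall c x i j k, dom A c x -> nijenhuis F c x i j k = 0].

Definition hypercomplex (I J K : field A R) : Prop :=
  [/\ complex_structure I, complex_structure J, complex_structure K &
      forall c x, dom A c x ->
        I c x *m J c x = K c x /\ J c x *m I c x = - K c x].

Definition hermitian (F g : field A R) : Prop :=
  forall c x, dom A c x -> (F c x)^T *m g c x *m F c x = g c x.

Definition hyperhermitian (I J K g : field A R) : Prop :=
  [/\ is_metric g, hermitian I g, hermitian J g & hermitian K g].

(* omega(X, Y) = g(FX, Y) = X^T (F^T g) Y *)
Definition omega (F g : field A R) : field A R :=
  fun c x => (F c x)^T *m g c x.

Definition closed2 (w : field A R) : Prop :=
  forall c x i j k, dom A c x ->
    pder c i (fun y => w c y j k) x + pder c j (fun y => w c y k i) x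
    + pder c k (fun y => w c y i j) x = 0.

Definition hyperkahler (I J K g : field A R) : Prop :=
  [/\ hyperhermitian I J K g, closed2 (omega I g), closed2 (omega J g) &
      closed2 (omega K g)].

(* The bivector dual to a 2-form with matrix W: i_X w is the covector W^T X,
   hence w^-1(a, b) = b^T (W^T)^-1 a = a^T W^-1 b. *)
Definition dual_bivector (w : field A R) : field A R :=
  fun c x => invmx (w c x).

(** * Complex geometry *)

(* The projection of the complexified tangent space onto T^{1,0} *)
Definition proj10 (F : 'M[R]_n) : 'M[R[i]]_n :=
  2^-1 *: (1%:M - 'i *: toC F).

Definition part20 (F : 'M[R]_n) (Q : 'M[R[i]]_n) : 'M[R[i]]_n :=
  proj10 F *m Q *m (proj10 F)^T.

Definition lie_bivector (c : idx A) (X : T -> 'cV[R[i]]_n) (Q : field A R[i])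
    (x : T) : 'M[R[i]]_n :=
  \matrix_(i, j) \sum_k (X x k 0 * cpder c k (fun y => Q c y i j) x
                         - Q c x k j * cpder c k (fun y => X y i 0) x
                         - Q c x i k * cpder c k (fun y => X y j 0) x).

(* Components of the Schouten bracket of two bivectors *)
Definition schouten (P Q : field A R[i]) (c : idx A) (x : T)
    (i j k : 'I_n) : R[i] :=
  let S i j k := \sum_l (P c x i l * cpder c l (fun y => Q c y j k) x
                         + Q c x i l * cpder c l (fun y => P c y j k) x) in
  S i j k + S j k i + S k i j.

(* The holomorphic structure of T^{1,0} is its Dolbeault operator,
   dbar_X Y = [X, Y]^{1,0} for X of type (0,1) and Y of type (1,0).  By the
   Leibniz rule it is given on sections of Lambda^2 T^{1,0} by
   dbar_X Q = (L_X Q)^{2,0}, and Q is holomorphic if it is killed by it. *)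
Definition holomorphic_bivector (F : field A R) (Q : field A R[i]) : Prop :=
  [/\ is_cbivector Q,
      forall c x, dom A c x -> toC (F c x) *m Q c x = 'i *: Q c x &
      forall c (X : T -> 'cV[R[i]]_n),
        (forall i, csmooth c (fun x => X x i 0)) ->
        (forall x, dom A c x -> toC (F c x) *m X x = - ('i *: X x)) ->
        forall x, dom A c x -> part20 (F c x) (lie_bivector c X Q x) = 0].

Definition holomorphic_poisson (F : field A R) (Q : field A R[i]) : Prop :=
  holomorphic_bivector F Q /\
  forall c x i j k, dom A c x -> schouten Q Q c x i j k = 0.

(* The image of Q : Lambda^{1,0} -> T^{1,0}, seen in the real tangent space
   through the isomorphism v |-> v^{1,0}.  Covectors are columns, so that
   those of type (1,0) are the xi with F^T xi = i xi. *)
Definition in_image (F : field A R) (Q : field A R[i]) (c : idx A) (x : T)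
    (v : 'cV[R]_n) : Prop :=
  exists2 xi : 'cV[R[i]]_n,
    (toC (F c x))^T *m xi = 'i *: xi &
    proj10 (F c x) *m toC v = (Q c x)^T *m xi.

End Tensors.

(** * Leaves

    An integral manifold of Q is (the underlying set of) an injectively
    immersed connected manifold whose tangent space at each point is the image
    of Q; a leaf is a maximal one. *)

Definition integral_manifold (R : realType) (n : nat) (T : topologicalType)
    (A : atlas R n T) (F : field A R) (Q : field A R[i]) (L : set T) : Prop :=
  exists (r : nat) (N : topologicalType) (B : atlas R r N) (f : N -> T),
    [/\ is_manifold B, smooth_map B A f, injective f, range f = L &
        forall p c d, dom B c p -> dom A d (f p) ->
          injective (mulmx (jac B A f c d p) : 'cV[R]_r -> 'cV[R]_n) /\
          range (mulmx (jac B A f c d p) : 'cV[R]_r -> 'cV[R]_n)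
            = [set v | in_image F Q d (f p) v]].

Definition is_leaf (R : realType) (n : nat) (T : topologicalType)
    (A : atlas R n T) (F : field A R) (Q : field A R[i]) (L : set T) : Prop :=
  integral_manifold F Q L /\
  forall L', integral_manifold F Q L' -> L `<=` L' -> L' = L.

(** * The sphere and its stereographic charts *)

Definition sphere (R : realType) : topologicalType :=
  [set a : 'cV[R]_3 | \sum_i a i 0 ^+ 2 = 1].

Definition vec3 (R : realType) (a b c : R) : 'cV[R]_3 :=
  \col_(i < 3) nth 0 [:: a; b; c] i.

Definition sqnorm2 (R : realType) (l : 'cV[R]_2) : R := l 0 0 ^+ 2 + l 1 0 ^+ 2.

(* The point with parameter lambda = l_0 + i l_1; recall that
   i (conj lambda - lambda) = 2 l_1 and lambda + conj lambda = 2 l_0. *)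
Definition stereo_vec (R : realType) (l : 'cV[R]_2) : 'cV[R]_3 :=
  vec3 ((sqnorm2 l - 1) / (1 + sqnorm2 l))
       (2 * l 1 0 / (1 + sqnorm2 l))
       (2 * l 0 0 / (1 + sqnorm2 l)).

(* The same in terms of mu = 1 / lambda = l_0 + i l_1. *)
Definition stereo_inv_vec (R : realType) (l : 'cV[R]_2) : 'cV[R]_3 :=
  vec3 ((1 - sqnorm2 l) / (1 + sqnorm2 l))
       (- (2 * l 1 0) / (1 + sqnorm2 l))
       (2 * l 0 0 / (1 + sqnorm2 l)).

Lemma sqnorm2_neq0 (R : realType) (l : 'cV[R]_2) : 1 + sqnorm2 l != 0.
Proof. by rewrite lt0r_neq0// ltr_pwDl// addr_ge0// sqr_ge0. Qed.

Lemma stereo_vecP (R : realType) (l : 'cV[R]_2) :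
  stereo_vec l \in [set a : 'cV[R]_3 | \sum_i a i 0 ^+ 2 = 1].
Proof.
have := sqnorm2_neq0 l; rewrite inE /= !big_ord_recl big_ord0 !mxE /= /sqnorm2.
by move=> ?; field.
Qed.

Lemma stereo_inv_vecP (R : realType) (l : 'cV[R]_2) :
  stereo_inv_vec l \in [set a : 'cV[R]_3 | \sum_i a i 0 ^+ 2 = 1].
Proof.
have := sqnorm2_neq0 l; rewrite inE /= !big_ord_recl big_ord0 !mxE /= /sqnorm2.
by move=> ?; field.
Qed.

Definition scomp (R : realType) (i : 'I_3) (a : sphere R) : R :=
  (set_val a : 'cV[R]_3) i 0.

(* [true] is the chart lambda, [false] is the chart mu = 1 / lambda. *)
Definition sphere_atlas (R : realType) : atlas R 2 (sphere R) :=
  @Atlas R 2 (sphere R) bool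
    (fun b => [set a | scomp 0 a != (if b then 1 else -1)])
    (fun b a => if b
       then \col_(i < 2) nth 0 [:: scomp 2 a / (1 - scomp 0 a);
                                   scomp 1 a / (1 - scomp 0 a)] i
       else \col_(i < 2) nth 0 [:: scomp 2 a / (1 + scomp 0 a);
                                   - scomp 1 a / (1 + scomp 0 a)] i)
    (fun b l => if b then exist _ (stereo_vec l) (stereo_vecP l)
                else exist _ (stereo_inv_vec l) (stereo_inv_vecP l)).

(* lambda = 0 is (-1,0,0), that is -I; lambda = infinity is (1,0,0), that is I *)
Definition lam0 (R : realType) : sphere R := param (sphere_atlas R) true 0.
Definition laminfty (R : realType) : sphere R := param (sphere_atlas R) false 0.

(* Multiplication by i in the coordinates (Re, Im) of lambda or mu *)
Definition mul_i (R : realType) : 'M[R]_2 :=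
  \matrix_(i, j) (if (i == 0) && (j == 1) then -1
                  else if (i == 1) && (j == 0) then 1 else 0).

(** * Twistor space *)

Definition prod_atlas (R : realType) (m n : nat) (S T : Type)
    (A : atlas R m S) (B : atlas R n T) : atlas R (m + n) (S * T) :=
  @Atlas R (m + n) (S * T) (idx A * idx B)%type
    (fun c => dom A c.1 `*` dom B c.2)
    (fun c z => col_mx (chart A c.1 z.1) (chart B c.2 z.2))
    (fun c v => (param A c.1 (usubmx v), param B c.2 (dsubmx v))).

Section Twistor.
Variables (R : realType) (n : nat) (M : topologicalType) (A : atlas R n M).

Definition twistor_atlas : atlas R (n + 2) (M * sphere R) :=
  prod_atlas A (sphere_atlas R).

Definition twistor_proj (z : M * sphere R) : sphere R := z.2.

Definition twistor_sec (a : sphere R) (x : M) : M * sphere R := (x, a).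

Definition twistor_complex (I J K : field A R) : field twistor_atlas R :=
  fun c z =>
    block_mx (scomp 0 z.2 *: I c.1 z.1 + scomp 1 z.2 *: J c.1 z.1
              + scomp 2 z.2 *: K c.1 z.1) 0
             0 (mul_i R).

Definition twistor_bivector (I J K g : field A R) : field twistor_atlas R[i] :=
  fun c z =>
    let ds := jac A twistor_atlas (twistor_sec z.2) c.1 c z.1 in
    part20 (twistor_complex I J K c z)
           (toC (ds *m dual_bivector (omega I g) c.1 z.1 *m ds^T)).

End Twistor.

(* Main.v *)
(* For I_s = s_0 I + s_1 J + s_2 K and e = (1, 0, 0), the (2,0)-part of
   P_I = I g^-1 with respect to I_s is one half of the imaginary quaternion
   e - (e . s) s + i e x s applied to g^-1; it vanishes only at s = e and s = -e.

   Let D be the Obata connection, the torsion-free connection with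
   DI = DJ = DK = 0.  It controls everything: omega_I, omega_J and omega_K are
   closed if and only if Dg = 0, because a tensor Dg which is hermitian in its
   last two arguments for I, J, K and whose three associated 3-forms vanish is
   zero.  If Dg = 0, then P is parallel along the fibers of pi, so its Schouten
   bracket vanishes, and it is holomorphic because its variation in the
   antiholomorphic directions of the sphere is killed by the projection onto
   T^{2,0}, by the Cauchy-Riemann equations of the sphere.  Conversely, if P is
   holomorphic at the points s = J and s = -J, then T = D_u g^-1 satisfies
   T = -i (+-J) T for all u of type (0,1) for +-J; the right hand side is skew
   and the left hand side symmetric, so T = 0; these u span everything.

   The image of P is the vertical space of pi away from the poles and 0 at the
   poles, so that pi is locally constant, hence constant, on every connected
   integral manifold. *)

Require Import Defs.
From HB Require Import structures.
From mathcomp Require Import all_boot all_order all_algebra.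
From mathcomp Require Import all_classical all_reals all_analysis.
From mathcomp Require Import complex ring.

Set Implicit Arguments.
Unset Strict Implicit.
Unset Printing Implicit Defensive.

Import Order.TTheory GRing.Theory Num.Theory.
Import numFieldNormedType.Exports.

Local Open Scope classical_set_scope.
Local Open Scope ring_scope.
Local Open Scope complex_scope.

(** * The Obata connection *)

(** Everything is linear algebra on 1-jets at one point: I, J, K, g, g^-1 and their first partial
    derivatives become complex matrices, and the connection is a family of matrices [G k] at that
    point, with nabla_k = d_k + G_k. A parallel endomorphism X then satisfies dX = X G - G X.

    The obstacle to holomorphicity is that the Lie derivative of P is tested along arbitrary fields
    X of type (0,1), whose own derivatives enter. Differentiating F X = - i X covariantly shows that
    nabla X is again of type (0,1). So the projection onto T^{1,0} removes the derivatives of X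
    together with the connection terms. What remains depends on X at the point only: the covariant
    derivative of g^-1 along the part of X tangent to M, and the derivative of the quaternionic
    coefficients along the part tangent to the sphere. Both directions of the theorem are read off
    from this formula.

    The converse uses s = J and s = -J because they are orthogonal to e, so that the coefficient of
    P reduces to e + i e x s, and because the test directions (1 + iJ)u and (1 - iJ)u add up to
    2u. *)

Section Entries.
Variables (R : pzRingType) (m n : nat).
Implicit Types A B : 'M[R]_(m, n).

Lemma addmxE A B i j : (A + B) i j = A i j + B i j. Proof. by rewrite mxE. Qed.
Lemma oppmxE A i j : (- A) i j = - A i j. Proof. by rewrite mxE. Qed.
Lemma scalemxE a A i j : (a *: A) i j = a * A i j. Proof. by rewrite mxE. Qed.
Lemma zeromxE i j : (0 : 'M[R]_(m, n)) i j = 0. Proof. by rewrite mxE. Qed.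
End Entries.

(** Distributes entries over the linear operations only. Unlike [mxE] it leaves matrix products
    folded, so that [ring] and [field] treat them as atoms. *)
Ltac mxlin := apply/matrixP => ? ?; rewrite !(addmxE, oppmxE, scalemxE, zeromxE).

Section Directional.
Variables (F : comNzRingType) (n m : nat).
Implicit Types (d : 'I_n -> 'M[F]_m) (v w : 'cV[F]_n).

(** The derivative along [v] of a matrix field whose partial derivatives at the point are [d l]. *)
Definition dir d v := \sum_l v l 0 *: d l.

Lemma dirD d v w : dir d (v + w) = dir d v + dir d w.
Proof. by rewrite /dir -big_split; apply: eq_bigr => l _; rewrite mxE scalerDl. Qed.

Lemma dirZ d a v : dir d (a *: v) = a *: dir d v.
Proof. by rewrite /dir scaler_sumr; apply: eq_bigr => l _; rewrite mxE scalerA. Qed.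

Lemma dirN d v : dir d (- v) = - dir d v.
Proof. by rewrite -scaleN1r dirZ scaleN1r. Qed.

Lemma dir_delta d k : dir d (delta_mx k 0) = d k.
Proof.
rewrite /dir (bigD1 k)//= big1 ?addr0 => [|l lk]; rewrite mxE ?eqxx ?scale1r//.
by rewrite (negbTE lk) scale0r.
Qed.

Lemma dir_mull d (X : 'M[F]_m) v : dir (fun k => X *m d k) v = X *m dir d v.
Proof. by rewrite mulmx_sumr; apply: eq_bigr => l _; rewrite scalemxAr. Qed.

Lemma dir_mulr d (X : 'M[F]_m) v : dir (fun k => d k *m X) v = dir d v *m X.
Proof. by rewrite mulmx_suml; apply: eq_bigr => l _; rewrite scalemxAl. Qed.

Lemma dir_add d e v : dir (fun k => d k + e k) v = dir d v + dir e v.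
Proof. by rewrite -big_split; apply: eq_bigr => l _; rewrite scalerDr. Qed.

Lemma dir_opp d v : dir (fun k => - d k) v = - dir d v.
Proof. by rewrite -sumrN; apply: eq_bigr => l _; rewrite scalerN. Qed.

Lemma dir_ext d e v : d =1 e -> dir d v = dir e v.
Proof. by move=> de; apply: eq_bigr => l _; rewrite de. Qed.

Lemma dir_tr d v : dir (fun k => (d k)^T) v = (dir d v)^T.
Proof.
rewrite raddf_sum; apply: eq_bigr => l _ /=.
by apply/matrixP => i j; rewrite !mxE.
Qed.

End Directional.

Lemma mulmx_ext (F : comNzRingType) (m n : nat) (X Y : 'M[F]_(m, n)) :
  (forall v : 'cV_n, X *m v = Y *m v) -> X = Y.
Proof.
by move=> h; apply/matrixP => i j; have /matrixP/(_ i 0) := h (delta_mx j 0);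
   rewrite -!colE !mxE.
Qed.

Section Obata.
Variables (F : numFieldType) (n : nat) (I J K : 'M[F]_n).
Variables (dI dJ dK : 'I_n -> 'M[F]_n).
Hypotheses (II : I *m I = - 1%:M) (JJ : J *m J = - 1%:M).
Hypotheses (IJ : I *m J = K) (JI : J *m I = - K).
Hypotheses (dII : forall k, dI k *m I + I *m dI k = 0)
  (dJJ : forall k, dJ k *m J + J *m dJ k = 0)
  (dIJ : forall k, dI k *m J + I *m dJ k = dK k)
  (dKI : forall k, dK k *m I + K *m dI k = dJ k).

(** The Nijenhuis tensor as a function of the 1-jet: the value [X] and the partial derivatives [dX]
    are independent arguments. *)
Definition torsion (X : 'M[F]_n) (dX : 'I_n -> 'M[F]_n) i j k :=
  \sum_l (X l j * dX l i k - X l k * dX l i j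
          + X i l * dX k l j - X i l * dX j l k).

Hypotheses (NI : forall i j k, torsion I dI i j k = 0)
  (NJ : forall i j k, torsion J dJ i j k = 0)
  (NK : forall i j k, torsion K dK i j k = 0).

(** Contraction of the components with [u] and [v], that is, N(u, v) for constant extensions of the
    two vectors. *)
Lemma torsion_dir X dX : (forall i j k, torsion X dX i j k = 0) ->
  forall u v, dir dX (X *m u) *m v - dir dX (X *m v) *m u
              + X *m (dir dX v *m u) - X *m (dir dX u *m v) = 0.
Proof.
move=> NX u v; apply/colP => i; rewrite [RHS]mxE.
have exp1 (p q : 'cV[F]_n) : (dir dX (X *m p) *m q) i 0 =
    \sum_j \sum_k \sum_l p j 0 * q k 0 * (X l j * dX l i k).
  rewrite exchange_big /= mxE; apply: eq_bigr => k _.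
  rewrite exchange_big /= summxE mulr_suml; apply: eq_bigr => l _.
  rewrite !mxE !mulr_suml; apply: eq_bigr => j _; ring.
have exp2 (p q : 'cV[F]_n) : (X *m (dir dX p *m q)) i 0 =
    \sum_j \sum_k \sum_l p j 0 * q k 0 * (X i l * dX j l k).
  rewrite mxE.
  under eq_bigr => l _.
    rewrite mxE mulr_sumr.
    under eq_bigr => k _ do rewrite summxE mulr_suml mulr_sumr.
    rewrite exchange_big; over.
  rewrite /= exchange_big /=; apply: eq_bigr => j _.
  rewrite /= exchange_big /=; apply: eq_bigr => k _.
  by apply: eq_bigr => l _; rewrite mxE; ring.
rewrite !(addmxE, oppmxE).
rewrite !exp1 !exp2 [X in _ - X + _ - _]exchange_big [X in _ + X - _]exchange_big /=.
rewrite -!sumrN -!big_split big1 // => j _ /=.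
rewrite -!sumrN -!big_split big1 // => k _ /=.
rewrite -!sumrN -!big_split /=.
transitivity (u j 0 * v k 0 * torsion X dX i j k); last by rewrite NX mulr0.
rewrite mulr_sumr.
by apply: eq_bigr => l _ /=; ring.
Qed.

Let KI : K *m I = J.
Proof. by rewrite -[K]opprK -JI mulNmx -mulmxA II mulmxN mulmx1 opprK. Qed.
Let IK : I *m K = - J.
Proof. by rewrite -IJ mulmxA II mulNmx mul1mx. Qed.
Let KJ : K *m J = - I.
Proof. by rewrite -IJ -mulmxA JJ mulmxN mulmx1. Qed.
Let JK : J *m K = I.
Proof. by rewrite -[K]opprK -JI mulmxN mulmxA JJ mulNmx mul1mx opprK. Qed.
Let KK : K *m K = - 1%:M.
Proof. by rewrite -{2}IJ mulmxA KI JJ. Qed.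

Let IIv (v : 'cV_n) : I *m (I *m v) = - v. Proof. by rewrite mulmxA II mulNmx mul1mx. Qed.
Let JJv (v : 'cV_n) : J *m (J *m v) = - v. Proof. by rewrite mulmxA JJ mulNmx mul1mx. Qed.
Let KKv (v : 'cV_n) : K *m (K *m v) = - v. Proof. by rewrite mulmxA KK mulNmx mul1mx. Qed.
Let IJv (v : 'cV_n) : I *m (J *m v) = K *m v. Proof. by rewrite mulmxA IJ. Qed.
Let JIv (v : 'cV_n) : J *m (I *m v) = - (K *m v). Proof. by rewrite mulmxA JI mulNmx. Qed.
Let KIv (v : 'cV_n) : K *m (I *m v) = J *m v. Proof. by rewrite mulmxA KI. Qed.
Let IKv (v : 'cV_n) : I *m (K *m v) = - (J *m v). Proof. by rewrite mulmxA IK mulNmx. Qed.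
Let KJv (v : 'cV_n) : K *m (J *m v) = - (I *m v). Proof. by rewrite mulmxA KJ mulNmx. Qed.
Let JKv (v : 'cV_n) : J *m (K *m v) = I *m v. Proof. by rewrite mulmxA JK. Qed.

Let dIIv (u v : 'cV[F]_n) : dir dI u *m (I *m v) = - (I *m (dir dI u *m v)).
Proof.
apply/eqP; rewrite -addr_eq0 !mulmxA -mulmxDl -dir_mull -dir_mulr -dir_add.
by rewrite (dir_ext (e := fun=> 0))// /dir big1 ?mul0mx// => l _; rewrite scaler0.
Qed.
Let dJJv (u v : 'cV[F]_n) : dir dJ u *m (J *m v) = - (J *m (dir dJ u *m v)).
Proof.
apply/eqP; rewrite -addr_eq0 !mulmxA -mulmxDl -dir_mull -dir_mulr -dir_add.
by rewrite (dir_ext (e := fun=> 0))// /dir big1 ?mul0mx// => l _; rewrite scaler0.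
Qed.
Let dKIv (u v : 'cV[F]_n) : dir dK u *m (I *m v) = dir dJ u *m v - K *m (dir dI u *m v).
Proof.
apply/eqP; rewrite -subr_eq opprK !mulmxA -mulmxDl -dir_mull -dir_mulr -dir_add.
by apply/eqP; congr (_ *m _); apply: dir_ext.
Qed.

Let rules := (IIv, JJv, KKv, IJv, JIv, KIv, IKv, KJv, JKv, dIIv, dJJv, dKIv,
  @mulmxDr F n n 1, @mulmxN F n n 1, @mulNmx F n n 1, @mulmxBr F n n 1,
  @opprK 'cV[F]_n, @opprD 'cV[F]_n, @dirN F n n).

(* Obata's connection
   (1/2) ([X,Y] + I[IX,Y] - J[X,JY] + K[IX,JY]) on constant vector fields. *)
Definition obata (u v : 'cV[F]_n) : 'cV[F]_n :=
  2^-1 *: (- (I *m (dir dI v *m u)) - J *m (dir dJ u *m v)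
           + K *m (dir dJ (I *m u) *m v - dir dI (J *m v) *m u)).

(** Integrability enters here: 2 ([obata u v] - [obata v u]) equals - N_I(u, v) + N_J(u, v) -
    N_K(Iu, Iv). *)
Lemma obata_sym u v : obata u v = obata v u.
Proof.
congr (_ *: _); apply/eqP; rewrite -subr_eq0; apply/eqP.
have /= hI := torsion_dir NI u v; have /= hJ := torsion_dir NJ u v.
have /= hK := torsion_dir NK (I *m u) (I *m v).
move: hI hJ hK; rewrite !rules => hI hJ hK.
have key (a b c d : 'cV[F]_n) :
    a = 0 -> b = 0 -> c = 0 -> d = - a + b - c -> d = 0.
  by move=> -> -> -> ->; rewrite oppr0 !addr0.
apply: (key _ _ _ _ hI hJ hK).
by mxlin; ring.
Qed.

Lemma obata_lin u (a b : F) v w :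
  obata u (a *: v + b *: w) = a *: obata u v + b *: obata u w.
Proof.
rewrite /obata !(mulmxDr, dirD, dirZ, mulmxDl, =^~ scalemxAl, =^~ scalemxAr, mulmxN, mulmxBr).
by mxlin; ring.
Qed.

(** J is parallel by the formula of the connection alone. For I the arguments have to be exchanged
    first, so this rests on the vanishing of the torsion. *)
Let parI u v : dir dI u *m v + obata u (I *m v) - I *m obata u v = 0.
Proof.
rewrite (obata_sym u (I *m v)) (obata_sym u v) /obata -scalemxAr !rules.
by mxlin; field.
Qed.

Let parJ u v : dir dJ u *m v + obata u (J *m v) - J *m obata u v = 0.
Proof.
rewrite /obata -scalemxAr !rules.
by mxlin; field.
Qed.

Lemma obata_connection : exists G : 'I_n -> 'M[F]_n,
  [/\ forall k l i, G k i l = G l i k,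
      forall k, dI k = I *m G k - G k *m I,
      forall k, dJ k = J *m G k - G k *m J &
      forall k, dK k = K *m G k - G k *m K].
Proof.
pose G k := \matrix_(i, l) obata (delta_mx k 0) (delta_mx l 0) i 0.
have Gv k v : G k *m v = obata (delta_mx k 0) v.
  have ob0 u : obata u 0 = 0.
    by have := obata_lin u 0 0 0 0; rewrite !scale0r addr0.
  have obS u (s : seq 'I_n) (f : 'I_n -> 'cV[F]_n) (a : 'I_n -> F) :
      obata u (\sum_(l <- s) a l *: f l) = \sum_(l <- s) a l *: obata u (f l).
    elim: s => [|x s ih]; first by rewrite !big_nil.
    rewrite !big_cons -[X in obata _ (_ + X)]scale1r obata_lin ih scale1r//.
  rewrite {2}(_ : v = \sum_l v l 0 *: delta_mx l 0).
    rewrite obS; apply/colP => i; rewrite mxE summxE.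
    by apply: eq_bigr => l _; rewrite !mxE mulrC.
  apply/colP => i; rewrite summxE (bigD1 i)//= big1 ?addr0 => [|l li].
    by rewrite !mxE !eqxx mulr1.
  by rewrite !mxE eq_sym (negbTE li) mulr0.
have GI k : dI k = I *m G k - G k *m I.
  apply: mulmx_ext => v; have := parI (delta_mx k 0) v; rewrite dir_delta -!Gv.
  rewrite mulmxBl -!mulmxA => /eqP; rewrite subr_eq0 => /eqP <-.
  by rewrite addrK.
have GJ k : dJ k = J *m G k - G k *m J.
  apply: mulmx_ext => v; have := parJ (delta_mx k 0) v; rewrite dir_delta -!Gv.
  rewrite mulmxBl -!mulmxA => /eqP; rewrite subr_eq0 => /eqP <-.
  by rewrite addrK.
exists G; split=> // [k l i|k]; first by rewrite mxE [RHS]mxE obata_sym.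
rewrite -dIJ GI GJ mulmxBl mulmxBr -IJ !mulmxA.
by mxlin; ring.
Qed.

End Obata.

(** * Vanishing of hyperhermitian tensors *)

Section Hyperhermitian.
Variables (F : numFieldType) (n : nat).

(* For each A in {I, J, K} the cyclic relation gives
   T(X; Y, Z) - T(Y; X, Z) = T(A Z; X, A Y), so the right hand side does not
   depend on A; hence it is T(Z; X, Y), and the symmetry in the last two
   arguments concludes. *)
Lemma trilinear0 (I J K : 'M[F]_n) (T : 'cV[F]_n -> 'cV[F]_n -> 'cV[F]_n -> F) :
  I *m I = - 1%:M -> J *m J = - 1%:M -> K *m K = - 1%:M ->
  I *m J = K -> J *m I = - K ->
  (forall X Y Z, T (- X) Y Z = - T X Y Z) ->
  (forall X Y Z, T X (- Y) Z = - T X Y Z) ->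
  (forall X Y Z, T X Y Z = T X Z Y) ->
  (forall A, A \in [:: I; J; K] -> forall X Y Z,
     T X (A *m Y) (A *m Z) = T X Y Z) ->
  (forall A, A \in [:: I; J; K] -> forall X Y Z,
     T X (A *m Y) Z + T Y (A *m Z) X + T Z (A *m X) Y = 0) ->
  forall X Y Z, T X Y Z = 0.
Proof.
move=> II JJ KK IJ JI T1 T2 Ts Th Tc.
have AA A : A \in [:: I; J; K] -> A *m A = - 1%:M.
  by rewrite !inE => /or3P[]/eqP->.
have step A X Y Z : A \in [:: I; J; K] ->
    T X Y Z = T Y X Z + T (A *m Z) X (A *m Y).
  move=> hA; have AAv W : A *m (A *m W) = - W by rewrite mulmxA AA ?mulNmx ?mul1mx.
  have := Tc A hA X Y (A *m Z).
  rewrite Th// AAv T2 -(Th A hA (A *m Z) (A *m X) Y) AAv T2 (Ts Y Z X) => e.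
  by apply/eqP; rewrite -subr_eq0 -e; apply/eqP; ring.
have JKv (W : 'cV_n) : J *m (I *m W) = - (K *m W) by rewrite mulmxA JI mulNmx.
have eIJ X Y Z : T (I *m Z) X (I *m Y) = T (J *m Z) X (J *m Y).
  have := step I X Y Z; rewrite (step J X Y Z) ?inE ?eqxx ?orbT// => /(_ isT).
  by move/addrI.
have eKZ X Y Z : T (J *m Z) X (K *m Y) = T (I *m Z) X Y.
  have := eIJ X (I *m Y) Z; rewrite JKv mulmxA II mulNmx mul1mx.
  by rewrite !(Ts _ X) !T2 => /oppr_inj.
have eK X Y Z : T (K *m Z) X (K *m Y) = T Z X Y.
  have := eKZ X Y (- (J *m (K *m Z))); rewrite !mulmxN !mulmxA JJ IJ KK.
  by rewrite !mulNmx !mul1mx !opprK.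
have fin X Y Z : T X Y Z = T Y X Z + T Z X Y.
  by rewrite (step K X Y Z) ?inE ?eqxx ?orbT// eK.
move=> X Y Z; have := fin Y Z X; rewrite (fin Z Y X) (Ts X Z Y) -addrA => /eqP.
rewrite eq_sym -subr_eq0 addrAC subrr add0r -mulr2n mulrn_eq0/= => /eqP <-.
by [].
Qed.

End Hyperhermitian.

(** * Torsion-free connections, exterior derivatives and Schouten brackets *)

Section Parallel.
Variables (F : numFieldType) (n : nat) (G : 'I_n -> 'M[F]_n).
Hypothesis Gsym : forall k l i, G k i l = G l i k.

Lemma cyclic_dir (C : 'I_n -> 'M[F]_n) :
  (forall i j k, C i j k + C j k i + C k i j = 0) ->
  forall X Y Z : 'cV_n, (Y^T *m dir C X *m Z) 0 0 + (Z^T *m dir C Y *m X) 0 0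
                 + (X^T *m dir C Z *m Y) 0 0 = 0.
Proof.
move=> hC X Y Z.
have ex (p q r : 'cV[F]_n) : (q^T *m dir C p *m r) 0 0 =
    \sum_i \sum_j \sum_k p i 0 * q j 0 * r k 0 * C i j k.
  rewrite mxE.
  under eq_bigr => k _.
    rewrite mxE mulr_suml.
    under eq_bigr => j _ do rewrite summxE mulr_sumr mulr_suml.
    rewrite exchange_big; over.
  rewrite /= exchange_big; apply: eq_bigr => i _ /=.
  rewrite exchange_big; apply: eq_bigr => j _ /=; apply: eq_bigr => k _.
  by rewrite !mxE; ring.
rewrite !ex [X in _ + X + _](_ : _ =
  \sum_i \sum_j \sum_k Y j 0 * Z k 0 * X i 0 * C j k i); last first.
  under eq_bigr => i _ do rewrite exchange_big.
  by rewrite exchange_big.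
rewrite [X in _ + _ + X](_ : _ =
  \sum_i \sum_j \sum_k Z k 0 * X i 0 * Y j 0 * C k i j); last first.
  rewrite exchange_big; apply: eq_bigr => i _ /=.
  by rewrite exchange_big.
rewrite -!big_split big1// => i _ /=; rewrite -!big_split big1// => j _ /=.
rewrite -!big_split big1// => k _ /=.
rewrite -[RHS](mulr0 (X i 0 * Y j 0 * Z k 0)) -(hC i j k); ring.
Qed.

Lemma bilinear_eq0 (C : 'M[F]_n) :
  (forall Y Z : 'cV_n, (Y^T *m C *m Z) 0 0 = 0) -> C = 0.
Proof.
move=> h; apply/matrixP => i j; rewrite [RHS]mxE -(h (delta_mx i 0) (delta_mx j 0)).
by rewrite trmx_delta -rowE -colE !mxE.
Qed.

Section Forms.
Variables (w : 'M[F]_n) (dw : 'I_n -> 'M[F]_n) (C : 'I_n -> 'M[F]_n).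
Hypotheses (wT : w^T = - w)
  (dwE : forall k, dw k = (G k)^T *m w + w *m G k + C k).

(** [C] is the covariant derivative of the 2-form [w]. In the alternation the Christoffel terms
    cancel in pairs, because [G] is symmetric in its lower indices and [w] is skew. *)
Lemma cyclic_torsion_free i j k :
  dw i j k + dw j k i + dw k i j = C i j k + C j k i + C k i j.
Proof.
have pair a b c : (w *m G b) c a = - ((G a)^T *m w) b c.
  rewrite !mxE -sumrN; apply: eq_bigr => l _; rewrite mxE (Gsym a).
  by have /matrixP/(_ l c) := wT; rewrite !mxE => ->; ring.
by rewrite !dwE !addmxE (pair k i j) (pair i j k) (pair j k i); ring.
Qed.

End Forms.

(** The hypothesis on [dP] is nabla P = 0. Each sum is then 2 (c i j k - c i k j), where c is
    symmetric in its first two indices by the symmetry of [G] and the skewness of [P]; the cyclic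
    sum therefore cancels. *)
Lemma schouten_parallel (P : 'M[F]_n) (dP : 'I_n -> 'M[F]_n) :
  P^T = - P -> (forall k, dP k = - (G k *m P) - P *m (G k)^T) ->
  forall i j k, \sum_l (P i l * dP l j k + P i l * dP l j k)
    + \sum_l (P j l * dP l k i + P j l * dP l k i)
    + \sum_l (P k l * dP l i j + P k l * dP l i j) = 0.
Proof.
move=> PT dPE; pose c i j k := \sum_l \sum_m P i l * P m j * G l k m.
have PE i j : P i j = - P j i by have /matrixP/(_ j i) := PT; rewrite !mxE.
have cE i j k : \sum_l (P i l * dP l j k + P i l * dP l j k)
    = 2 * (c i j k - c i k j).
  have dE l : dP l j k = \sum_m (P m j * G l k m - P m k * G l j m).
    rewrite dPE addmxE !oppmxE ![in LHS]mxE -!sumrN -big_split.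
    by apply: eq_bigr => m _ /=; rewrite mxE (PE j m); ring.
  rewrite /c -sumrB mulr_sumr; apply: eq_bigr => l _.
  rewrite (_ : _ + _ = 2 * (P i l * dP l j k)); last by ring.
  congr (2 * _); rewrite dE -sumrB mulr_sumr; apply: eq_bigr => m _; ring.
have csym i j k : c i j k = c j i k.
  rewrite /c exchange_big /=; apply: eq_bigr => m _; apply: eq_bigr => l _.
  by rewrite (Gsym l m) (PE m j) (PE i l); ring.
move=> i j k; rewrite !cE (csym i j k) (csym i k j) (csym j k i); ring.
Qed.

End Parallel.

(** * Imaginary quaternions *)

Section Quaternions.
Variables (F : comNzRingType) (n : nat) (I J K : 'M[F]_n).
Hypotheses (II : I *m I = - 1%:M) (JJ : J *m J = - 1%:M)
  (IJ : I *m J = K) (JI : J *m I = - K).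

Definition quat (a b c : F) : 'M[F]_n := a *: I + b *: J + c *: K.

Lemma quatM a b c a' b' c' : quat a b c *m quat a' b' c' =
  - (a * a' + b * b' + c * c')%:M
  + quat (b * c' - c * b') (c * a' - a * c') (a * b' - b * a').
Proof.
have KI : K *m I = J by rewrite -[K]opprK -JI mulNmx -mulmxA II mulmxN mulmx1 opprK.
have IK : I *m K = - J by rewrite -IJ mulmxA II mulNmx mul1mx.
have KJ : K *m J = - I by rewrite -IJ -mulmxA JJ mulmxN mulmx1.
have JK : J *m K = I.
  by rewrite -[K]opprK -JI mulmxN mulmxA JJ mulNmx mul1mx opprK.
have KK : K *m K = - 1%:M by rewrite -{2}IJ mulmxA KI JJ.
rewrite -(scalemx1 _ (_ + _)) /quat !(mulmxDl, mulmxDr) -!(scalemxAl, scalemxAr).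
rewrite II JJ KK IJ JI KI IK KJ JK.
by mxlin; ring.
Qed.

Lemma quatZ x a b c : x *: quat a b c = quat (x * a) (x * b) (x * c).
Proof. by rewrite /quat !scalerDr !scalerA. Qed.

Lemma quatD a b c a' b' c' :
  quat a b c + quat a' b' c' = quat (a + a') (b + b') (c + c').
Proof. by rewrite /quat; mxlin; ring. Qed.

(** In vector notation, (1 - i a) v (1 + i a) = 2 (v - (v . a) a + i v x a) for a unit vector a. The
    two factors are twice the projections onto T^{1,0} and T^{0,1}, so this computes (2,0)-parts. *)
Lemma quat_sandwich (i a b c x y z : F) : i * i = -1 ->
  a * a + b * b + c * c = 1 ->
  (1%:M - i *: quat a b c) *m quat x y z *m (1%:M + i *: quat a b c) =
  2 *: quat (x - (x * a + y * b + z * c) * a + i * (y * c - z * b))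
            (y - (x * a + y * b + z * c) * b + i * (z * a - x * c))
            (z - (x * a + y * b + z * c) * c + i * (x * b - y * a)).
Proof.
move=> ii abc; rewrite mulmxBl mul1mx mulmxDr mulmx1 !mulmxBl.
rewrite -!(scalemxAl, scalemxAr) scalerA ii scaleN1r opprK !quatM.
rewrite mulmxDl mulNmx mul_scalar_mx !quatM -!(scalemx1 _ (_ + _)) /quat.
apply/matrixP => p q; rewrite !(addmxE, oppmxE, scalemxE).
apply/eqP; rewrite -subr_eq0; apply/eqP.
transitivity ((a * a + b * b + c * c - 1)
              * (x * I p q + y * J p q + z * K p q)); first by ring.
by rewrite abc subrr mul0r.
Qed.

End Quaternions.

(** * The covariant derivative of a hyperhermitian metric *)

Section ParallelMetric.
Variables (F : numFieldType) (n : nat) (G : 'I_n -> 'M[F]_n).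
Hypothesis Gsym : forall k l i, G k i l = G l i k.
Variables (g : 'M[F]_n) (dg : 'I_n -> 'M[F]_n).
Hypotheses (gT : g^T = g) (dgT : forall k, (dg k)^T = dg k).

Definition nabla k := dg k - (G k)^T *m g - g *m G k.

Lemma nablaT k : (nabla k)^T = nabla k.
Proof. by rewrite /nabla !linearB/= !trmx_mul trmxK gT dgT addrAC. Qed.

Section OneStructure.
Variables (A : 'M[F]_n) (dA : 'I_n -> 'M[F]_n).
Hypotheses (AA : A *m A = - 1%:M) (dAE : forall k, dA k = A *m G k - G k *m A)
  (Ag : A^T *m g *m A = g).

Lemma hermitian_skew : A^T *m g = - (g *m A).
Proof. by rewrite -{2}Ag -mulmxA AA mulmxN mulmx1 opprK. Qed.

(** Covariant differentiation of A^T g A = g; since A is parallel, only g is differentiated. *)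
Lemma nabla_hermitian k :
  (dA k)^T *m g *m A + A^T *m dg k *m A + A^T *m g *m dA k = dg k ->
  A^T *m nabla k *m A = nabla k.
Proof.
move=> dAg; rewrite /nabla -[in RHS]dAg dAE [(_ - _)^T]linearB/= !trmx_mul.
rewrite !(mulmxBr, mulmxBl) !mulmxA Ag.
have -> : (G k)^T *m A^T *m g *m A = (G k)^T *m g by rewrite -!mulmxA (mulmxA A^T) Ag.
by mxlin; ring.
Qed.

(** The form A^T g is skew, and A is parallel, so its covariant derivative is A^T (nabla g);
    [cyclic_torsion_free] applies. *)
Lemma closed_nabla i j k :
  let dw k := (dA k)^T *m g + A^T *m dg k in
  let C k := A^T *m nabla k in
  dw i j k + dw j k i + dw k i j = C i j k + C j k i + C k i j.
Proof.
move=> dw C; apply: (cyclic_torsion_free Gsym (w := A^T *m g)) => [|l].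
  by rewrite trmx_mul gT trmxK hermitian_skew opprK.
rewrite /dw /C /nabla dAE [(_ - _)^T]linearB/= !trmx_mul !(mulmxBr, mulmxBl) !mulmxA.
by mxlin; ring.
Qed.

End OneStructure.

(** This is [trilinear0] for T(X, Y, Z) = (nabla_X g)(Y, Z). *)
Lemma nabla_eq0 (I J K : 'M[F]_n) :
  I *m I = - 1%:M -> J *m J = - 1%:M -> K *m K = - 1%:M ->
  I *m J = K -> J *m I = - K ->
  (forall A, A \in [:: I; J; K] -> forall k, A^T *m nabla k *m A = nabla k) ->
  (forall A, A \in [:: I; J; K] -> forall i j k,
     (A^T *m nabla i) j k + (A^T *m nabla j) k i + (A^T *m nabla k) i j = 0) ->
  forall k, nabla k = 0.
Proof.
move=> II JJ KK IJ JI nH nC.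
have dirT X : (dir nabla X)^T = dir nabla X.
  by rewrite -dir_tr; apply: dir_ext => k; rewrite nablaT.
have T0 : forall X Y Z : 'cV_n, (Y^T *m dir nabla X *m Z) 0 0 = 0.
  apply: (trilinear0 II JJ KK IJ JI) => [X Y Z|X Y Z|X Y Z|A hA X Y Z|A hA X Y Z].
  - by rewrite dirN mulmxN mulNmx oppmxE.
  - by rewrite linearN/= !mulNmx oppmxE.
  - have trE (M : 'M[F]_1) : M 0 0 = M^T 0 0 by rewrite mxE.
    by rewrite trE !trmx_mul trmxK dirT mulmxA.
  - have e := dir_ext X (nH A hA); rewrite dir_mulr dir_mull in e.
    by rewrite -{2}e trmx_mul !mulmxA.
  - have := cyclic_dir (nC A hA) X Y Z; rewrite !dir_mull !trmx_mul !mulmxA.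
    by [].
move=> k; apply: bilinear_eq0 => Y Z.
by have := T0 (delta_mx k 0) Y Z; rewrite dir_delta.
Qed.

End ParallelMetric.

(** * Smooth functions *)

Lemma open_near (T : topologicalType) (U : set T) v :
  open U -> U v -> \near v, U v.
Proof. by move=> oU Uv; apply: open_nbhs_nbhs. Qed.

Section SmoothOn.
Variables (R : realType) (n : nat).
Implicit Types (U V : set 'cV[R]_n) (f g : 'cV[R]_n -> R).

Let d (i : 'I_n) : 'cV[R]_n := delta_mx i 0.

Lemma open_near_eq U f g v : open U -> {in U, f =1 g} -> U v ->
  \near v, f v = g v.
Proof.
move=> oU fg Uv; have := open_near oU Uv.
by apply: filterS => w Uw; apply: fg; rewrite inE.
Qed.

Lemma near_eq_continuous (T : topologicalType) (f g : T -> R) v :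
  (\near v, f v = g v) -> {for v, continuous f} -> {for v, continuous g}.
Proof.
move=> fg cf; have e : f v = g v := nbhs_singleton fg.
change (f @ v --> f v) in cf; change (g @ v --> g v); rewrite -e.
by apply: cvg_trans cf; apply: near_eq_cvg.
Qed.

Lemma Ck_ext U k f g : open U -> {in U, f =1 g} -> Ck U k f -> Ck U k g.
Proof.
move=> oU; elim: k f g => [|k ih] f g fg /=.
  by move=> cf v Uv; apply: near_eq_continuous (cf v Uv); apply: open_near_eq fg Uv.
move=> [df Cf]; split=> [i v Uv|i].
  by apply: near_eq_derivable (df i v Uv); apply: open_near_eq fg Uv.
apply: ih (Cf i) => v; rewrite inE => Uv; apply: near_eq_derive.
exact: open_near_eq fg Uv.
Qed.

Lemma smooth_on_ext U f g :
  open U -> {in U, f =1 g} -> smooth_on U f -> smooth_on U g.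
Proof. by move=> oU fg sf k; apply: Ck_ext fg (sf k). Qed.

Lemma smooth_on_sub U V f : V `<=` U -> smooth_on U f -> smooth_on V f.
Proof.
move=> VU sf k; have := sf k; elim: k f {sf} => [|k ih] f /=.
  by move=> cf v /VU; apply: cf.
by move=> [df Cf]; split=> [i v /VU|i]; [apply: df|apply: ih].
Qed.

Lemma smooth_on_continuous U f : smooth_on U f ->
  forall v, U v -> {for v, continuous f}.
Proof. by move=> sf; exact: (sf 0%N). Qed.

Lemma smooth_on_derivable U f : smooth_on U f ->
  forall i v, U v -> derivable f v (delta_mx i 0).
Proof. by move=> sf; have [df _] := sf 1%N; exact: df. Qed.

Lemma smooth_on_derive U f (i : 'I_n) : smooth_on U f ->
  smooth_on U (fun v => 'D_(delta_mx i 0) f v).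
Proof. by move=> sf k; have [_ Cf] := sf k.+1; exact: Cf. Qed.

(** A coinduction principle, for functions whose derivatives leave their original shape: it is
    applied to constants, to reciprocals and to compositions with linear maps. *)
Lemma smooth_on_coind U (S : ('cV[R]_n -> R) -> Prop) : open U ->
  (forall f, S f -> (forall v, U v -> {for v, continuous f}) /\
     forall i, (forall v, U v -> derivable f v (delta_mx i 0)) /\
       exists2 g, S g & forall v, U v -> 'D_(delta_mx i 0) f v = g v) ->
  forall f, S f -> smooth_on U f.
Proof.
move=> oU HS f Sf k; elim: k f Sf => [|k ih] f /HS[cf df] //=.
split=> i; first by have [] := df i.
have [_ [g Sg fg]] := df i; apply: Ck_ext (ih g Sg) => // v; rewrite inE => Uv.
by rewrite fg.
Qed.

Lemma smooth_on_cst U (a : R) : open U -> smooth_on U (fun=> a).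
Proof.
move=> oU; apply: (smooth_on_coind (S := fun f => exists a, f = fun=> a)) => //.
  move=> _ [{}a ->]; split=> [v _|i]; first exact: cst_continuous.
  split=> [v _|]; first exact: derivable_cst.
  by exists (fun=> 0); [exists 0|move=> v _; rewrite derive_cst].
by exists a.
Qed.

Lemma Ck_add U k f g : open U -> Ck U k f -> Ck U k g -> Ck U k (fun v => f v + g v).
Proof.
move=> oU; elim: k f g => [|k ih] f g /=.
  by move=> cf cg v Uv; apply: continuousD; [apply: cf|apply: cg].
move=> [df Cf] [dg Cg]; split=> [i v Uv|i].
  by apply: derivableD; [apply: df|apply: dg].
apply: Ck_ext (ih _ _ (Cf i) (Cg i)) => // v; rewrite inE => Uv.
by rewrite deriveD//; [apply: df|apply: dg].
Qed.

Lemma smooth_on_add U f g : open U -> smooth_on U f -> smooth_on U g ->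
  smooth_on U (fun v => f v + g v).
Proof. by move=> oU sf sg k; apply: Ck_add. Qed.

(** The induction on the order keeps both factors smooth, not merely of class C^k, so that it
    applies to both terms of the product rule. *)
Lemma smooth_on_mul U f g : open U -> smooth_on U f -> smooth_on U g ->
  smooth_on U (fun v => f v * g v).
Proof.
move=> oU + + k; elim: k f g => [|k ih] f g sf sg /=.
  by move=> v Uv; apply: continuousM; apply: smooth_on_continuous Uv.
have df := smooth_on_derivable sf; have dg := smooth_on_derivable sg.
split=> [i v Uv|i]; first by apply: derivableM; [apply: df|apply: dg].
have Cf := ih _ _ (smooth_on_derive i sf) sg.
have Cg := ih _ _ sf (smooth_on_derive i sg).
apply: Ck_ext (Ck_add oU Cf Cg) => // v; rewrite inE => Uv.
by rewrite deriveM; [rewrite addrC; congr (_ + _); apply: mulrC|apply: df|apply: dg].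
Qed.

Lemma smooth_on_opp U f : open U -> smooth_on U f -> smooth_on U (fun v => - f v).
Proof.
move=> oU sf; have := smooth_on_mul oU (smooth_on_cst (-1) oU) sf.
by apply: smooth_on_ext => // v _; rewrite mulN1r.
Qed.

Lemma smooth_on_sub_fun U f g : open U -> smooth_on U f -> smooth_on U g ->
  smooth_on U (fun v => f v - g v).
Proof. by move=> oU sf sg; apply: smooth_on_add => //; apply: smooth_on_opp. Qed.

Lemma smooth_on_sum U (I : Type) (r : seq I) (P : pred I) (F : I -> 'cV[R]_n -> R) :
  open U -> (forall i, smooth_on U (F i)) ->
  smooth_on U (fun v => \sum_(i <- r | P i) F i v).
Proof.
move=> oU sF; elim: r => [|x r ih].
  by under eq_fun do rewrite big_nil; exact: smooth_on_cst.
under eq_fun do rewrite big_cons.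
by case: (P x) => //; apply: smooth_on_add.
Qed.

Lemma smooth_on_prod U (I : Type) (r : seq I) (P : pred I) (F : I -> 'cV[R]_n -> R) :
  open U -> (forall i, smooth_on U (F i)) ->
  smooth_on U (fun v => \prod_(i <- r | P i) F i v).
Proof.
move=> oU sF; elim: r => [|x r ih].
  by under eq_fun do rewrite big_nil; exact: smooth_on_cst.
under eq_fun do rewrite big_cons.
by case: (P x) => //; apply: smooth_on_mul.
Qed.

Lemma is_derive_invX f (v w : 'cV[R]_n) m : f v != 0 -> derivable f v w ->
  is_derive v w (fun v => (f v)^-1 ^+ m) (- (m%:R * 'D_w f v * (f v)^-1 ^+ m.+1)).
Proof.
move=> fv df; elim: m => [|m ih].
  by rewrite !mul0r oppr0; exact: is_derive_cst.
rewrite (_ : (fun v => _) = (fun v => (f v)^-1) * (fun v => (f v)^-1 ^+ m)); last first.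
  by apply/funext => x; rewrite exprS.
have dV := derivableP (derivableV fv df).
apply: is_derive_eq (is_deriveM dV ih) _.
rewrite deriveV// /GRing.scale/= !exprS -natr1 expr0; field.
by [].
Qed.

Lemma smooth_on_inv U f : open U -> (forall v, U v -> f v != 0) ->
  smooth_on U f -> smooth_on U (fun v => (f v)^-1).
Proof.
move=> oU f0 sf; pose pw m v := (f v)^-1 ^+ m.
(* The functions a f^-m with a smooth are closed under partial derivatives: d(a f^-m) = (da f - m a
   df) f^-(m+1). *)
pose S h := exists2 a, smooth_on U a & exists m, h = a * pw m.
have df := smooth_on_derivable sf.
apply: (smooth_on_coind (S := S)) => // [_ [a sa [m ->]]|]; last first.
  exists (fun=> 1); first exact: smooth_on_cst.
  by exists 1%N; apply/funext => v; rewrite /pw/= -[RHS]/(_ * _) expr1 mul1r.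
have da := smooth_on_derivable sa.
have cf := smooth_on_continuous sf; have ca := smooth_on_continuous sa.
have dX i v : U v -> is_derive v (d i) (pw m) (- (m%:R * 'D_(d i) f v * (f v)^-1 ^+ m.+1)).
  by move=> Uv; exact: is_derive_invX (f0 v Uv) (df i v Uv).
have cV v : U v -> {for v, continuous (fun v => (f v)^-1)}.
  by move=> Uv; exact: continuousV (f0 v Uv) (cf v Uv).
have cX v : U v -> {for v, continuous (pw m)}.
  move=> /cV cv; elim: m {dX} => [|m ih]; first exact: cst_continuous.
  rewrite (_ : pw m.+1 = (fun v => (f v)^-1 * pw m v)).
    by apply: continuousM cv ih.
  by apply/funext => w; rewrite /pw exprS.
split=> [v Uv|i]; first by apply: continuousM (ca v Uv) (cX v Uv).
have dM v (Uv : U v) := is_deriveM (derivableP (da i v Uv)) (dX i v Uv).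
split=> [v Uv|]; first by case: (dM v Uv).
exists ((fun v => 'D_(delta_mx i 0) a v * f v - m%:R * a v * 'D_(delta_mx i 0) f v)
        * pw m.+1).
  eexists; last by exists m.+1.
  apply: smooth_on_sub_fun => //; apply: smooth_on_mul => //.
  - exact: smooth_on_derive.
  - by apply: smooth_on_mul => //; exact: smooth_on_cst.
  - exact: smooth_on_derive.
move=> v Uv; have [_ ->] := dM v Uv; rewrite /GRing.scale/= -[RHS]/(_ * _) /pw.
by have := f0 v Uv => fv; rewrite !exprS; field.
Qed.

End SmoothOn.
Arguments smooth_on_derivable {R n U f} _ i {v} _.
Arguments smooth_on_continuous {R n U f} _ {v} _.

Section LinearComposition.
Variables (R : realType) (m n : nat) (p : {linear 'cV[R]_m -> 'cV[R]_n}).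
Implicit Types (f : 'cV[R]_n -> R).

Let growth_comp f v w :
  (fun h : R => h^-1 *: ((f \o p \o shift v) (h *: w) - (f \o p) v)) =
  (fun h => h^-1 *: ((f \o shift (p v)) (h *: p w) - f (p v))).
Proof. by apply/funext => h /=; rewrite linearP. Qed.

Lemma derive_comp_linear f v w : 'D_w (f \o p) v = 'D_(p w) f (p v).
Proof. by rewrite /derive growth_comp. Qed.

Lemma derivable_comp_linear f v w :
  derivable f (p v) (p w) -> derivable (f \o p) v w.
Proof. by rewrite /derivable growth_comp. Qed.

(** The condition on basis vectors is that of a coordinate projection. Each partial derivative of
    the composite is then 0 or the composite of a partial derivative, so the composites form a class
    as in [smooth_on_coind]. *)
Lemma smooth_on_comp_linear (U : set 'cV[R]_n) (V : set 'cV[R]_m) f :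
  open U -> open V -> continuous p -> V `<=` p @^-1` U ->
  (forall i, p (delta_mx i 0) = 0 \/ exists j, p (delta_mx i 0) = delta_mx j 0) ->
  smooth_on U f -> smooth_on V (f \o p).
Proof.
move=> oU oV cp VU pd sf.
pose S h := exists2 f, smooth_on U f & h = f \o p.
apply: (smooth_on_coind (S := S)) => //; last by exists f.
move=> _ {f sf}[f sf ->]; split=> [v Vv|i].
  by apply: continuous_comp; [exact: cp|apply: (smooth_on_continuous sf); exact: VU].
have [p0|[j pj]] := pd i.
  split=> [v Vv|]; first by apply: derivable_comp_linear; rewrite p0; exact: derivable0.
  exists ((fun=> 0) \o p); first by exists (fun=> 0) => //; exact: smooth_on_cst.
  by move=> v Vv; rewrite derive_comp_linear p0 derive0.
split=> [v Vv|].
  apply: derivable_comp_linear; rewrite pj.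
  by apply: (smooth_on_derivable sf); exact: VU.
exists ((fun v => 'D_(delta_mx j 0) f v) \o p).
  by eexists; [exact: smooth_on_derive sf|].
by move=> v Vv; rewrite derive_comp_linear pj.
Qed.

End LinearComposition.

Section Coordinates.
Variables (R : realType) (n : nat).

Lemma is_derive_coord (i : 'I_n) (v w : 'cV[R]_n) :
  is_derive v w (fun v => v i 0) (w i 0).
Proof.
have cst : \forall h \near (0 : R)^',
    h^-1 *: (((fun v : 'cV[R]_n => v i 0) \o shift v) (h *: w) - v i 0) = w i 0.
  apply: filterS (nbhs_dnbhs_neq (0 : R)) => h h0 /=.
  by rewrite !mxE addrK /GRing.scale/= mulKf.
have cv : h^-1 *: (((fun v : 'cV[R]_n => v i 0) \o shift v) (h *: w) - v i 0)
    @[h --> 0^'] --> w i 0.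
  by apply: cvg_near_cst.
by apply: DeriveDef; [apply/cvg_ex; exists (w i 0)|apply: cvg_lim].
Qed.

Lemma smooth_on_coord (U : set 'cV[R]_n) (i : 'I_n) :
  open U -> smooth_on U (fun v => v i 0).
Proof.
move=> oU k; case: k => [|k] /=; first by move=> v _; exact: coord_continuous.
split=> [j v _|j]; first by case: (is_derive_coord i v (delta_mx j 0)).
rewrite (_ : (fun v => _) = fun=> (delta_mx j 0 : 'cV[R]_n) i 0); last first.
  by apply/funext => v; have [_ ->] := is_derive_coord i v (delta_mx j 0).
exact: smooth_on_cst.
Qed.

Lemma continuous_usubmx m : continuous (usubmx : 'cV[R]_(m + n) -> 'cV[R]_m).
Proof.
move=> v A [B nB BA]; exists (fun (i : 'I_(m + n)) j =>
    if fintype.split i is inl k then B k j else setT).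
  move=> i j; case: fintype.splitP => k ik; last exact: filterT.
  have -> : v i j = usubmx v k j by rewrite mxE; congr (v _ _); apply: val_inj.
  exact: nB.
move=> w Bw; apply: BA => i j; have := Bw (lshift n i) j.
by rewrite mxE (unsplitK (inl i)).
Qed.

Lemma continuous_dsubmx m : continuous (dsubmx : 'cV[R]_(m + n) -> 'cV[R]_n).
Proof.
move=> v A [B nB BA]; exists (fun (i : 'I_(m + n)) j =>
    if fintype.split i is inr k then B k j else setT).
  move=> i j; case: fintype.splitP => k ik; first exact: filterT.
  have -> : v i j = dsubmx v k j by rewrite mxE; congr (v _ _); apply: val_inj.
  exact: nB.
move=> w Bw; apply: BA => i j; have := Bw (rshift m i) j.
by rewrite mxE (unsplitK (inr i)).
Qed.

Lemma usubmx_delta m (k : 'I_m) :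
  usubmx (delta_mx (lshift n k) 0 : 'cV[R]_(m + n)) = delta_mx k 0.
Proof. by apply/colP => i; rewrite !mxE eq_lshift. Qed.
Lemma dsubmx_deltal m (k : 'I_m) :
  dsubmx (delta_mx (lshift n k) 0 : 'cV[R]_(m + n)) = 0.
Proof. by apply/colP => i; rewrite !mxE eq_rlshift. Qed.
Lemma usubmx_deltar m (k : 'I_n) :
  usubmx (delta_mx (rshift m k) 0 : 'cV[R]_(m + n)) = 0.
Proof. by apply/colP => i; rewrite !mxE eq_lrshift. Qed.
Lemma dsubmx_delta m (k : 'I_n) :
  dsubmx (delta_mx (rshift m k) 0 : 'cV[R]_(m + n)) = delta_mx k 0.
Proof. by apply/colP => i; rewrite !mxE eq_rshift. Qed.

End Coordinates.

(** * Differential calculus in one chart *)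

(** What the calculus in a single chart relies on, isolated so that it serves M, the sphere and the
    twistor space alike. *)
Definition good_chart (R : realType) (n : nat) (T : Type) (A : atlas R n T)
    (c : idx A) : Prop :=
  open (chart A c @` dom A c) /\
  forall x, dom A c x -> param A c (chart A c x) = x.

Section ChartCalculus.
Variables (R : realType) (n : nat) (T : Type) (A : atlas R n T) (c : idx A).
Hypothesis cP : good_chart c.
Let U := chart A c @` dom A c.
Let oU : open U := cP.1.
Let cK := cP.2.

Lemma chart_mem x : dom A c x -> U (chart A c x).
Proof. by exists x. Qed.

Lemma param_dom v : U v -> dom A c (param A c v).
Proof. by move=> [x cx <-]; rewrite cK. Qed.

Lemma paramK v : U v -> chart A c (param A c v) = v.
Proof. by move=> [x cx <-]; rewrite cK. Qed.

Section Real.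
Implicit Types (f g : T -> R) (x : T).

Lemma smooth_ext f g : {in dom A c, f =1 g} -> smooth c f -> smooth c g.
Proof.
move=> fg; apply: smooth_on_ext => // v; rewrite inE => Uv.
by apply: fg; rewrite inE; apply: param_dom.
Qed.

Lemma smooth_cst (a : R) : smooth c (fun=> a).
Proof. exact: smooth_on_cst. Qed.

Lemma smooth_add f g : smooth c f -> smooth c g -> smooth c (fun x => f x + g x).
Proof. exact: smooth_on_add. Qed.

Lemma smooth_mul f g : smooth c f -> smooth c g -> smooth c (fun x => f x * g x).
Proof. exact: smooth_on_mul. Qed.

Lemma smooth_opp f : smooth c f -> smooth c (fun x => - f x).
Proof. exact: smooth_on_opp. Qed.

Lemma smooth_inv f : (forall x, dom A c x -> f x != 0) ->
  smooth c f -> smooth c (fun x => (f x)^-1).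
Proof.
by move=> f0; apply: smooth_on_inv => // v /param_dom; apply: f0.
Qed.

Lemma pder_ext k f g x : dom A c x -> {in dom A c, f =1 g} ->
  pder c k f x = pder c k g x.
Proof.
move=> cx fg; apply: near_eq_derive; apply: (open_near_eq oU) (chart_mem cx) => v.
by rewrite inE => /param_dom cv; apply: fg; rewrite inE.
Qed.

Lemma pder_cst k (a : R) x : pder c k (fun=> a) x = 0.
Proof. exact: derive_cst. Qed.

Lemma pder_add k f g x : dom A c x -> smooth c f -> smooth c g ->
  pder c k (fun x => f x + g x) x = pder c k f x + pder c k g x.
Proof.
move=> /chart_mem cx sf sg.
rewrite /pder.
by have <- := deriveD (smooth_on_derivable sf k cx) (smooth_on_derivable sg k cx).
Qed.

Lemma pder_mul k f g x : dom A c x -> smooth c f -> smooth c g ->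
  pder c k (fun x => f x * g x) x = pder c k f x * g x + f x * pder c k g x.
Proof.
move=> cx' sf sg; have cx := chart_mem cx'.
rewrite /pder.
have := deriveM (smooth_on_derivable sf k cx) (smooth_on_derivable sg k cx).
by rewrite /GRing.scale/= cK// => ->; rewrite addrC [in LHS]mulrC.
Qed.

Lemma pder_opp k f x : dom A c x -> smooth c f ->
  pder c k (fun x => - f x) x = - pder c k f x.
Proof.
move=> /chart_mem cx sf; rewrite /pder.
by have <- := deriveN (smooth_on_derivable sf k cx).
Qed.

End Real.

Section Complex.
Implicit Types (f g : T -> R[i]) (x : T).

Lemma csmooth_ext f g : {in dom A c, f =1 g} -> csmooth c f -> csmooth c g.
Proof.
by move=> fg [s1 s2]; split; [apply: smooth_ext s1|apply: smooth_ext s2] => y /fg ->.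
Qed.

Lemma csmooth_cst (a : R[i]) : csmooth c (fun=> a).
Proof. by split; exact: smooth_cst. Qed.

Lemma csmooth_real (f : T -> R) : smooth c f -> csmooth c (fun x => (f x)%:C).
Proof. by move=> sf; split=> //; exact: smooth_cst. Qed.

Lemma csmooth_add f g :
  csmooth c f -> csmooth c g -> csmooth c (fun x => f x + g x).
Proof.
move=> [f1 f2] [g1 g2]; split.
  apply: smooth_ext (smooth_add f1 g1) => x _.
  by case: (f x) (g x) => [? ?] [].
apply: smooth_ext (smooth_add f2 g2) => x _.
by case: (f x) (g x) => [? ?] [].
Qed.

Lemma csmooth_opp f : csmooth c f -> csmooth c (fun x => - f x).
Proof.
move=> [f1 f2]; split.
  by apply: smooth_ext (smooth_opp f1) => x _; case: (f x).
by apply: smooth_ext (smooth_opp f2) => x _; case: (f x).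
Qed.

Lemma csmooth_mul f g :
  csmooth c f -> csmooth c g -> csmooth c (fun x => f x * g x).
Proof.
move=> [f1 f2] [g1 g2]; split.
  apply: smooth_ext (smooth_add (smooth_mul f1 g1) (smooth_opp (smooth_mul f2 g2))).
  by move=> x _; case: (f x) (g x) => [? ?] [].
apply: smooth_ext (smooth_add (smooth_mul f1 g2) (smooth_mul f2 g1)).
by move=> x _; case: (f x) (g x) => [? ?] [].
Qed.

Lemma csmooth_sum (I : Type) (r : seq I) (P : pred I) (F : I -> T -> R[i]) :
  (forall i, csmooth c (F i)) -> csmooth c (fun x => \sum_(i <- r | P i) F i x).
Proof.
move=> sF; elim: r => [|i r ih].
  by under eq_fun do rewrite big_nil; exact: csmooth_cst.
under eq_fun do rewrite big_cons.
by case: (P i) => //; apply: csmooth_add.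
Qed.

Lemma cpder_ext k f g x : dom A c x -> {in dom A c, f =1 g} ->
  cpder c k f x = cpder c k g x.
Proof. by move=> cx fg; congr (_ +i* _); apply: pder_ext => // y /fg ->. Qed.

Lemma cpder_cst k (a : R[i]) x : cpder c k (fun=> a) x = 0.
Proof. by rewrite /cpder !pder_cst. Qed.

Lemma cpder_real k (f : T -> R) x : cpder c k (fun x => (f x)%:C) x = (pder c k f x)%:C.
Proof. by rewrite /cpder /= pder_cst. Qed.

Lemma cpder_add k f g x : dom A c x -> csmooth c f -> csmooth c g ->
  cpder c k (fun x => f x + g x) x = cpder c k f x + cpder c k g x.
Proof.
move=> cx [f1 f2] [g1 g2]; rewrite /cpder.
rewrite (@pder_ext k _ (fun y => complex.Re (f y) + complex.Re (g y)))//; last first.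
  by move=> y _; case: (f y) (g y) => [? ?] [].
rewrite (@pder_ext k (fun y => complex.Im (f y + g y))
    (fun y => complex.Im (f y) + complex.Im (g y)))//; last first.
  by move=> y _; case: (f y) (g y) => [? ?] [].
by rewrite !pder_add.
Qed.

Lemma cpder_opp k f x : dom A c x -> csmooth c f ->
  cpder c k (fun x => - f x) x = - cpder c k f x.
Proof.
move=> cx [f1 f2]; rewrite /cpder.
rewrite (@pder_ext k _ (fun y => - complex.Re (f y)))//; last first.
  by move=> y _; case: (f y).
rewrite (@pder_ext k (fun y => complex.Im (- f y))
    (fun y => - complex.Im (f y)))//; last first.
  by move=> y _; case: (f y).
by rewrite !pder_opp.
Qed.

Lemma cpder_mul k f g x : dom A c x -> csmooth c f -> csmooth c g ->
  cpder c k (fun x => f x * g x) x = cpder c k f x * g x + f x * cpder c k g x.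
Proof.
move=> cx [f1 f2] [g1 g2]; rewrite /cpder.
rewrite (@pder_ext k _ (fun y => complex.Re (f y) * complex.Re (g y)
                             + - (complex.Im (f y) * complex.Im (g y))))//; last first.
  by move=> y _; case: (f y) (g y) => [? ?] [].
rewrite (@pder_ext k (fun y => complex.Im (f y * g y))
    (fun y => complex.Re (f y) * complex.Im (g y)
                             + complex.Im (f y) * complex.Re (g y)))//; last first.
  by move=> y _; case: (f y) (g y) => [? ?] [].
rewrite !pder_add//; do ?[exact: smooth_mul|apply: smooth_opp; exact: smooth_mul].
rewrite pder_opp//; last exact: smooth_mul.
rewrite !pder_mul//; move: (f x) (g x) => [a b] [a' b'] /=.
by congr (_ +i* _); ring.
Qed.

Lemma cpder_sum k (I : Type) (r : seq I) (P : pred I) (F : I -> T -> R[i]) x :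
  dom A c x -> (forall i, csmooth c (F i)) ->
  cpder c k (fun x => \sum_(i <- r | P i) F i x) x =
  \sum_(i <- r | P i) cpder c k (F i) x.
Proof.
move=> cx sF; elim: r => [|i r ih].
  by under eq_fun do rewrite big_nil; rewrite big_nil cpder_cst.
under eq_fun do rewrite big_cons; rewrite big_cons.
by case: (P i) => //; rewrite cpder_add ?ih//; exact: csmooth_sum.
Qed.

End Complex.

Section Matrix.
Variables (p q r : nat).
Implicit Types (X : T -> 'M[R[i]]_(p, q)) (Y : T -> 'M[R[i]]_(q, r)).

Definition csmooth_mx (p q : nat) (X : T -> 'M[R[i]]_(p, q)) : Prop :=
  forall i j, csmooth c (fun x => X x i j).

Definition dmx (p q : nat) (k : 'I_n) (X : T -> 'M[R[i]]_(p, q)) x :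
  'M[R[i]]_(p, q) := \matrix_(i, j) cpder c k (fun y => X y i j) x.

Lemma csmooth_mx_ext X X' : {in dom A c, X =1 X'} -> csmooth_mx X -> csmooth_mx X'.
Proof. by move=> XX' sX i j; apply: csmooth_ext (sX i j) => y /XX' ->. Qed.

Lemma csmooth_mxD X X' : csmooth_mx X -> csmooth_mx X' ->
  csmooth_mx (fun x => X x + X' x).
Proof.
by move=> sX sX' i j; under eq_fun do rewrite mxE; exact: csmooth_add.
Qed.

Lemma csmooth_mxM X Y : csmooth_mx X -> csmooth_mx Y ->
  csmooth_mx (fun x => X x *m Y x).
Proof.
move=> sX sY i j; under eq_fun do rewrite mxE.
by apply: csmooth_sum => k; apply: csmooth_mul.
Qed.

Lemma csmooth_mxZ (s : T -> R[i]) X : csmooth c s -> csmooth_mx X ->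
  csmooth_mx (fun x => s x *: X x).
Proof. by move=> ss sX i j; under eq_fun do rewrite mxE; exact: csmooth_mul. Qed.

Lemma csmooth_mx_cst (M : 'M[R[i]]_(p, q)) : csmooth_mx (fun=> M).
Proof. by move=> i j; exact: csmooth_cst. Qed.

Lemma csmooth_mxT X : csmooth_mx X -> csmooth_mx (fun x => (X x)^T).
Proof. by move=> sX i j; under eq_fun do rewrite mxE. Qed.

Lemma dmx_ext k X X' x : dom A c x -> {in dom A c, X =1 X'} -> dmx k X x = dmx k X' x.
Proof.
by move=> cx XX'; apply/matrixP => i j; rewrite !mxE; apply: cpder_ext => // y /XX' ->.
Qed.

Lemma dmx_cst k (M : 'M[R[i]]_(p, q)) x : dmx k (fun=> M) x = 0.
Proof. by apply/matrixP => i j; rewrite !mxE cpder_cst. Qed.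

Lemma dmxD k X X' x : dom A c x -> csmooth_mx X -> csmooth_mx X' ->
  dmx k (fun x => X x + X' x) x = dmx k X x + dmx k X' x.
Proof.
move=> cx sX sX'; apply/matrixP => i j; rewrite !mxE.
by under [in LHS]eq_fun do rewrite mxE; rewrite cpder_add.
Qed.

Lemma dmxM k X Y x : dom A c x -> csmooth_mx X -> csmooth_mx Y ->
  dmx k (fun x => X x *m Y x) x = dmx k X x *m Y x + X x *m dmx k Y x.
Proof.
move=> cx sX sY; apply/matrixP => i j; rewrite !mxE.
under [in LHS]eq_fun do rewrite mxE.
rewrite cpder_sum//; last by move=> l; exact: csmooth_mul.
rewrite -big_split; apply: eq_bigr => l _ /=.
by rewrite cpder_mul// !mxE.
Qed.

Lemma dmxZ k (s : T -> R[i]) X x : dom A c x -> csmooth c s -> csmooth_mx X ->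
  dmx k (fun x => s x *: X x) x = cpder c k s x *: X x + s x *: dmx k X x.
Proof.
move=> cx ss sX; apply/matrixP => i j; rewrite !mxE.
by under [in LHS]eq_fun do rewrite mxE; rewrite cpder_mul.
Qed.

Lemma dmxT k X x : dmx k (fun x => (X x)^T) x = (dmx k X x)^T.
Proof. by apply/matrixP => i j; rewrite !mxE; under eq_fun do rewrite mxE. Qed.

End Matrix.

(** Cramer's rule: the entries are cofactors divided by the determinant. *)
Lemma smooth_invmx (m : nat) (X : T -> 'M[R]_m) :
  (forall x, dom A c x -> X x \in unitmx) ->
  (forall i j, smooth c (fun x => X x i j)) ->
  forall i j, smooth c (fun x => invmx (X x) i j).
Proof.
move=> uX sX i j.
have sdet k (Y : T -> 'M[R]_k) : (forall i j, smooth c (fun x => Y x i j)) ->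
    smooth c (fun x => \det (Y x)).
  move=> sY; apply: smooth_on_sum => // s; apply: smooth_on_mul => //.
    exact: smooth_on_cst.
  by apply: smooth_on_prod => // l; apply: sY.
apply: (smooth_ext (f := fun x => (\det (X x))^-1 * cofactor (X x) j i)).
  by move=> x; rewrite inE => cx; rewrite /invmx uX// !mxE.
apply: smooth_mul.
  apply: smooth_inv (sdet _ _ sX) => x cx.
  by have := uX x cx; rewrite unitmxE unitfE.
apply: smooth_mul; first exact: smooth_cst.
by apply: sdet => a b; under eq_fun do rewrite !mxE; exact: sX.
Qed.

End ChartCalculus.

(** * The sphere *)

Section ChartCoordinates.
Variables (R : realType) (n : nat) (T : Type) (A : atlas R n T) (c : idx A).
Hypothesis cP : good_chart c.

Lemma smooth_chart i : smooth c (fun x => chart A c x i 0).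
Proof.
apply: smooth_on_ext (smooth_on_coord i cP.1) => [|v]; first exact: cP.1.
by rewrite inE => Uv; rewrite paramK.
Qed.

Lemma pder_chart k i x : dom A c x -> pder c k (fun y => chart A c y i 0) x = (i == k)%:R.
Proof.
move=> cx; rewrite /pder.
rewrite (@near_eq_derive _ _ _ _ (fun v : 'cV[R]_n => v i 0)).
  by have [_ ->] := is_derive_coord i (chart A c x) (delta_mx k 0); rewrite mxE eqxx andbT.
apply: (open_near_eq cP.1) (chart_mem cx) => v.
by rewrite inE => Uv; rewrite (paramK cP).
Qed.

End ChartCoordinates.

Section Sphere.
Variable R : realType.
Implicit Types (a : sphere R) (b : bool) (l : 'cV[R]_2).
Let S := sphere_atlas R.

Lemma sphereP a : scomp 0 a ^+ 2 + scomp 1 a ^+ 2 + scomp 2 a ^+ 2 = 1.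
Proof.
have := set_valP a; rewrite /= !big_ord_recl big_ord0 addr0 addrA => <-.
by rewrite /scomp; congr (_ + _ ^+ 2 + _ ^+ 2); congr (_ _ 0); apply: val_inj.
Qed.

Lemma sphere_eq a a' : (forall i, scomp i a = scomp i a') -> a = a'.
Proof. by move=> h; apply: val_inj; apply/colP => i; apply: h. Qed.

Lemma I3_ind (P : 'I_3 -> Prop) : P 0 -> P 1 -> P 2 -> forall i, P i.
Proof.
by move=> p0 p1 p2 [[|[|[]]]// h]; [move: p0|move: p1|move: p2]; congr (P _); apply: val_inj.
Qed.

Lemma I2_ind (P : 'I_2 -> Prop) : P 0 -> P 1 -> forall i, P i.
Proof.
by move=> p0 p1 [[|[]]// h]; [move: p0|move: p1]; congr (P _); apply: val_inj.
Qed.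

(** The first coordinate of the point that the chart [b] omits. As a sign it also lets both charts
    be treated by the same formulas. *)
Definition pole b : R := if b then 1 else -1.

Lemma pole_mul b : pole b * pole b = 1.
Proof. by case: b; rewrite /pole ?mulrNN mulr1. Qed.

Definition rad l : R := (1 + sqnorm2 l)^-1.

Lemma radP l : rad l * (1 + l 0 0 ^+ 2 + l 1 0 ^+ 2) = 1.
Proof. by rewrite /rad -addrA mulVf// sqnorm2_neq0. Qed.

Lemma scomp_param b l :
  [/\ scomp 0 (param S b l) = pole b * (1 - 2 * rad l),
      scomp 1 (param S b l) = pole b * (2 * l 1 0 * rad l) &
      scomp 2 (param S b l) = 2 * l 0 0 * rad l].
Proof.
have := sqnorm2_neq0 l; rewrite /rad => h.
case: b; rewrite /scomp /set_val /= /stereo_vec /stereo_inv_vec !mxE /=.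
  by split; field.
by split; field.
Qed.

Lemma sphere_paramK b l : chart S b (param S b l) = l.
Proof.
have [e0 e1 e2] := scomp_param b l; have h := sqnorm2_neq0 l.
have r0 : rad l != 0 by rewrite invr_eq0.
move: (param S b l) e0 e1 e2 => p; rewrite /pole; case: b => e0 e1 e2.
  have d : 1 - scomp 0 p = 2 * rad l by rewrite e0; ring.
  by apply/colP; apply: I2_ind; rewrite mxE /= d ?e1 ?e2; field.
have d : 1 + scomp 0 p = 2 * rad l by rewrite e0; ring.
by apply/colP; apply: I2_ind; rewrite mxE /= d ?e1 ?e2; field.
Qed.

Lemma sphere_domE b a : dom S b a = (scomp 0 a != pole b) :> Prop.
Proof. by []. Qed.

Lemma sphere_param_dom b l : dom S b (param S b l).
Proof.
rewrite sphere_domE; have [-> _ _] := scomp_param b l.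
have h := sqnorm2_neq0 l; have r0 : rad l != 0 by rewrite invr_eq0.
rewrite mulrBr mulr1 -subr_eq0 addrAC subrr add0r oppr_eq0 !mulf_neq0//.
  by rewrite /pole; case: b; rewrite ?oppr_eq0 oner_eq0.
Qed.

Lemma sphere_chartK b a : dom S b a -> param S b (chart S b a) = a.
Proof.
rewrite sphere_domE => ab; have aP := sphereP a.
pose s := pole b; have ss : s * s = 1 := pole_mul b.
have s0 : 1 - s * scomp 0 a != 0.
  apply: contra ab => /eqP h; rewrite -subr_eq0; apply/eqP.
  transitivity (s * s * scomp 0 a - s); first by rewrite ss mul1r.
  by transitivity (- s * (1 - s * scomp 0 a)); [ring|rewrite h mulr0].
have cE : chart S b a 0 0 = scomp 2 a / (1 - s * scomp 0 a) /\
          chart S b a 1 0 = s * scomp 1 a / (1 - s * scomp 0 a).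
  by rewrite /s /S /=; case: (b); rewrite !mxE /= ?mul1r ?mulN1r ?opprK.
(* On the sphere a1^2 + a2^2 = (1 - s a0)(1 + s a0), so the squared norm of the chart is (1 + s a0)
   / (1 - s a0). *)
have rE : rad (chart S b a) = (1 - s * scomp 0 a) / 2.
  rewrite /rad /sqnorm2; case: cE => -> ->.
  rewrite (_ : 1 + _ = 2 / (1 - s * scomp 0 a)) ?invf_div//.
  have e : scomp 2 a ^+ 2 + (s * scomp 1 a) ^+ 2 =
      (1 - s * scomp 0 a) * (1 + s * scomp 0 a).
    transitivity (scomp 0 a ^+ 2 + scomp 1 a ^+ 2 + scomp 2 a ^+ 2 - scomp 0 a ^+ 2
        + (s * s - 1) * scomp 1 a ^+ 2); first by ring.
    by rewrite aP ss subrr mul0r addr0; transitivity (1 - (s * s) * scomp 0 a ^+ 2);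
      [rewrite ss mul1r|ring].
  by rewrite !expr_div_n -mulrDl e; field.
have [e0 e1 e2] := scomp_param b (chart S b a).
apply: sphere_eq; apply: I3_ind; rewrite ?e0 ?e1 ?e2 rE -/s ?cE.1 ?cE.2.
- by transitivity (s * s * scomp 0 a); [field|rewrite ss mul1r].
- by transitivity (s * s * scomp 1 a); [field|rewrite ss mul1r].
- by field.
Qed.

Lemma sphere_codom b : chart S b @` dom S b = setT.
Proof.
apply/seteqP; split=> // l _; exists (param S b l); first exact: sphere_param_dom.
exact: sphere_paramK.
Qed.

Lemma sphere_good b : good_chart (A := S) b.
Proof.
by split=> [|a ab]; [rewrite sphere_codom; exact: openT|exact: sphere_chartK].
Qed.

Lemma scomp_continuous i : continuous (@scomp R i).
Proof.
move=> a; apply: (@continuous_comp _ _ _ set_val (fun v : 'cV[R]_3 => v i 0)).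
  exact: initial_continuous.
exact: coord_continuous.
Qed.

Lemma sphere_dom_open b : open (dom S b).
Proof.
rewrite (_ : dom S b = scomp 0 @^-1` [set y | y != pole b]).
  apply: open_comp => [a _|]; first exact: scomp_continuous.
  exact: open_neq.
by apply/seteqP; split=> a; rewrite sphere_domE.
Qed.

Lemma sphere_cover a : exists b, dom S b a.
Proof.
have [e|ne] := eqVneq (scomp 0 a) (pole true); last by exists true.
exists false; rewrite sphere_domE e -subr_eq0 opprK.
by rewrite (_ : pole true + 1 = 2%:R) ?pnatr_eq0.
Qed.

Section Derivatives.
Variables (b : bool) (a : sphere R).
Hypothesis ab : dom S b a.
Let x (i : 'I_2) (a : sphere R) : R := chart S b a i 0.
Let r (a : sphere R) : R := rad (chart S b a).
Let s := pole b.

Let bP := sphere_good b.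
Let sx i : smooth (A := S) b (x i). Proof. exact: smooth_chart. Qed.
Let xE i k : pder (A := S) b k (x i) a = (i == k)%:R. Proof. exact: pder_chart. Qed.

Let sq a := 1 + x 0 a * x 0 a + x 1 a * x 1 a.
Let ssq : smooth (A := S) b sq.
Proof.
apply: smooth_add; [exact: bP| |exact: smooth_mul].
apply: smooth_add; [exact: bP|exact: smooth_cst|exact: smooth_mul].
Qed.

Let rsq a' : r a' * sq a' = 1.
Proof. by rewrite /r /sq -!expr2 radP. Qed.

Let sq0 a' : sq a' != 0.
Proof. by have := oner_neq0 R; rewrite -(rsq a') mulf_eq0 negb_or => /andP[]. Qed.

Let sr : smooth (A := S) b r.
Proof.
apply: smooth_ext (smooth_inv bP (fun a _ => sq0 a) ssq) => // a' _.
by rewrite -[LHS]mul1r -(rsq a') mulfK.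
Qed.

Let rE k : pder (A := S) b k r a = - (2 * x k a * r a ^+ 2).
Proof.
(* The derivative of [r] is obtained by differentiating r sq = 1. *)
have e : pder (A := S) b k (fun a => r a * sq a) a = 0.
  by rewrite (@pder_ext _ _ _ _ _ bP _ _ (fun=> 1))// pder_cst.
rewrite (pder_mul bP)// in e.
have dsq : pder (A := S) b k sq a = 2 * x k a.
  rewrite /sq pder_add//; last exact: smooth_mul.
    rewrite pder_add//; [|exact: smooth_cst|exact: smooth_mul].
    rewrite pder_cst !(pder_mul bP)// !xE.
    by move: k {e}; apply: I2_ind => /=; rewrite ?eqxx; ring.
  by apply: smooth_add => //; [exact: smooth_cst|exact: smooth_mul].
apply/eqP; rewrite -subr_eq0; apply/eqP.
transitivity (r a * (pder (A := S) b k r a * sq a + r a * pder (A := S) b k sq a)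
   + (1 - r a * sq a) * pder (A := S) b k r a); last first.
  by rewrite e rsq subrr mulr0 mul0r addr0.
by rewrite dsq; ring.
Qed.

Let scompE (a' : sphere R) : dom S b a' ->
  [/\ scomp 0 a' = s * (1 - 2 * r a'), scomp 1 a' = s * (2 * (x 1 a' * r a')) &
      scomp 2 a' = 2 * (x 0 a' * r a')].
Proof.
move=> h; have [e0 e1 e2] := scomp_param b (chart S b a').
by rewrite !mulrA; rewrite (sphere_chartK h) in e0 e1 e2; rewrite e0 e1 e2 !mulrA.
Qed.

Let sxr i : smooth (A := S) b (fun a => x i a * r a). Proof. exact: smooth_mul. Qed.
Let sZ (k : R) f : smooth (A := S) b f -> smooth (A := S) b (fun a => k * f a).
Proof. by move=> sf; apply: smooth_mul => //; exact: smooth_cst. Qed.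
Let pZ (k : R) f m : smooth (A := S) b f ->
  pder (A := S) b m (fun a => k * f a) a = k * pder (A := S) b m f a.
Proof.
move=> sf; rewrite (pder_mul bP)//; last exact: smooth_cst.
by rewrite pder_cst mul0r add0r.
Qed.

Lemma smooth_scomp i : smooth (A := S) b (@scomp R i).
Proof.
move: i; apply: I3_ind.
- apply: (@smooth_ext _ _ _ _ _ bP (fun a => s * (1 + (- 2) * r a))) => //.
    by move=> a'; rewrite inE mulNr => /scompE[->].
  by apply: sZ; apply: smooth_add => //; [exact: smooth_cst|exact: sZ].
- apply: (@smooth_ext _ _ _ _ _ bP (fun a => s * (2 * (x 1 a * r a)))) => //.
    by move=> a'; rewrite inE => /scompE[_ ->].
  by do 2!apply: sZ.
- apply: (@smooth_ext _ _ _ _ _ bP (fun a => 2 * (x 0 a * r a))) => //.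
    by move=> a'; rewrite inE => /scompE[_ _ ->].
  by apply: sZ.
Qed.

Lemma pder_scomp k :
  [/\ pder (A := S) b k (@scomp R 0) a = s * (4 * x k a * r a ^+ 2),
      pder (A := S) b k (@scomp R 1) a =
        s * (2 * ((1 == k)%:R * r a - 2 * x 1 a * x k a * r a ^+ 2)) &
      pder (A := S) b k (@scomp R 2) a =
        2 * ((0 == k)%:R * r a - 2 * x 0 a * x k a * r a ^+ 2)].
Proof.
split.
- rewrite (@pder_ext _ _ _ _ _ bP _ _ (fun a => s * (1 + (- 2) * r a)))//; last first.
    by move=> a'; rewrite inE mulNr => /scompE[->].
  rewrite pZ; last by apply: smooth_add => //; [exact: smooth_cst|exact: sZ].
  rewrite pder_add//; [|exact: smooth_cst|exact: sZ].
  by rewrite pder_cst pZ// rE; ring.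
- rewrite (@pder_ext _ _ _ _ _ bP _ _ (fun a => s * (2 * (x 1 a * r a))))//; last first.
    by move=> a'; rewrite inE => /scompE[_ ->].
  rewrite !pZ//; last by apply: sZ.
  by rewrite (pder_mul bP)// xE rE; ring.
- rewrite (@pder_ext _ _ _ _ _ bP _ _ (fun a => 2 * (x 0 a * r a)))//; last first.
    by move=> a'; rewrite inE => /scompE[_ _ ->].
  by rewrite pZ// (pder_mul bP)// xE rE; ring.
Qed.

(* The Cauchy-Riemann equations of the embedding: the complex structure of the
   sphere at [a] is the cross product with [a]. *)
Lemma sphere_cauchy_riemann :
  let D k i := pder (A := S) b k (@scomp R i) a in
  [/\ D 0 1 * scomp 2 a - D 0 2 * scomp 1 a = - D 1 0,
      D 0 2 * scomp 0 a - D 0 0 * scomp 2 a = - D 1 1,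
      D 0 0 * scomp 1 a - D 0 1 * scomp 0 a = - D 1 2 &
      [/\ D 1 1 * scomp 2 a - D 1 2 * scomp 1 a = D 0 0,
          D 1 2 * scomp 0 a - D 1 0 * scomp 2 a = D 0 1 &
          D 1 0 * scomp 1 a - D 1 1 * scomp 0 a = D 0 2]].
Proof.
move=> D; rewrite /D; have [-> -> ->] := pder_scomp 0; have [-> -> ->] := pder_scomp 1.
have [-> -> ->] := scompE ab; rewrite !eqxx /=.
have := rsq a; have := sq0 a; rewrite /sq /s /pole.
move: (x 0 a) (x 1 a) (r a) => u v w q0 /(canRL (mulfK q0)) ->; rewrite mul1r.
by case: (b); split; [field|field|field|split; field|field|field|field|split; field].
Qed.

End Derivatives.
End Sphere.

Lemma manifold_good_chart (R : realType) (n : nat) (T : topologicalType)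
  (A : atlas R n T) (c : idx A) : is_manifold A -> good_chart c.
Proof. by move=> hA; split; [exact: mfd_codom_open|exact: mfd_chartK]. Qed.

(** * Calculus on a product *)

Section ProductAtlas.
Variables (R : realType) (m n : nat) (S T : Type) (A : atlas R m S) (B : atlas R n T).
Let Z := prod_atlas A B.
Variables (c : idx A) (d : idx B).
Hypotheses (cP : good_chart c) (dP : good_chart d).

Lemma prod_codom (v : 'cV[R]_(m + n)) : (chart Z (c, d) @` dom Z (c, d)) v <->
  (chart A c @` dom A c) (usubmx v) /\ (chart B d @` dom B d) (dsubmx v).
Proof.
split=> [[[x y] [/= cx dy] <-]|[[x cx ex] [y dy ey]]].
  by rewrite col_mxKu col_mxKd; split; [exists x|exists y].
by exists (x, y) => //=; rewrite ex ey vsubmxK.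
Qed.

Lemma prod_good_chart : good_chart (A := Z) (c, d).
Proof.
split=> [|[x y] [/= cx dy]]; last first.
  by rewrite col_mxKu col_mxKd cP.2// dP.2.
rewrite (_ : chart Z (c, d) @` _ =
  usubmx @^-1` (chart A c @` dom A c) `&` dsubmx @^-1` (chart B d @` dom B d)).
  apply: openI.
    by apply: open_comp cP.1 => v _; exact: continuous_usubmx.
  by apply: open_comp dP.1 => v _; exact: continuous_dsubmx.
by apply/seteqP; split=> v; [move=> /prod_codom|move=> h; apply/prod_codom].
Qed.

(** The two difference quotients are the same function of h, because a basis vector of the first
    factor leaves the second coordinate fixed. *)
Lemma pder_prodl (f : S * T -> R) k x y : dom B d y ->
  pder (A := Z) (c, d) (lshift n k) f (x, y) = pder c k (fun x => f (x, y)) x.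
Proof.
move=> dy; pose F v := f (param Z (c, d) v); pose G v := f (param A c v, y).
suff e : (fun h : R => h^-1 *: ((F \o shift (chart Z (c, d) (x, y)))
      (h *: delta_mx (lshift n k) 0) - F (chart Z (c, d) (x, y)))) =
    (fun h => h^-1 *: ((G \o shift (chart A c x)) (h *: delta_mx k 0)
      - G (chart A c x))) by rewrite /pder /derive e.
apply/funext => h; rewrite /F /G /= !linearP /= usubmx_delta dsubmx_deltal.
by rewrite scaler0 add0r col_mxKu col_mxKd dP.2.
Qed.

Lemma pder_prodr (f : S * T -> R) k x y : dom A c x ->
  pder (A := Z) (c, d) (rshift m k) f (x, y) = pder d k (fun y => f (x, y)) y.
Proof.
move=> cx; pose F v := f (param Z (c, d) v); pose G v := f (x, param B d v).
suff e : (fun h : R => h^-1 *: ((F \o shift (chart Z (c, d) (x, y)))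
      (h *: delta_mx (rshift m k) 0) - F (chart Z (c, d) (x, y)))) =
    (fun h => h^-1 *: ((G \o shift (chart B d y)) (h *: delta_mx k 0)
      - G (chart B d y))) by rewrite /pder /derive e.
apply/funext => h; rewrite /F /G /= !linearP /= dsubmx_delta usubmx_deltar.
by rewrite scaler0 add0r col_mxKu col_mxKd cP.2.
Qed.

Lemma cpder_prodl (f : S * T -> R[i]) k x y : dom B d y ->
  cpder (A := Z) (c, d) (lshift n k) f (x, y) = cpder c k (fun x => f (x, y)) x.
Proof. by move=> dy; rewrite /cpder !pder_prodl. Qed.

Lemma cpder_prodr (f : S * T -> R[i]) k x y : dom A c x ->
  cpder (A := Z) (c, d) (rshift m k) f (x, y) = cpder d k (fun y => f (x, y)) y.
Proof. by move=> cx; rewrite /cpder !pder_prodr. Qed.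

Lemma smooth_fst (f : S -> R) : smooth c f -> smooth (A := Z) (c, d) (fun z => f z.1).
Proof.
move=> sf; rewrite /smooth /=.
apply: (smooth_on_comp_linear (p := usubmx)
  (U := chart A c @` dom A c) (f := fun v => f (param A c v))) => //.
- exact: cP.1.
- exact: prod_good_chart.1.
- exact: continuous_usubmx.
- by move=> v /prod_codom[].
- move=> i; case: (fintype.split_ordP i) => j ->.
    by right; exists j; exact: usubmx_delta.
  by left; exact: usubmx_deltar.
Qed.

Lemma smooth_snd (f : T -> R) : smooth d f -> smooth (A := Z) (c, d) (fun z => f z.2).
Proof.
move=> sf; rewrite /smooth /=.
apply: (smooth_on_comp_linear (p := dsubmx)
  (U := chart B d @` dom B d) (f := fun v => f (param B d v))) => //.
- exact: dP.1.
- exact: prod_good_chart.1.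
- exact: continuous_dsubmx.
- by move=> v /prod_codom[].
- move=> i; case: (fintype.split_ordP i) => j ->.
    by left; exact: dsubmx_deltal.
  by right; exists j; exact: dsubmx_delta.
Qed.

End ProductAtlas.

(** * Hypercomplex manifolds *)

Lemma toC_tr (R : realType) m n (X : 'M[R]_(m, n)) : (toC X)^T = toC X^T.
Proof. by apply/matrixP => i j; rewrite !mxE. Qed.

Lemma realC_add3 (R : realType) (a b c : R) (a' b' c' : R[i]) :
  a' = a%:C -> b' = b%:C -> c' = c%:C -> (a + b + c)%:C = a' + b' + c'.
Proof. by move=> -> -> ->; rewrite !rmorphD. Qed.

Lemma realC_torsion (R : realType) (a b c d e f p q : R) (a' b' c' d' e' f' p' q' : R[i]) :
  a' = a%:C -> b' = b%:C -> c' = c%:C -> d' = d%:C ->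
  e' = e%:C -> f' = f%:C -> p' = p%:C -> q' = q%:C ->
  a' * b' - c' * d' + e' * f' - p' * q' = (a * b - c * d + e * f - p * q)%:C.
Proof. by move=> -> -> -> -> -> -> -> ->; rewrite !(rmorphB, rmorphD, rmorphM). Qed.

Section Hypercomplex.
Variables (R : realType) (n : nat) (M : topologicalType) (A : atlas R n M).
Variables (I J K g : field A R).
Hypotheses (hM : is_manifold A) (hIJK : hypercomplex I J K)
  (hg : hyperhermitian I J K g).

Section Pointwise.
Variables (c : idx A) (x : M).
Hypothesis cx : dom A c x.

Lemma hypercomplex_alg : [/\ I c x *m I c x = - 1%:M, J c x *m J c x = - 1%:M,
  K c x *m K c x = - 1%:M, I c x *m J c x = K c x & J c x *m I c x = - K c x].
Proof.
case: hIJK => [[_ II _] [_ JJ _] [_ KK _] /(_ _ _ cx)[IJ JI]].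
by split; [exact: II|exact: JJ|exact: KK|exact: IJ|exact: JI].
Qed.

Lemma metric_sym : (g c x)^T = g c x.
Proof. by case: hg => -[_ _ gT _] _ _ _; exact: gT. Qed.

Lemma metric_unit : g c x \in unitmx.
Proof.
case: hg => -[_ _ _ gpos] _ _ _; rewrite -row_free_unit.
apply: inj_row_free => v vg; apply/eqP; apply: contraT => v0.
have := gpos c x v^T cx; rewrite trmxK vg mul0mx mxE ltxx => h.
by apply: h; apply: contra v0 => /eqP h; rewrite -[v]trmxK h trmx0.
Qed.

Lemma hermitian_at : [/\ (I c x)^T *m g c x *m I c x = g c x,
  (J c x)^T *m g c x *m J c x = g c x & (K c x)^T *m g c x *m K c x = g c x].
Proof. by case: hg => _ gI gJ gK; split; [exact: gI|exact: gJ|exact: gK]. Qed.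

(** Multiply F^T g = - g F by g^-1 on both sides. *)
Lemma metric_inv_skew (F : 'M[R]_n) : F *m F = - 1%:M -> F^T *m g c x *m F = g c x ->
  invmx (g c x) *m F^T = - (F *m invmx (g c x)).
Proof.
move=> FF Fg; have gu := metric_unit.
have e : F^T *m g c x = - (g c x *m F) := hermitian_skew FF Fg.
apply: (can_inj (mulKmx gu)); rewrite mulmxN !mulmxA mulmxV// mul1mx.
by apply: (can_inj (mulmxK gu)); rewrite e mulNmx mulmxKV.
Qed.

Lemma dual_bivector_omega : dual_bivector (omega I g) c x = I c x *m invmx (g c x).
Proof.
have [II _ _ _ _] := hypercomplex_alg; have [gI _ _] := hermitian_at.
have gu := metric_unit.
have e : omega I g c x *m (I c x *m invmx (g c x)) = 1%:M.
  by rewrite /omega mulmxA gI mulmxV.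
have [ou _] := mulmx1_unit e.
by rewrite /dual_bivector -[LHS]mulmx1 -e mulKmx.
Qed.

End Pointwise.

Section Jets.
Variable c : idx A.
Let cP : good_chart c := manifold_good_chart c hM.

Definition cfield (X : field A R) (x : M) : 'M[R[i]]_n := toC (X c x).
Definition cmetric_inv (x : M) : 'M[R[i]]_n := toC (invmx (g c x)).

Lemma csmooth_cfield (X : field A R) : field_smooth X -> csmooth_mx c (cfield X).
Proof.
by move=> sX i j; under eq_fun do rewrite mxE; exact: csmooth_real (sX c i j).
Qed.

Lemma csmooth_structures : [/\ csmooth_mx c (cfield I), csmooth_mx c (cfield J),
  csmooth_mx c (cfield K) & csmooth_mx c (cfield g)].
Proof.
case: hIJK => [[[sI _] _ _] [[sJ _] _ _] [[sK _] _ _] _].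
by case: hg => -[sg _ _ _] _ _ _; split; exact: csmooth_cfield.
Qed.

Lemma csmooth_metric_inv : csmooth_mx c cmetric_inv.
Proof.
move=> i j; under eq_fun do rewrite mxE; apply: csmooth_real => //.
case: hg => -[sg _ _ _] _ _ _.
apply: smooth_invmx => //.
by move=> x; exact: metric_unit.
Qed.

Lemma dmx_cfield k (X : field A R) x :
  dmx c k (cfield X) x = \matrix_(i, j) (pder c k (fun y => X c y i j) x)%:C.
Proof.
apply/matrixP => i j; rewrite mxE [RHS]mxE -cpder_real.
by congr (cpder c k _ x); apply/funext => y; rewrite mxE.
Qed.

Lemma dmx_cfield_entry k (X : field A R) x i j :
  dmx c k (cfield X) x i j = (pder c k (fun y => X c y i j) x)%:C.
Proof. by rewrite dmx_cfield mxE. Qed.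

Lemma torsion_cfield (X : field A R) x : complex_structure X -> dom A c x ->
  forall i j k, torsion (cfield X x) (fun l => dmx c l (cfield X) x) i j k = 0.
Proof.
case=> _ _ NX cx i j k; have cE a b : cfield X x a b = (X c x a b)%:C by rewrite mxE.
transitivity (nijenhuis X c x i j k)%:C; last by rewrite NX// rmorph0.
rewrite /torsion /nijenhuis rmorph_sum; apply: eq_bigr => l _.
by apply: realC_torsion; first [exact: cE|exact: dmx_cfield_entry].
Qed.

Lemma cfield_alg x : dom A c x -> [/\ cfield I x *m cfield I x = - 1%:M,
  cfield J x *m cfield J x = - 1%:M, cfield K x *m cfield K x = - 1%:M,
  cfield I x *m cfield J x = cfield K x & cfield J x *m cfield I x = - cfield K x].
Proof.
move=> /hypercomplex_alg[II JJ KK IJ JI]; rewrite /cfield -!map_mxM.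
by rewrite II JJ KK IJ JI !map_mxN map_mx1.
Qed.

(** The hypotheses of [obata_connection] on derivatives come from differentiating the quaternion
    relations, which hold on the whole chart domain. The family [G] itself is produced at [x]
    only. *)
Lemma obata_at x : dom A c x -> exists G : 'I_n -> 'M[R[i]]_n,
  [/\ forall k l i, G k i l = G l i k,
      forall k, dmx c k (cfield I) x = cfield I x *m G k - G k *m cfield I x,
      forall k, dmx c k (cfield J) x = cfield J x *m G k - G k *m cfield J x &
      forall k, dmx c k (cfield K) x = cfield K x *m G k - G k *m cfield K x].
Proof.
move=> cx; have [sI sJ sK _] := csmooth_structures.
have [II JJ KK IJ JI] := cfield_alg cx.
have [hI hJ hK _] := hIJK.
have dcst X Y B : {in dom A c, (fun y => X y *m Y y) =1 fun=> B} ->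
    csmooth_mx c X -> csmooth_mx c Y ->
    forall k, dmx c k X x *m Y x + X x *m dmx c k Y x = 0.
  by move=> XY sX sY k; rewrite -dmxM// (dmx_ext _ k cx XY) ?dmx_cst.
apply: (@obata_connection _ _ (cfield I x) (cfield J x) (cfield K x)) => //.
- by apply: dcst => // y; rewrite inE => /cfield_alg[->].
- by apply: dcst => // y; rewrite inE => /cfield_alg[_ ->].
- move=> k; rewrite -dmxM//; apply: dmx_ext => // y.
  by rewrite inE => /cfield_alg[_ _ _ ->].
- move=> k; rewrite -dmxM//; apply: dmx_ext => // y.
  rewrite inE => /cfield_alg[II' _ _ _ JI'].
  by rewrite -[cfield K y]opprK -JI' mulNmx -mulmxA II' mulmxN mulmx1 opprK.
- exact: torsion_cfield.
- exact: torsion_cfield.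
- exact: torsion_cfield.
Qed.

Lemma cmetric_invK x : dom A c x -> cfield g x *m cmetric_inv x = 1%:M.
Proof. by move=> /metric_unit gu; rewrite -map_mxM mulmxV// map_mx1. Qed.

Lemma dmx_metric_inv k x : dom A c x ->
  dmx c k cmetric_inv x =
  - (cmetric_inv x *m dmx c k (cfield g) x *m cmetric_inv x).
Proof.
move=> cx; have [_ _ _ sg] := csmooth_structures; have sh := csmooth_metric_inv.
have e : dmx c k (fun y => cfield g y *m cmetric_inv y) x = 0.
  by rewrite (dmx_ext _ _ (X' := fun=> 1%:M))// ?dmx_cst// => y; rewrite inE => /cmetric_invK.
rewrite dmxM// in e.
have hg1 : cmetric_inv x *m cfield g x = 1%:M by apply: mulmx1C; exact: cmetric_invK.
rewrite -[LHS]mul1mx -hg1 -!mulmxA -mulmxN; congr (_ *m _).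
by apply/eqP; rewrite -addr_eq0 addrC e.
Qed.

(* The covariant derivative of the inverse metric for the connection G. *)
Definition nabla_inv (G : 'I_n -> 'M[R[i]]_n) x k : 'M[R[i]]_n :=
  dmx c k cmetric_inv x + G k *m cmetric_inv x + cmetric_inv x *m (G k)^T.

(** Since g^-1 is invertible, this makes the vanishing of nabla g and of nabla g^-1 equivalent. *)
Lemma nabla_invE G x k : dom A c x -> nabla_inv G x k =
  - (cmetric_inv x *m nabla G (cfield g x) (fun k => dmx c k (cfield g) x) k
     *m cmetric_inv x).
Proof.
move=> cx; rewrite /nabla_inv dmx_metric_inv// /nabla !mulmxBr !mulmxBl !mulmxA.
have hg1 : cmetric_inv x *m cfield g x = 1%:M by apply: mulmx1C; exact: cmetric_invK.
rewrite hg1 mul1mx -[_ *m (G k)^T *m _ *m _]mulmxA cmetric_invK// mulmx1.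
by rewrite !opprD !opprK addrAC.
Qed.

Section Connection.
Variables (x : M) (G : 'I_n -> 'M[R[i]]_n).
Hypotheses (cx : dom A c x) (Gsym : forall k l i, G k i l = G l i k).
Let dg k := dmx c k (cfield g) x.
Let D := nabla G (cfield g x) dg.

Let csym : (cfield g x)^T = cfield g x.
Proof. by rewrite toC_tr metric_sym. Qed.

Let dgT k : (dg k)^T = dg k.
Proof.
by rewrite /dg -dmxT; apply: dmx_ext => // y; rewrite inE toC_tr => /metric_sym ->.
Qed.

Section OneStructure.
Variable F : field A R.
Hypotheses (Fs : field_smooth F)
  (FF : forall y, dom A c y -> F c y *m F c y = - 1%:M)
  (Fg : forall y, dom A c y -> (F c y)^T *m g c y *m F c y = g c y)
  (dF : forall k, dmx c k (cfield F) x = cfield F x *m G k - G k *m cfield F x).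

Let CF y : dom A c y -> cfield F y *m cfield F y = - 1%:M.
Proof. by move=> /FF FFy; rewrite -map_mxM FFy map_mxN map_mx1. Qed.

Let CFg y : dom A c y -> (cfield F y)^T *m cfield g y *m cfield F y = cfield g y.
Proof. by move=> /Fg Fgy; rewrite toC_tr -!map_mxM Fgy. Qed.

Let sF := csmooth_cfield Fs.
Let sg : csmooth_mx c (cfield g). Proof. by case: csmooth_structures. Qed.
Let sFT : csmooth_mx c (fun y => (cfield F y)^T). Proof. exact: csmooth_mxT. Qed.

Lemma nabla_hermitian_at k : (cfield F x)^T *m D k *m cfield F x = D k.
Proof.
apply: (nabla_hermitian (dA := fun k => dmx c k (cfield F) x)) => //.
- exact: CFg.
have sFg := csmooth_mxM cP sFT sg.
rewrite /dg -[RHS](dmx_ext cP _ cx (X := fun y => (cfield F y)^T *m cfield g y *m cfield F y)).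
  by rewrite dmxM// dmxM// dmxT mulmxDl.
by move=> y; rewrite inE => /CFg.
Qed.

(** Links the real components of d omega_F to the complexified Dg. It serves both to deduce Dg = 0
    from closedness and to recover closedness from Dg = 0. *)
Lemma closed_nabla_at i j k :
  (pder c i (fun y => omega F g c y j k) x + pder c j (fun y => omega F g c y k i) x
    + pder c k (fun y => omega F g c y i j) x)%:C =
  ((cfield F x)^T *m D i) j k + ((cfield F x)^T *m D j) k i
    + ((cfield F x)^T *m D k) i j.
Proof.
have e l : (dmx c l (cfield F) x)^T *m cfield g x + (cfield F x)^T *m dg l =
    dmx c l (cfield (omega F g)) x.
  rewrite -dmxT -dmxM//; apply: dmx_ext => // y _.
  by rewrite toC_tr -map_mxM.
have E a b l : ((dmx c l (cfield F) x)^T *m cfield g x + (cfield F x)^T *m dg l) a b =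
    (pder c l (fun y => omega F g c y a b) x)%:C.
  exact: etrans (congr1 (fun Y : 'M[R[i]]_n => Y a b) (e l)) (dmx_cfield_entry _ _ _ _ _).
exact: etrans (realC_add3 (E j k i) (E k i j) (E i j k))
  (closed_nabla Gsym dg csym (CF cx) dF (CFg cx) i j k).
Qed.

End OneStructure.

Hypotheses
  (dI : forall k, dmx c k (cfield I) x = cfield I x *m G k - G k *m cfield I x)
  (dJ : forall k, dmx c k (cfield J) x = cfield J x *m G k - G k *m cfield J x)
  (dK : forall k, dmx c k (cfield K) x = cfield K x *m G k - G k *m cfield K x).

Let sI : field_smooth I. Proof. by case: hIJK => -[[]]. Qed.
Let sJ : field_smooth J. Proof. by case: hIJK => _ [[]]. Qed.
Let sK : field_smooth K. Proof. by case: hIJK => _ _ [[]]. Qed.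
Let II y (cy : dom A c y) : I c y *m I c y = - 1%:M.
Proof. by have [] := hypercomplex_alg cy. Qed.
Let JJ y (cy : dom A c y) : J c y *m J c y = - 1%:M.
Proof. by have [] := hypercomplex_alg cy. Qed.
Let KK y (cy : dom A c y) : K c y *m K c y = - 1%:M.
Proof. by have [] := hypercomplex_alg cy. Qed.
Let gI y (cy : dom A c y) : (I c y)^T *m g c y *m I c y = g c y.
Proof. by have [] := hermitian_at cy. Qed.
Let gJ y (cy : dom A c y) : (J c y)^T *m g c y *m J c y = g c y.
Proof. by have [] := hermitian_at cy. Qed.
Let gK y (cy : dom A c y) : (K c y)^T *m g c y *m K c y = g c y.
Proof. by have [] := hermitian_at cy. Qed.

Lemma nabla_metric_sym k : (D k)^T = D k.
Proof. exact: nablaT. Qed.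

Lemma nabla_hyperhermitian X : X \in [:: cfield I x; cfield J x; cfield K x] ->
  forall k, X^T *m D k *m X = D k.
Proof.
by rewrite !inE => /or3P[]/eqP-> k;
  [exact: (nabla_hermitian_at sI)|exact: (nabla_hermitian_at sJ)|exact: (nabla_hermitian_at sK)].
Qed.

Lemma hyperkahler_nabla : hyperkahler I J K g -> forall k, D k = 0.
Proof.
case=> _ cI cJ cK; have [II' JJ' KK' IJ JI] := cfield_alg cx.
apply: (nabla_eq0 csym dgT II' JJ' KK' IJ JI); first exact: nabla_hyperhermitian.
move=> X; rewrite !inE => /or3P[]/eqP-> i j k.
- by rewrite -closed_nabla_at// cI// rmorph0.
- by rewrite -closed_nabla_at// cJ// rmorph0.
- by rewrite -closed_nabla_at// cK// rmorph0.
Qed.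

Lemma nabla_closed : (forall k, D k = 0) -> forall i j k,
  [/\ pder c i (fun y => omega I g c y j k) x + pder c j (fun y => omega I g c y k i) x
      + pder c k (fun y => omega I g c y i j) x = 0,
      pder c i (fun y => omega J g c y j k) x + pder c j (fun y => omega J g c y k i) x
      + pder c k (fun y => omega J g c y i j) x = 0 &
      pder c i (fun y => omega K g c y j k) x + pder c j (fun y => omega K g c y k i) x
      + pder c k (fun y => omega K g c y i j) x = 0].
Proof.
move=> D0 i j k; have C0 (r : R) : r%:C = 0 -> r = 0 by case.
by split; apply: C0; rewrite closed_nabla_at// !D0 !mulmx0 !mxE !addr0.
Qed.

End Connection.

End Jets.
End Hypercomplex.

(** * The bivector on the twistor space *)

Lemma quat_skew (S : comNzRingType) (n : nat) (I J K h : 'M[S]_n) (a b c : S) :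
  h *m I^T = - (I *m h) -> h *m J^T = - (J *m h) -> h *m K^T = - (K *m h) ->
  h *m (quat I J K a b c)^T = - (quat I J K a b c *m h).
Proof.
move=> hI hJ hK.
have -> : (quat I J K a b c)^T = a *: I^T + b *: J^T + c *: K^T.
  by apply/matrixP => i j; rewrite !mxE.
rewrite /quat !mulmxDr !mulmxDl -!(scalemxAl, scalemxAr) hI hJ hK.
by rewrite !scalerN -!opprD.
Qed.

(** Moving the transposed projector past the inverse metric turns the projection onto T^{1,0} into
    that onto T^{0,1}. A (2,0)-part thereby becomes a two-sided quaternion product. *)
Lemma proj_skew (S : fieldType) (n : nat) (q h : 'M[S]_n) (i : S) :
  h *m q^T = - (q *m h) ->
  h *m (2^-1 *: (1%:M - i *: q))^T = 2^-1 *: (1%:M + i *: q) *m h.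
Proof.
move=> hq; have -> : (2^-1 *: (1%:M - i *: q))^T = 2^-1 *: (1%:M - i *: q^T).
  by apply/matrixP => a b; rewrite !mxE eq_sym.
rewrite -!(scalemxAl, scalemxAr) mulmxBr mulmx1 -scalemxAr hq.
by rewrite mulmxDl mul1mx scalerN opprK scalemxAl.
Qed.

Section Twistor.
Variables (R : realType) (n : nat) (M : topologicalType) (A : atlas R n M).
Variables (I J K g : field A R).
Hypotheses (hM : is_manifold A) (hIJK : hypercomplex I J K)
  (hg : hyperhermitian I J K g).
Let Z := twistor_atlas A.
Let F := twistor_complex I J K.
Let P := twistor_bivector I J K g.

Lemma twistor_good_chart (c : idx Z) : good_chart c.
Proof.
case: c => c b; apply: prod_good_chart; first exact: manifold_good_chart.
exact: sphere_good.
Qed.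

Definition sc (i : 'I_3) (z : M * sphere R) : R[i] := (scomp i z.2)%:C.

Lemma scP z : sc 0 z * sc 0 z + sc 1 z * sc 1 z + sc 2 z * sc 2 z = 1.
Proof. by rewrite /sc -!rmorphM -!rmorphD -!expr2 sphereP rmorph1. Qed.

Definition fquat (c : idx A) (x : M) (s1 s2 s3 : R[i]) : 'M[R[i]]_n :=
  quat (cfield c I x) (cfield c J x) (cfield c K x) s1 s2 s3.

Definition fiber_structure c z := fquat c z.1 (sc 0 z) (sc 1 z) (sc 2 z).

(* Twice the (2,0)-part of I for I_a, in the basis I, J, K: this is
   e - (e . a) a + i e x a with e = (1, 0, 0). *)
Definition bcoef (i : 'I_3) (z : M * sphere R) : R[i] :=
  nth 0 [:: 1 - sc 0 z * sc 0 z; - (sc 0 z * sc 1 z) - 'i * sc 2 z;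
            - (sc 0 z * sc 2 z) + 'i * sc 1 z] i.

(** A closed form of the (2,0)-part, suited to differentiation; [fiber_bivectorE] identifies it with
    the projection. *)
Definition fiber_bivector c z :=
  2^-1 *: (fquat c z.1 (bcoef 0 z) (bcoef 1 z) (bcoef 2 z) *m cmetric_inv g c z.1).

Definition fiber_proj c z : 'M[R[i]]_n :=
  2^-1 *: (1%:M - 'i *: fiber_structure c z).
Definition base_proj : 'M[R[i]]_2 := 2^-1 *: (1%:M - 'i *: toC (mul_i R)).

Lemma twistor_complexE (c : idx Z) z :
  toC (F c z) = block_mx (fiber_structure c.1 z) 0 0 (toC (mul_i R)).
Proof.
rewrite /F /twistor_complex map_block_mx !map_mx0; congr block_mx.
by rewrite !map_mxD !map_mxZ.
Qed.

Lemma twistor_projE (c : idx Z) z :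
  proj10 (F c z) = block_mx (fiber_proj c.1 z) 0 0 base_proj.
Proof.
rewrite /proj10 twistor_complexE scale_block_mx scalar_mx_block opp_block_mx.
by rewrite add_block_mx scale_block_mx !(scaler0, subr0).
Qed.

Lemma quat_metric_inv c x a1 a2 a3 : dom A c x ->
  cmetric_inv g c x *m (fquat c x a1 a2 a3)^T = - (fquat c x a1 a2 a3 *m cmetric_inv g c x).
Proof.
move=> cx; have [gI gJ gK] := hermitian_at hg cx.
have [II JJ KK _ _] := hypercomplex_alg hIJK cx.
have e (X : field A R) : X c x *m X c x = - 1%:M ->
    (X c x)^T *m g c x *m X c x = g c x ->
    cmetric_inv g c x *m (cfield c X x)^T = - (cfield c X x *m cmetric_inv g c x).
  by move=> XX gX; rewrite toC_tr -!map_mxM (metric_inv_skew hg cx XX gX) map_mxN.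
by rewrite /fquat quat_skew//; apply: e.
Qed.

Lemma fiber_proj_metric c z : dom A c z.1 ->
  cmetric_inv g c z.1 *m (fiber_proj c z)^T =
  2^-1 *: (1%:M + 'i *: fiber_structure c z) *m cmetric_inv g c z.1.
Proof.
move=> cx; have e : cmetric_inv g c z.1 *m (fiber_structure c z)^T =
    - (fiber_structure c z *m cmetric_inv g c z.1) := quat_metric_inv _ _ _ cx.
exact: proj_skew e.
Qed.

(** Once [fiber_proj_metric] has moved the right projector past the inverse metric, this is
    [quat_sandwich]; the coefficient is 2 / 4. *)
Lemma fiber_sandwich c z s1 s2 s3 : dom A c z.1 ->
  fiber_proj c z *m (fquat c z.1 s1 s2 s3 *m cmetric_inv g c z.1) *m (fiber_proj c z)^T =
  let d := s1 * sc 0 z + s2 * sc 1 z + s3 * sc 2 z in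
  2^-1 *: (fquat c z.1 (s1 - d * sc 0 z + 'i * (s2 * sc 2 z - s3 * sc 1 z))
                       (s2 - d * sc 1 z + 'i * (s3 * sc 0 z - s1 * sc 2 z))
                       (s3 - d * sc 2 z + 'i * (s1 * sc 1 z - s2 * sc 0 z))
           *m cmetric_inv g c z.1).
Proof.
move=> cx /=; rewrite -!mulmxA fiber_proj_metric// !mulmxA.
rewrite /fiber_proj -!(scalemxAl, scalemxAr) scalerA scalemxAl.
have [II JJ _ IJ JI] := cfield_alg hIJK cx.
have ii : 'i * 'i = -1 :> R[i] by rewrite -expr2 sqrCi.
rewrite (quat_sandwich II JJ IJ JI _ _ _ ii (scP z)) scalerA -scalemxAl.
by congr (_ *: _); field.
Qed.

Lemma fquatI c x : fquat c x 1 0 0 = cfield c I x.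
Proof. by rewrite /fquat /quat scale1r !scale0r !addr0. Qed.

Lemma fiber_bivectorE c z : dom A c z.1 -> fiber_bivector c z =
  fiber_proj c z *m (cfield c I z.1 *m cmetric_inv g c z.1) *m (fiber_proj c z)^T.
Proof.
move=> cx; rewrite -fquatI (fiber_sandwich _ _ _ cx) /fiber_bivector /bcoef /=.
set d := 1 * sc 0 z + _ + _.
rewrite (_ : 1 - d * sc 0 z + _ = 1 - sc 0 z * sc 0 z); last by rewrite /d; ring.
rewrite (_ : 0 - d * sc 1 z + _ = - (sc 0 z * sc 1 z) - 'i * sc 2 z); last by rewrite /d; ring.
by rewrite (_ : 0 - d * sc 2 z + _ = - (sc 0 z * sc 2 z) + 'i * sc 1 z)//; rewrite /d; ring.
Qed.

Lemma twistor_sec_jac (c : idx Z) z : dom Z c z ->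
  jac A Z (twistor_sec z.2) c.1 c z.1 = col_mx 1%:M 0.
Proof.
case: c z => c b [x a] [/= cx ab]; have cP := manifold_good_chart c hM.
apply/matrixP => i j; rewrite mxE.
case: (fintype.split_ordP i) => k ->.
  rewrite col_mxEu [RHS]mxE -(pder_chart cP j k cx); congr (pder c j _ x).
  by apply/funext => y; rewrite /= col_mxEu.
rewrite col_mxEd [RHS]mxE -[RHS](pder_cst c j (chart (sphere_atlas R) b a k 0) x).
by congr (pder c j _ x); apply/funext => y; rewrite /= col_mxEd.
Qed.

(** The pushforward has no component along the sphere and the projector is block diagonal, so only
    the block of M survives. *)
Lemma twistor_bivectorE (c : idx Z) z : dom Z c z ->
  P c z = block_mx (fiber_bivector c.1 z) 0 0 0.
Proof.
move=> cz; have [cx _] := cz; rewrite /P /twistor_bivector twistor_sec_jac//.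
rewrite (dual_bivector_omega hIJK hg cx) mul_col_mx mul1mx mul0mx tr_col_mx trmx1 trmx0.
rewrite mul_col_row !(mulmx1, mul0mx, mulmx0) /part20 twistor_projE map_block_mx !map_mx0.
rewrite tr_block_mx !trmx0 !mulmx_block !(mulmx0, mul0mx, addr0) (fiber_bivectorE cx).
have <- : toC (I c.1 z.1 *m invmx (g c.1 z.1)) =
    cfield c.1 I z.1 *m cmetric_inv g c.1 z.1 by rewrite map_mxM.
by [].
Qed.

Lemma fiber_structureK c z : dom A c z.1 ->
  fiber_structure c z *m fiber_structure c z = - 1%:M.
Proof.
move=> cx; have [II JJ _ IJ JI] := cfield_alg hIJK cx.
rewrite /fiber_structure /fquat (quatM II JJ IJ JI) scP.
rewrite (_ : quat _ _ _ _ _ _ = 0) ?addr0//.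
by rewrite /quat !(mulrC (sc 2 z)) !(mulrC (sc 1 z)) !subrr !scale0r !addr0.
Qed.

Lemma fiber_proj_eigen c z : dom A c z.1 ->
  fiber_structure c z *m fiber_proj c z = 'i *: fiber_proj c z.
Proof.
move=> cx; rewrite /fiber_proj -scalemxAr mulmxBr mulmx1 -scalemxAr (fiber_structureK cx).
have e (X : 'M[R[i]]_n) : 2^-1 *: (X - 'i *: - 1%:M) =
    'i *: (2^-1 *: (1%:M - 'i *: X)).
  rewrite [RHS]scalerA ['i * _]mulrC -[RHS]scalerA; congr (_ *: _).
  by rewrite scalerBr scalerA -expr2 sqrCi scaleN1r opprK scalerN opprK addrC.
exact: e.
Qed.

Lemma fiber_bivector_skew c z : dom A c z.1 ->
  (fiber_bivector c z)^T = - fiber_bivector c z.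
Proof.
move=> cx; rewrite (fiber_bivectorE cx) !trmx_mul trmxK.
have hT : (cmetric_inv g c z.1)^T = cmetric_inv g c z.1.
  by rewrite toC_tr trmx_inv (metric_sym hg cx).
rewrite hT -fquatI (quat_metric_inv _ _ _ cx) mulNmx mulmxN -!mulmxA.
by [].
Qed.

Lemma twistor_bivector_eigen (c : idx Z) z : dom Z c z ->
  toC (F c z) *m P c z = 'i *: P c z.
Proof.
move=> cz; have [cx _] := cz; rewrite twistor_complexE (twistor_bivectorE cz).
rewrite mulmx_block !(mulmx0, mul0mx, addr0) scale_block_mx !scaler0.
by rewrite (fiber_bivectorE cx) !mulmxA (fiber_proj_eigen cx) -!scalemxAl.
Qed.

Lemma twistor_bivector_poles (c : idx Z) z : dom Z c z ->
  twistor_proj z = lam0 R \/ twistor_proj z = laminfty R -> P c z = 0.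
Proof.
move=> cz zp; rewrite (twistor_bivectorE cz) /fiber_bivector.
have [e0 e1 e2] : [/\ scomp 0 z.2 * scomp 0 z.2 = 1, scomp 1 z.2 = 0 & scomp 2 z.2 = 0].
  case: zp; rewrite /twistor_proj => ->; rewrite /lam0 /laminfty.
    have [-> -> ->] := scomp_param (R := R) true 0.
    by rewrite /rad /sqnorm2 !mxE /pole; split; field.
  have [-> -> ->] := scomp_param (R := R) false 0.
  by rewrite /rad /sqnorm2 !mxE /pole; split; field.
rewrite /bcoef /= /sc e1 e2 -!rmorphM e0 rmorph0 rmorph1 !mulr0 !subrr !oppr0 !addr0.
rewrite /fquat /quat !scale0r !addr0 mul0mx scaler0.
by rewrite block_mx0.
Qed.

End Twistor.

(** * First derivatives on the twistor space *)

Lemma quat_leibniz (S : comNzRingType) (n : nat) (I J K dI dJ dK : 'M[S]_n)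
    (a b c da db dc : S) :
  da *: I + a *: dI + (db *: J + b *: dJ) + (dc *: K + c *: dK) =
  quat I J K da db dc + quat dI dJ dK a b c.
Proof. by rewrite /quat; mxlin; ring. Qed.

Section TwistorJets.
Variables (R : realType) (n : nat) (M : topologicalType) (A : atlas R n M).
Variables (I J K g : field A R).
Hypotheses (hM : is_manifold A) (hIJK : hypercomplex I J K)
  (hg : hyperhermitian I J K g).
Let Z := twistor_atlas A.
Let P := twistor_bivector I J K g.

Section OneChart.
Variables (c : idx A) (b : bool).
Let cb : idx Z := (c, b).
Let cP : good_chart c := manifold_good_chart c hM.
Let bP : good_chart (A := sphere_atlas R) b := sphere_good R b.
Let cbP : good_chart (A := Z) cb := twistor_good_chart hM cb.

Lemma csmooth_mx_fst p q (X : M -> 'M[R[i]]_(p, q)) :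
  csmooth_mx c X -> csmooth_mx (A := Z) cb (fun z => X z.1).
Proof.
move=> sX i j; have [s1 s2] := sX i j; split.
  exact: (smooth_fst cP bP s1).
exact: (smooth_fst cP bP s2).
Qed.

Lemma csmooth_sc i : csmooth (A := Z) cb (@sc R M i).
Proof.
apply: csmooth_real => //.
by apply: (smooth_snd cP bP); exact: smooth_scomp.
Qed.

Lemma csmooth_bcoef i : csmooth (A := Z) cb (@bcoef R M i).
Proof.
have s := csmooth_sc.
have sM := csmooth_mul cbP; have sN := csmooth_opp cbP; have sD := csmooth_add cbP.
have sC a := csmooth_cst cbP a.
move: i; apply: I3_ind; rewrite /bcoef /=.
- by apply: sD => //; apply: sN; apply: sM.
- by apply: sD; apply: sN; apply: sM.
- by apply: sD; [apply: sN|]; apply: sM.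
Qed.

Lemma csmooth_mx_fquat s1 s2 s3 : csmooth (A := Z) cb s1 -> csmooth (A := Z) cb s2 ->
  csmooth (A := Z) cb s3 ->
  csmooth_mx (A := Z) cb (fun z => fquat I J K c z.1 (s1 z) (s2 z) (s3 z)).
Proof.
move=> h1 h2 h3; have [sI sJ sK _] := csmooth_structures hM hIJK hg c.
by apply: csmooth_mxD => //; [apply: csmooth_mxD => //|];
  apply: csmooth_mxZ => //; apply: csmooth_mx_fst.
Qed.

Lemma csmooth_mx_fiber_structure :
  csmooth_mx (A := Z) cb (fiber_structure I J K c).
Proof. by apply: csmooth_mx_fquat; exact: csmooth_sc. Qed.

Lemma csmooth_mx_metric_inv :
  csmooth_mx (A := Z) cb (fun z => cmetric_inv g c z.1).
Proof. have s := csmooth_metric_inv hM hg c; exact: csmooth_mx_fst s. Qed.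

Lemma csmooth_mx_fiber_bivector :
  csmooth_mx (A := Z) cb (fiber_bivector I J K g c).
Proof.
apply: (csmooth_mxZ cbP (csmooth_cst cbP _)).
apply: (csmooth_mxM cbP); last exact: csmooth_mx_metric_inv.
by apply: csmooth_mx_fquat; exact: csmooth_bcoef.
Qed.

Lemma csmooth_mx_bivector : csmooth_mx (A := Z) cb (P cb).
Proof.
pose B z : 'M[R[i]]_(n + 2) := block_mx (fiber_bivector I J K g c z) 0 0 0.
have e : {in dom Z cb, B =1 P cb}.
  by move=> z; rewrite inE => cz; rewrite /P (twistor_bivectorE hM hIJK hg cz).
suff sB : csmooth_mx (A := Z) cb B by apply: csmooth_mx_ext e sB.
move=> i j.
have s0 := csmooth_cst cbP 0.
rewrite /B; case: (fintype.split_ordP i) => k ->; case: (fintype.split_ordP j) => l ->.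
- under eq_fun do rewrite block_mxEul; exact: csmooth_mx_fiber_bivector.
- by under eq_fun do rewrite block_mxEur mxE.
- by under eq_fun do rewrite block_mxEdl mxE.
- by under eq_fun do rewrite block_mxEdr mxE.
Qed.

Section AtPoint.
Variables (x : M) (a : sphere R).
Hypotheses (cx : dom A c x) (ab : dom (sphere_atlas R) b a).
Let z := (x, a).
Let cz : dom Z cb z. Proof. by []. Qed.

Lemma dmx_fstl p q k (X : M -> 'M[R[i]]_(p, q)) :
  dmx (A := Z) cb (lshift 2 k) (fun z => X z.1) z = dmx c k X x.
Proof.
apply/matrixP => i j; rewrite !mxE.
exact: (cpder_prodl c bP (fun z => X z.1 i j) k x ab).
Qed.

Lemma dmx_fstr p q k (X : M -> 'M[R[i]]_(p, q)) :
  dmx (A := Z) cb (rshift n k) (fun z => X z.1) z = 0.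
Proof.
apply/matrixP => i j; rewrite !mxE.
apply: etrans (cpder_prodr (B := sphere_atlas R) b cP (fun z => X z.1 i j) k a cx) _.
exact: (@cpder_cst _ _ _ (sphere_atlas R) b k (X x i j) a).
Qed.

Lemma cpder_sndl k (f : sphere R -> R[i]) :
  cpder (A := Z) cb (lshift 2 k) (fun z => f z.2) z = 0.
Proof.
apply: etrans (cpder_prodl c bP (fun z => f z.2) k x ab) _.
exact: (@cpder_cst _ _ _ A c k (f a) x).
Qed.

Lemma cpder_scl k i : cpder (A := Z) cb (lshift 2 k) (@sc R M i) z = 0.
Proof. exact: (cpder_sndl k (fun a => (scomp i a)%:C)). Qed.

Lemma cpder_bcoefl k i : cpder (A := Z) cb (lshift 2 k) (@bcoef R M i) z = 0.
Proof. exact: (cpder_sndl k (fun a => bcoef i (x, a))). Qed.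

Lemma cpder_scr k i : cpder (A := Z) cb (rshift n k) (@sc R M i) z =
  (pder (A := sphere_atlas R) b k (@scomp R i) a)%:C.
Proof.
apply: etrans (cpder_prodr (B := sphere_atlas R) b cP (@sc R M i) k a cx) _.
by rewrite /sc /= cpder_real.
Qed.

Lemma dmx_fquat k s1 s2 s3 : csmooth (A := Z) cb s1 -> csmooth (A := Z) cb s2 ->
  csmooth (A := Z) cb s3 ->
  dmx (A := Z) cb k (fun z => fquat I J K c z.1 (s1 z) (s2 z) (s3 z)) z =
  fquat I J K c x (cpder (A := Z) cb k s1 z) (cpder (A := Z) cb k s2 z)
                  (cpder (A := Z) cb k s3 z)
  + quat (dmx (A := Z) cb k (fun z => cfield c I z.1) z)
         (dmx (A := Z) cb k (fun z => cfield c J z.1) z)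
         (dmx (A := Z) cb k (fun z => cfield c K z.1) z) (s1 z) (s2 z) (s3 z).
Proof.
move=> h1 h2 h3; have [sI sJ sK _] := csmooth_structures hM hIJK hg c.
have fI := csmooth_mx_fst sI; have fJ := csmooth_mx_fst sJ; have fK := csmooth_mx_fst sK.
have zI := csmooth_mxZ cbP h1 fI; have zJ := csmooth_mxZ cbP h2 fJ.
have zK := csmooth_mxZ cbP h3 fK; have zIJ := csmooth_mxD cbP zI zJ.
rewrite dmxD// dmxD// !dmxZ// /fquat.
exact: quat_leibniz.
Qed.

End AtPoint.
End OneChart.
End TwistorJets.

(** * Lie derivatives of the bivector along fields of type (0,1) *)

Lemma dir_split (S : comNzRingType) (p q m : nat) (d : 'I_(p + q) -> 'M[S]_m)
    (v : 'cV[S]_(p + q)) :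
  dir d v = dir (fun k => d (lshift q k)) (usubmx v)
            + dir (fun k => d (rshift p k)) (dsubmx v).
Proof.
by rewrite /dir big_split_ord; congr (_ + _); apply: eq_bigr => k _; rewrite mxE.
Qed.

Lemma dir_block (S : comNzRingType) (N p q : nat) (d : 'I_N -> 'M[S]_p) (v : 'cV[S]_N) :
  dir (fun k => block_mx (d k) 0 0 0 : 'M[S]_(p + q)) v = block_mx (dir d v) 0 0 0.
Proof.
rewrite /dir; elim/big_rec2: _ => [|k X Y _ ->]; first by rewrite block_mx0.
by rewrite scale_block_mx add_block_mx !scaler0 !addr0.
Qed.

Lemma mulmx_cols_eq0 (S : comNzRingType) (m n p : nat) (X : 'M[S]_(m, n))
  (Y : 'M[S]_(n, p)) : (forall k, X *m col k Y = 0) -> X *m Y = 0.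
Proof.
move=> h; apply/matrixP => i k; have /matrixP/(_ i 0) := h k.
by rewrite !mxE => e; rewrite -[RHS]e; apply: eq_bigr => l _; rewrite mxE.
Qed.

Lemma quat_commutator (S : comNzRingType) (n : nat) (I J K G : 'M[S]_n) (a b c : S) :
  quat (I *m G - G *m I) (J *m G - G *m J) (K *m G - G *m K) a b c =
  quat I J K a b c *m G - G *m quat I J K a b c.
Proof.
rewrite /quat !mulmxDl !mulmxDr -!(scalemxAl, scalemxAr); mxlin; ring.
Qed.

(** Here dX = X Y - Y X says that X is parallel for the connection matrix Y. Hence the covariant
    derivative of the bivector X W is X applied to that of W, and the other two terms are the
    connection acting on X W. *)
Lemma covariant_product (S : fieldType) (n : nat) (X W dW Y : 'M[S]_n) (t : S) :
  t *: ((X *m Y - Y *m X) *m W + X *m dW) =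
  t *: (X *m (dW + Y *m W + W *m Y^T)) - Y *m (t *: (X *m W)) - (t *: (X *m W)) *m Y^T.
Proof.
rewrite !mulmxDr mulmxBl -!scalemxAr -!scalemxAl !mulmxA; mxlin; ring.
Qed.

Lemma dir_covariant (S : fieldType) (N n : nat) (X G : 'I_N -> 'M[S]_n) (Q : 'M[S]_n)
    (v : 'cV[S]_N) :
  dir (fun k => X k - G k *m Q - Q *m (G k)^T) v =
  dir X v - dir G v *m Q - Q *m (dir G v)^T.
Proof. by rewrite -dir_tr -dir_mull -dir_mulr -!dir_opp -!dir_add. Qed.

(** [D] holds the derivatives of the test field and [G] the connection terms. They enter only
    through D + G, which p kills from the left, and through its transpose, which p^T kills from the
    right. *)
Lemma lie_block (S : fieldType) (n : nat) (L1 L2 Q G D p : 'M[S]_n) :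
  p *m (D + G) = 0 ->
  p *m (L1 - G *m Q - Q *m G^T + L2 - D *m Q - Q *m D^T) *m p^T =
  p *m L1 *m p^T + p *m L2 *m p^T.
Proof.
move=> e; have -> : L1 - G *m Q - Q *m G^T + L2 - D *m Q - Q *m D^T =
    (L1 + L2) - (D + G) *m Q - Q *m (D + G)^T.
  by rewrite linearD/= mulmxDl mulmxDr; mxlin; ring.
rewrite !mulmxBr !mulmxBl (mulmxA p (D + G)) e !mul0mx subr0.
by rewrite -!mulmxA -trmx_mul e trmx0 !mulmx0 subr0 mulmxDl mulmxDr !mulmxA.
Qed.

Lemma lie_off_diag (S : fieldType) (m n : nat) (p Q : 'M[S]_n) (D : 'M[S]_(m, n))
    (s : 'M[S]_m) : s *m D = 0 ->
  p *m (- (Q *m D^T)) *m s^T = 0 /\ s *m (- (D *m Q)) *m p^T = 0.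
Proof.
move=> e; rewrite !mulmxN !mulNmx (mulmxA s) e !mul0mx oppr0; split=> //.
by rewrite -!mulmxA -trmx_mul e trmx0 !mulmx0 oppr0.
Qed.

Lemma quat_deriv (S : comNzRingType) (n : nat) (X Y W : 'M[S]_n) (t a b c : S) :
  t *: ((X + quat 0 0 0 a b c) *m W + Y *m 0) = t *: (X *m W).
Proof. by rewrite /quat !scaler0 !addr0 mulmx0 addr0. Qed.

Lemma commutator_eigen (S : fieldType) (n : nat) (X G : 'M[S]_n) (u du : 'cV[S]_n)
    (i : S) : X *m u = - (i *: u) ->
  (- i) *: du = (X *m G - G *m X) *m u + X *m du -> X *m (du + G *m u) = - (i *: (du + G *m u)).
Proof.
move=> Xu; rewrite mulmxBl -!mulmxA Xu mulmxN -scalemxAr opprK => e.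
rewrite mulmxDr scalerDr opprD -[- (i *: du)]scaleNr e.
by mxlin; ring.
Qed.

Lemma dmx_usubmx (R : realType) (N : nat) (T : Type) (A : atlas R N T) (c : idx A)
    (p q r : nat) k (X : T -> 'M[R[i]]_(p + q, r)) x :
  dmx c k (fun y => usubmx (X y)) x = usubmx (dmx c k X x).
Proof.
apply/matrixP => i j; rewrite mxE [RHS]mxE [RHS]mxE; congr (cpder c k _ x).
by apply/funext => y; rewrite mxE.
Qed.

Lemma dmx_dsubmx (R : realType) (N : nat) (T : Type) (A : atlas R N T) (c : idx A)
    (p q r : nat) k (X : T -> 'M[R[i]]_(p + q, r)) x :
  dmx c k (fun y => dsubmx (X y)) x = dsubmx (dmx c k X x).
Proof.
apply/matrixP => i j; rewrite mxE [RHS]mxE [RHS]mxE; congr (cpder c k _ x).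
by apply/funext => y; rewrite mxE.
Qed.

Section LieDerivative.
Variables (R : realType) (n : nat) (M : topologicalType) (A : atlas R n M).
Variables (I J K g : field A R).
Hypotheses (hM : is_manifold A) (hIJK : hypercomplex I J K)
  (hg : hyperhermitian I J K g).
Let Z := twistor_atlas A.
Let F := twistor_complex I J K.
Let P := twistor_bivector I J K g.
Variables (c : idx A) (b : bool) (x : M) (a : sphere R).
Hypotheses (cx : dom A c x) (ab : dom (sphere_atlas R) b a).
Let cb : idx Z := (c, b).
Let z := (x, a).
Let cbP : good_chart (A := Z) cb := twistor_good_chart hM cb.
Let cz : dom Z cb z. Proof. by []. Qed.

Variable G : 'I_n -> 'M[R[i]]_n.
Hypotheses (Gsym : forall k l i, G k i l = G l i k)
  (dI : forall k, dmx c k (cfield c I) x = cfield c I x *m G k - G k *m cfield c I x)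
  (dJ : forall k, dmx c k (cfield c J) x = cfield c J x *m G k - G k *m cfield c J x)
  (dK : forall k, dmx c k (cfield c K) x = cfield c K x *m G k - G k *m cfield c K x).

Let S := fiber_structure I J K c z.
Let Q := fiber_bivector I J K g c z.
Let pr := fiber_proj I J K c z.
Let ps : 'M[R[i]]_2 := base_proj R.
Let h := cmetric_inv g c x.
Let E := nabla_inv g c G x.
Let B := fquat I J K c x (bcoef 0 z) (bcoef 1 z) (bcoef 2 z).

Lemma dmx_fiber_structure k :
  dmx (A := Z) cb (lshift 2 k) (fiber_structure I J K c) z = S *m G k - G k *m S.
Proof.
have s := csmooth_sc hM c b.
rewrite /fiber_structure (dmx_fquat hM hIJK hg cx ab (lshift 2 k) (s 0) (s 1) (s 2)).
rewrite !(cpder_scl c x ab) !(dmx_fstl c x ab) dI dJ dK quat_commutator.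
by rewrite /fquat {1}/quat !scale0r !add0r.
Qed.

(** Along M the coefficients [bcoef] are constant and I, J, K are parallel. Besides the connection
    terms, only the covariant derivative [E] of the inverse metric contributes. *)
Lemma dmx_fiber_bivectorl k :
  dmx (A := Z) cb (lshift 2 k) (fiber_bivector I J K g c) z =
  2^-1 *: (B *m E k) - G k *m Q - Q *m (G k)^T.
Proof.
have s := csmooth_bcoef hM c b.
have sB := csmooth_mx_fquat hM hIJK hg (s 0) (s 1) (s 2).
have sh := csmooth_mx_metric_inv hM hg c b.
rewrite /fiber_bivector (dmxZ cbP _ cz (csmooth_cst cbP _)); last exact: csmooth_mxM.
rewrite cpder_cst scale0r add0r (dmxM cbP _ cz sB sh).
rewrite (dmx_fquat hM hIJK hg cx ab (lshift 2 k) (s 0) (s 1) (s 2)).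
rewrite !(cpder_bcoefl c x ab) !(dmx_fstl c x ab) dI dJ dK quat_commutator.
rewrite /fquat {1}/quat !scale0r !add0r.
exact: covariant_product.
Qed.

Lemma dmx_fiber_bivectorr k :
  dmx (A := Z) cb (rshift n k) (fiber_bivector I J K g c) z =
  2^-1 *: (fquat I J K c x (cpder (A := Z) cb (rshift n k) (@bcoef R M 0) z)
                           (cpder (A := Z) cb (rshift n k) (@bcoef R M 1) z)
                           (cpder (A := Z) cb (rshift n k) (@bcoef R M 2) z) *m h).
Proof.
have s := csmooth_bcoef hM c b.
have sB := csmooth_mx_fquat hM hIJK hg (s 0) (s 1) (s 2).
have sh := csmooth_mx_metric_inv hM hg c b.
rewrite /fiber_bivector (dmxZ cbP _ cz (csmooth_cst cbP _)); last exact: csmooth_mxM.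
rewrite cpder_cst scale0r add0r (dmxM cbP _ cz sB sh).
rewrite (dmx_fquat hM hIJK hg cx ab (rshift n k) (s 0) (s 1) (s 2)).
have -> := dmx_fstr hM b a cx k (cmetric_inv g c).
have -> := dmx_fstr hM b a cx k (cfield c I).
have -> := dmx_fstr hM b a cx k (cfield c J).
have -> := dmx_fstr hM b a cx k (cfield c K).
exact: quat_deriv.
Qed.

Lemma dmx_bivector k : dmx (A := Z) cb k (P cb) z =
  block_mx (dmx (A := Z) cb k (fiber_bivector I J K g c) z) 0 0 0.
Proof.
pose Bl y : 'M[R[i]]_(n + 2) := block_mx (fiber_bivector I J K g c y) 0 0 0.
have e : {in dom Z cb, P cb =1 Bl}.
  by move=> y; rewrite inE => cy; rewrite /P (twistor_bivectorE hM hIJK hg cy).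
rewrite (dmx_ext cbP k cz e).
apply/matrixP => i j; rewrite mxE /Bl.
case: (fintype.split_ordP i) => i' ->; case: (fintype.split_ordP j) => j' ->.
- by rewrite block_mxEul mxE; under eq_fun do rewrite block_mxEul.
- by rewrite block_mxEur mxE; under eq_fun do rewrite block_mxEur mxE; rewrite cpder_cst.
- by rewrite block_mxEdl mxE; under eq_fun do rewrite block_mxEdl mxE; rewrite cpder_cst.
- by rewrite block_mxEdr mxE; under eq_fun do rewrite block_mxEdr mxE; rewrite cpder_cst.
Qed.

Section Field.
Variable X : M * sphere R -> 'cV[R[i]]_(n + 2).
Hypotheses (sX : csmooth_mx (A := Z) cb X)
  (FX : forall y, dom Z cb y -> toC (F cb y) *m X y = - ('i *: X y)).
Let Xu y := usubmx (X y).
Let Xd y := dsubmx (X y).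
Let DX : 'M[R[i]]_(n + 2) := \matrix_(i, k) cpder (A := Z) cb k (fun y => X y i 0) z.

Lemma lie_bivectorE :
  lie_bivector (A := Z) cb X P z =
  dir (fun k => dmx (A := Z) cb k (P cb) z) (X z) - DX *m P cb z - P cb z *m DX^T.
Proof.
apply/matrixP => i j; rewrite mxE !addmxE !oppmxE summxE.
rewrite [(DX *m _) i j]mxE [(_ *m DX^T) i j]mxE -!sumrN -!big_split.
apply: eq_bigr => k _ /=; rewrite scalemxE [dmx _ _ _ _ _ _]mxE [DX^T k j]mxE.
by rewrite [DX i k]mxE [DX j k]mxE [cpder _ _ _ _ * P cb z k j]mulrC.
Qed.

Let FXu y : dom Z cb y -> fiber_structure I J K c y *m Xu y = - ('i *: Xu y).
Proof.
move=> cy; have := FX cy; rewrite (twistor_complexE I J K cb y) -{1}[X y]vsubmxK.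
rewrite mul_block_col !mul0mx addr0 => /(congr1 usubmx); rewrite col_mxKu => ->.
by rewrite /Xu linearN linearZ.
Qed.

Let FXd y : dom Z cb y -> toC (mul_i R) *m Xd y = - ('i *: Xd y).
Proof.
move=> cy; have := FX cy; rewrite (twistor_complexE I J K cb y) -{1}[X y]vsubmxK.
rewrite mul_block_col !mul0mx add0r => /(congr1 dsubmx); rewrite col_mxKd => ->.
by rewrite /Xd linearN linearZ.
Qed.

Let sXu : csmooth_mx (A := Z) cb Xu.
Proof. by move=> i j; under eq_fun do rewrite mxE; exact: sX. Qed.
Let sXd : csmooth_mx (A := Z) cb Xd.
Proof. by move=> i j; under eq_fun do rewrite mxE; exact: sX. Qed.

Let proj_kill (m : nat) (W : 'M[R[i]]_m) (Y : 'cV[R[i]]_m) : W *m Y = - ('i *: Y) ->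
  (2^-1 *: (1%:M - 'i *: W)) *m Y = 0.
Proof.
move=> WY; rewrite -scalemxAl mulmxBl mul1mx -scalemxAl WY scalerN opprK scalerA.
by rewrite -expr2 sqrCi scaleN1r subrr scaler0.
Qed.

(** Symmetry of [G]: the derivative of a field v in direction k involves G_k v, whereas the Lie
    derivative involves column k of G_v. *)
Lemma dirG_colE k (v : 'cV[R[i]]_n) : col k (dir G v) = G k *m v.
Proof.
apply/colP => i; rewrite !mxE summxE; apply: eq_bigr => l _.
by rewrite mxE (Gsym k) mulrC.
Qed.

(** The covariant derivatives of the component [Xu] along M are again of type (0,1), so the
    projection onto T^{1,0} kills them. *)
Lemma proj_dXu : pr *m ulsubmx DX = - (pr *m dir G (Xu z)).
Proof.
apply/eqP; rewrite -addr_eq0 -mulmxDr; apply/eqP; apply: mulmx_cols_eq0 => k.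
have colD : col k (ulsubmx DX) = usubmx (dmx (A := Z) cb (lshift 2 k) X z).
  by apply/colP => i; rewrite !mxE.
rewrite raddfD/= dirG_colE colD -(dmx_usubmx (A := Z)).
apply: proj_kill.
have e := dmxM cbP (lshift 2 k) cz (csmooth_mx_fiber_structure hM hIJK hg c b) sXu.
have FXu' : {in dom Z cb, (fun y => fiber_structure I J K c y *m Xu y) =1
    (fun y => (- 'i) *: Xu y)}.
  by move=> y; rewrite inE => /FXu ->; rewrite scaleNr.
rewrite (dmx_ext cbP (lshift 2 k) cz FXu') (dmxZ cbP _ cz (csmooth_cst cbP _) sXu) in e.
rewrite cpder_cst scale0r add0r (dmx_fiber_structure k) in e.
exact: commutator_eigen (FXu cz) e.
Qed.

Lemma proj_dXd : ps *m dlsubmx DX = 0.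
Proof.
apply: mulmx_cols_eq0 => k.
have colD : col k (dlsubmx DX) = dsubmx (dmx (A := Z) cb (lshift 2 k) X z).
  by apply/colP => i; rewrite !mxE.
rewrite colD -(dmx_dsubmx (A := Z)).
apply: proj_kill.
have sm : csmooth_mx (A := Z) cb (fun=> toC (mul_i R)) by exact: csmooth_mx_cst.
have e := dmxM cbP (lshift 2 k) cz sm sXd.
have FXd' : {in dom Z cb, (fun y => toC (mul_i R) *m Xd y) =1
    (fun y => (- 'i) *: Xd y)}.
  by move=> y; rewrite inE => /FXd ->; rewrite scaleNr.
rewrite (dmx_ext cbP (lshift 2 k) cz FXd') (dmxZ cbP _ cz (csmooth_cst cbP _) sXd) in e.
rewrite cpder_cst scale0r add0r dmx_cst mul0mx add0r in e.
by rewrite -e scaleNr.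
Qed.

Let baseder k := fquat I J K c x (cpder (A := Z) cb (rshift n k) (@bcoef R M 0) z)
  (cpder (A := Z) cb (rshift n k) (@bcoef R M 1) z)
  (cpder (A := Z) cb (rshift n k) (@bcoef R M 2) z).

(** The derivatives of X cancel against the connection terms. The two remaining terms depend on X at
    [z] only: [E] along the part tangent to M, and the derivative of the coefficients along the part
    tangent to the sphere. *)
Lemma part20_lie :
  part20 (F cb z) (lie_bivector (A := Z) cb X P z) =
  block_mx (pr *m dir (fun k => 2^-1 *: (B *m E k)) (Xu z) *m pr^T
            + pr *m dir (fun k => 2^-1 *: (baseder k *m h)) (Xd z) *m pr^T) 0 0 0.
Proof.
have pE : proj10 (F cb z) = block_mx pr 0 0 ps by exact: twistor_projE.
have PE : P cb z = block_mx Q 0 0 0 by exact: (twistor_bivectorE hM hIJK hg cz).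
rewrite /part20 pE lie_bivectorE PE.
rewrite (dir_ext (e := fun k =>
    block_mx (dmx (A := Z) cb k (fiber_bivector I J K g c) z) 0 0 0)); last first.
  by move=> k; exact: dmx_bivector.
rewrite dir_block dir_split.
rewrite (dir_ext _ dmx_fiber_bivectorl) (dir_ext _ dmx_fiber_bivectorr).
rewrite -[DX]submxK tr_block_mx !mulmx_block !mulmx0 !mul0mx !addr0.
rewrite !opp_block_mx !add_block_mx !oppr0 !add0r !addr0.
rewrite tr_block_mx !trmx0 !mulmx_block !mulmx0 !mul0mx !addr0 ?add0r.
have eG : pr *m (ulsubmx DX + dir G (Xu z)) = 0 by rewrite mulmxDr proj_dXu addNr.
have [edl edr] := lie_off_diag pr Q proj_dXd.
rewrite edl edr mul0mx.
have -> := dir_covariant (fun k => 2^-1 *: (B *m E k)) G Q (Xu z).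
by rewrite (lie_block _ _ _ eG).
Qed.

End Field.
End LieDerivative.

(** * Change of charts *)

Lemma quat_transport (S : comNzRingType) (n : nat) (T I J K I' J' K' h h' : 'M[S]_n)
    (a b c t : S) :
  T *m I = I' *m T -> T *m J = J' *m T -> T *m K = K' *m T -> h' = T *m h *m T^T ->
  t *: (quat I' J' K' a b c *m h') = T *m (t *: (quat I J K a b c *m h)) *m T^T.
Proof.
move=> eI eJ eK ->; rewrite -scalemxAr -scalemxAl; congr (_ *: _).
rewrite !mulmxA; do 2!congr (_ *m _); rewrite /quat !mulmxDl !mulmxDr.
by rewrite -!(scalemxAl, scalemxAr) eI eJ eK.
Qed.

(** Only the first block column of [Y] meets the nonzero block, so its other two blocks may be
    arbitrary. *)
Lemma block_congruence (S : comNzRingType) (m n : nat) (T Q Q' : 'M[S]_m)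
    (Y : 'M[S]_(m + n)) : ulsubmx Y = T -> dlsubmx Y = 0 -> Q' = T *m Q *m T^T ->
  block_mx Q' 0 0 0 = Y *m block_mx Q 0 0 0 *m Y^T.
Proof.
move=> eT e0 ->; rewrite -[Y]submxK eT e0 tr_block_mx !mulmx_block.
by rewrite !(mul0mx, mulmx0, addr0, trmx0).
Qed.

Section Tensor.
Variables (R : realType) (n : nat) (M : topologicalType) (A : atlas R n M).
Variables (I J K g : field A R).
Hypotheses (hM : is_manifold A) (hIJK : hypercomplex I J K)
  (hg : hyperhermitian I J K g).
Let Z := twistor_atlas A.
Let P := twistor_bivector I J K g.

Lemma metric_inv_transport c d x : dom A c x -> dom A d x ->
  invmx (g d x) = transition c d x *m invmx (g c x) *m (transition c d x)^T.
Proof.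
move=> cx dx; case: (hg) => -[_ gE _ _] _ _ _.
have gc := metric_unit hg cx; have gd := metric_unit hg dx.
set T := transition c d x; have e : g c x = T^T *m g d x *m T := gE c d x cx dx.
have Tu : T \in unitmx by move: gc; rewrite e !unitmx_mul => /andP[].
have TTu : T^T \in unitmx by rewrite unitmx_tr.
have e1 : g d x *m (T *m invmx (g c x) *m T^T) = 1%:M.
  by apply: (can_inj (mulKmx TTu)); rewrite !mulmxA -e mulmxV// mul1mx mulmx1.
by rewrite -[LHS]mulmx1 -e1 mulKmx.
Qed.

(** Invertibility of the Jacobian is read off from the transformation law of the metric, whose
    matrices are invertible. *)
Lemma transition_unit c d x : dom A c x -> dom A d x -> transition c d x \in unitmx.
Proof.
move=> cx dx; case: (hg) => -[_ gE _ _] _ _ _.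
have := metric_unit hg cx; rewrite (gE c d x cx dx) !unitmx_mul => /andP[] //.
Qed.

Lemma fiber_bivector_transport c d z : dom A c z.1 -> dom A d z.1 ->
  fiber_bivector I J K g d z = toC (transition c d z.1) *m fiber_bivector I J K g c z
    *m (toC (transition c d z.1))^T.
Proof.
move=> cx dx; case: (hIJK) => -[[_ eI] _ _] [[_ eJ] _ _] [[_ eK] _ _] _.
have tr (X : field A R) : (forall c d x, dom A c x -> dom A d x ->
      transition c d x *m X c x = X d x *m transition c d x) ->
    toC (transition c d z.1) *m cfield c X z.1 = cfield d X z.1 *m toC (transition c d z.1).
  by move=> e; rewrite -!map_mxM e.
have eh : cmetric_inv g d z.1 = toC (transition c d z.1) *m cmetric_inv g c z.1
    *m (toC (transition c d z.1))^T.
  by rewrite toC_tr -!map_mxM /cmetric_inv (metric_inv_transport cx dx).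
exact: quat_transport (tr I eI) (tr J eJ) (tr K eK) eh.
Qed.

Lemma twistor_transition c d b b' x a : dom A c x -> dom (sphere_atlas R) b a ->
  let T := transition (A := Z) (c, b) (d, b') (x, a) in
  ulsubmx T = transition c d x /\ dlsubmx T = 0.
Proof.
move=> cx ab T; split; apply/matrixP => i j; rewrite mxE mxE /T [LHS]mxE.
  have -> := pder_prodl c (sphere_good R b)
    (fun y => chart Z (d, b') y (lshift 2 i) 0) j x ab.
  rewrite mxE; congr (pder c j _ x); apply/funext => y /=; by rewrite col_mxEu.
have -> := pder_prodl c (sphere_good R b)
    (fun y => chart Z (d, b') y (rshift n i) 0) j x ab.
rewrite [RHS]mxE -[RHS](pder_cst c j (chart (sphere_atlas R) b' a i 0) x).
by congr (pder c j _ x); apply/funext => y /=; rewrite col_mxEd.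
Qed.

Lemma toC_ulsubmx p q (X : 'M[R]_(p + q)) : ulsubmx (toC X) = toC (ulsubmx X).
Proof. by apply/matrixP => i j; rewrite !mxE. Qed.
Lemma toC_dlsubmx p q (X : 'M[R]_(p + q)) : dlsubmx (toC X) = toC (dlsubmx X).
Proof. by apply/matrixP => i j; rewrite !mxE. Qed.

Lemma twistor_cbivector : is_cbivector P.
Proof.
split.
- by case=> c b; exact: csmooth_mx_bivector.
- move=> [c b] [d b'] [x a] cz dz; have [cx ab] := cz; have [dx ab'] := dz.
  rewrite /P (twistor_bivectorE hM hIJK hg cz) (twistor_bivectorE hM hIJK hg dz).
  have [eT e0] := twistor_transition d b' cx ab.
  apply: (@block_congruence _ _ _ (toC (transition c d x))).
  + by rewrite toC_ulsubmx eT.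
  + by rewrite toC_dlsubmx e0 map_mx0.
  + exact: (@fiber_bivector_transport c d (x, a)).
- move=> c z cz; have [cx _] := cz.
  rewrite /P (twistor_bivectorE hM hIJK hg cz) tr_block_mx !trmx0.
  by rewrite (fiber_bivector_skew hIJK hg cx) opp_block_mx !oppr0.
Qed.

End Tensor.

(** * Antiholomorphic derivatives in the direction of the sphere *)

(* In vector notation, for a derivation d along which the point s of the sphere
   moves with d x s = i d, the derivative u = - (d . e) s - (s . e) d + i e x d
   of e - (e . s) s + i e x s satisfies u - (u . s) s + i u x s = 0. *)
Lemma cauchy_riemann_kill (S : fieldType) (i s0 s1 s2 d0 d1 d2 : S) :
  i * i = -1 -> s0 * s0 + s1 * s1 + s2 * s2 = 1 ->
  d1 * s2 - d2 * s1 = i * d0 -> d2 * s0 - d0 * s2 = i * d1 ->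
  d0 * s1 - d1 * s0 = i * d2 ->
  let u0 := - (d0 * s0 + s0 * d0) in
  let u1 := - (d0 * s1 + s0 * d1) - i * d2 in
  let u2 := - (d0 * s2 + s0 * d2) + i * d1 in
  let p := u0 * s0 + u1 * s1 + u2 * s2 in
  [/\ u0 - p * s0 + i * (u1 * s2 - u2 * s1) = 0,
      u1 - p * s1 + i * (u2 * s0 - u0 * s2) = 0 &
      u2 - p * s2 + i * (u0 * s1 - u1 * s0) = 0].
Proof.
move=> ii ss r0 r1 r2 u0 u1 u2 p.
have q0 : d0 * s0 + d1 * s1 + d2 * s2 = 0.
  have e : i * (d0 * s0 + d1 * s1 + d2 * s2) = 0.
    by rewrite !mulrDr !mulrA -r0 -r1 -r2; ring.
  transitivity (- (i * (i * (d0 * s0 + d1 * s1 + d2 * s2)))).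
    by rewrite [i * (i * _)]mulrA ii mulN1r opprK.
  by rewrite e mulr0 oppr0.
pose h0 := d1 * s2 - d2 * s1 - i * d0; pose h1 := d2 * s0 - d0 * s2 - i * d1.
pose h2 := d0 * s1 - d1 * s0 - i * d2.
pose q := d0 * s0 + d1 * s1 + d2 * s2.
pose w := (s0 * s0 + s1 * s1 + s2 * s2 - 1) - (i * i + 1).
have z0 : h0 = 0 by rewrite /h0 r0 subrr.
have z1 : h1 = 0 by rewrite /h1 r1 subrr.
have z2 : h2 = 0 by rewrite /h2 r2 subrr.
have zw : w = 0 by rewrite /w ss ii; ring.
split.
- transitivity (d0 * s0 * w + s0 * q * s0 - i * h0 * s0 - i * s0 * h0 - i * i * q).
    by rewrite /p /u0 /u1 /u2 /w /q /h0; ring.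
  by rewrite zw z0 /q q0 !(mulr0, mul0r, subr0, addr0).
- transitivity (d0 * s1 * w + h2 + s0 * q * s1 - i * h0 * s1 - i * s0 * h1).
    by rewrite /p /u0 /u1 /u2 /w /q /h0 /h1 /h2; ring.
  by rewrite zw z0 z1 z2 /q q0 !(mulr0, mul0r, subr0, addr0).
- transitivity (d0 * s2 * w - h1 + s0 * q * s2 - i * h0 * s2 - i * s0 * h2).
    by rewrite /p /u0 /u1 /u2 /w /q /h0 /h1 /h2; ring.
  by rewrite zw z0 z1 z2 /q q0 !(mulr0, mul0r, subr0, addr0).
Qed.

(** With p and q the derivatives of the point along the two real coordinates, p x s = - q and q x s
    = p give (p + i q) x s = i (p + i q). So d = p + i q is a derivation as in
    [cauchy_riemann_kill]. *)
Lemma cauchy_riemann_pair (S : fieldType) (i s0 s1 s2 p0 p1 p2 q0 q1 q2 : S) :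
  i * i = -1 -> s0 * s0 + s1 * s1 + s2 * s2 = 1 ->
  [/\ p1 * s2 - p2 * s1 = - q0, p2 * s0 - p0 * s2 = - q1, p0 * s1 - p1 * s0 = - q2 &
     [/\ q1 * s2 - q2 * s1 = p0, q2 * s0 - q0 * s2 = p1 & q0 * s1 - q1 * s0 = p2]] ->
  let u0 := - (p0 * s0 + s0 * p0) + i * - (q0 * s0 + s0 * q0) in
  let u1 := - (p0 * s1 + s0 * p1) - i * p2 + i * (- (q0 * s1 + s0 * q1) - i * q2) in
  let u2 := - (p0 * s2 + s0 * p2) + i * p1 + i * (- (q0 * s2 + s0 * q2) + i * q1) in
  let p := u0 * s0 + u1 * s1 + u2 * s2 in
  [/\ u0 - p * s0 + i * (u1 * s2 - u2 * s1) = 0,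
      u1 - p * s1 + i * (u2 * s0 - u0 * s2) = 0 &
      u2 - p * s2 + i * (u0 * s1 - u1 * s0) = 0].
Proof.
move=> ii ss [e1 e2 e3 [e4 e5 e6]] u0 u1 u2.
have r (u v x y : S) : u = - y -> v = x -> u + i * v = i * (x + i * y).
  by move=> -> ->; rewrite mulrDr mulrA ii mulN1r addrC.
have r0 : (p1 + i * q1) * s2 - (p2 + i * q2) * s1 = i * (p0 + i * q0).
  by rewrite -(r _ _ _ _ e1 e4); ring.
have r1 : (p2 + i * q2) * s0 - (p0 + i * q0) * s2 = i * (p1 + i * q1).
  by rewrite -(r _ _ _ _ e2 e5); ring.
have r2 : (p0 + i * q0) * s1 - (p1 + i * q1) * s0 = i * (p2 + i * q2).
  by rewrite -(r _ _ _ _ e3 e6); ring.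
have := cauchy_riemann_kill ii ss r0 r1 r2.
have -> : u0 = - ((p0 + i * q0) * s0 + s0 * (p0 + i * q0)) by rewrite /u0; ring.
have -> : u1 = - ((p0 + i * q0) * s1 + s0 * (p1 + i * q1)) - i * (p2 + i * q2).
  by rewrite /u1; ring.
by have -> : u2 = - ((p0 + i * q0) * s2 + s0 * (p2 + i * q2)) + i * (p1 + i * q1)
  by rewrite /u2; ring.
Qed.

Section Holomorphic.
Variables (R : realType) (n : nat) (M : topologicalType) (A : atlas R n M).
Variables (I J K g : field A R).
Hypotheses (hM : is_manifold A) (hIJK : hypercomplex I J K)
  (hg : hyperhermitian I J K g).
Let Z := twistor_atlas A.

Section AtPoint.
Variables (c : idx A) (b : bool) (x : M) (a : sphere R).
Hypotheses (cx : dom A c x) (ab : dom (sphere_atlas R) b a).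
Let cb : idx Z := (c, b).
Let z := (x, a).
Let cz : dom Z cb z. Proof. by []. Qed.
Let cbP : good_chart (A := Z) cb := twistor_good_chart hM cb.

Let D k i : R[i] := (pder (A := sphere_atlas R) b k (@scomp R i) a)%:C.

Lemma cpder_bcoef k :
  [/\ cpder (A := Z) cb (rshift n k) (@bcoef R M 0) z =
        - (D k 0 * sc 0 z + sc 0 z * D k 0),
      cpder (A := Z) cb (rshift n k) (@bcoef R M 1) z =
        - (D k 0 * sc 1 z + sc 0 z * D k 1) - 'i * D k 2 &
      cpder (A := Z) cb (rshift n k) (@bcoef R M 2) z =
        - (D k 0 * sc 2 z + sc 0 z * D k 2) + 'i * D k 1].
Proof.
have s := csmooth_sc hM c b; have DE i := cpder_scr hM b a cx k i.
have sM i j := csmooth_mul cbP (s i) (s j); have sN i j := csmooth_opp cbP (sM i j).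
have sC t := csmooth_cst cbP t; have si i := csmooth_mul cbP (sC 'i) (s i).
have siN i := csmooth_opp cbP (si i).
have dM i j : cpder (A := Z) cb (rshift n k) (fun y => sc i y * sc j y) z =
    D k i * sc j z + sc i z * D k j by rewrite (cpder_mul cbP _ cz (s i) (s j)) !DE.
have di i : cpder (A := Z) cb (rshift n k) (fun y => 'i * sc i y) z = 'i * D k i.
  by rewrite (cpder_mul cbP _ cz (sC 'i) (s i)) cpder_cst mul0r add0r DE.
split; rewrite /bcoef /=.
- rewrite (cpder_add cbP _ cz (sC 1) (sN 0 0)) cpder_cst add0r.
  by rewrite (cpder_opp cbP _ cz (sM 0 0)) dM.
- rewrite (cpder_add cbP _ cz (sN 0 1) (siN 2)) (cpder_opp cbP _ cz (sM 0 1)).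
  by rewrite (cpder_opp cbP _ cz (si 2)) dM di.
- rewrite (cpder_add cbP _ cz (sN 0 2) (si 1)) (cpder_opp cbP _ cz (sM 0 2)).
  by rewrite dM di.
Qed.

Lemma fquat_lin (t : R[i]) a1 a2 a3 b1 b2 b3 :
  fquat I J K c x a1 a2 a3 + t *: fquat I J K c x b1 b2 b3 =
  fquat I J K c x (a1 + t * b1) (a2 + t * b2) (a3 + t * b3).
Proof. by rewrite /fquat quatZ quatD. Qed.

(** [dB 0 + 'i *: dB 1] is twice the derivative of the coefficients in the conjugate of the complex
    chart coordinate. By [fiber_sandwich] its (2,0)-part is the vector expression of
    [cauchy_riemann_pair]. *)
Lemma proj_baseder : let h := cmetric_inv g c x in
  let dB k := fquat I J K c x (cpder (A := Z) cb (rshift n k) (@bcoef R M 0) z)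
    (cpder (A := Z) cb (rshift n k) (@bcoef R M 1) z)
    (cpder (A := Z) cb (rshift n k) (@bcoef R M 2) z) in
  fiber_proj I J K c z *m ((dB 0 + 'i *: dB 1) *m h) *m (fiber_proj I J K c z)^T = 0.
Proof.
move=> h dB; rewrite /dB fquat_lin.
have [-> -> ->] := cpder_bcoef 0; have [-> -> ->] := cpder_bcoef 1.
rewrite (fiber_sandwich hIJK hg _ _ _ (z := z) cx).
have ii : 'i * 'i = -1 :> R[i] by rewrite -expr2 sqrCi.
have toCE (u v w t y : R) : u * v - w * t = y -> u%:C * v%:C - w%:C * t%:C = y%:C.
  by move=> <-; rewrite rmorphB !rmorphM.
have toCN (y : R) : (- y)%:C = - y%:C by rewrite rmorphN.
have CR : [/\ D 0 1 * sc 2 z - D 0 2 * sc 1 z = - D 1 0,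
   D 0 2 * sc 0 z - D 0 0 * sc 2 z = - D 1 1,
   D 0 0 * sc 1 z - D 0 1 * sc 0 z = - D 1 2 &
   [/\ D 1 1 * sc 2 z - D 1 2 * sc 1 z = D 0 0,
       D 1 2 * sc 0 z - D 1 0 * sc 2 z = D 0 1 &
       D 1 0 * sc 1 z - D 1 1 * sc 0 z = D 0 2]].
  have [c1 c2 c3 [c4 c5 c6]] := sphere_cauchy_riemann ab.
  by rewrite /D -!toCN; split; [exact: toCE|exact: toCE|exact: toCE|split; exact: toCE].
have [E0 E1 E2] := cauchy_riemann_pair ii (scP z) CR.
cbv zeta; rewrite E0 E1 E2 /fquat.
by rewrite {1}/quat !scale0r !addr0 mul0mx scaler0.
Qed.

End AtPoint.
End Holomorphic.

(** * The Schouten bracket on the twistor space *)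

(** [H] is the product of the connection [G] with the flat coordinate connection of the base. *)
Lemma block_connection_sym (S : comNzRingType) (n m : nat) (G : 'I_n -> 'M[S]_n)
    (H : 'I_(n + m) -> 'M[S]_(n + m)) :
  (forall k l i, G k i l = G l i k) ->
  (forall k, H (lshift m k) = block_mx (G k) 0 0 0) ->
  (forall k, H (rshift n k) = 0) ->
  forall k l i, H k i l = H l i k.
Proof.
move=> Gs Hl Hr k l i.
case: (fintype.split_ordP k) => k' ->; case: (fintype.split_ordP l) => l' ->;
  case: (fintype.split_ordP i) => i' ->;
  by rewrite ?Hl ?Hr ?block_mxEul ?block_mxEur ?block_mxEdl ?block_mxEdr ?mxE// Gs.
Qed.

(* Derivatives of P in base directions do not contribute to its bracket, so
   they may be replaced by 0. *)
Lemma schouten_vertical (S : numFieldType) (n m : nat) (G : 'I_n -> 'M[S]_n) (Q : 'M[S]_n)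
    (P : 'M[S]_(n + m)) (dP : 'I_(n + m) -> 'M[S]_(n + m)) :
  (forall k l i, G k i l = G l i k) -> Q^T = - Q -> P = block_mx Q 0 0 0 ->
  (forall k, dP (lshift m k) = block_mx (- (G k *m Q) - Q *m (G k)^T) 0 0 0) ->
  forall i j k, \sum_l (P i l * dP l j k + P i l * dP l j k)
    + \sum_l (P j l * dP l k i + P j l * dP l k i)
    + \sum_l (P k l * dP l i j + P k l * dP l i j) = 0.
Proof.
move=> Gs QT PE dPE i j k.
pose H (k : 'I_(n + m)) : 'M[S]_(n + m) :=
  if fintype.split k is inl l then block_mx (G l) 0 0 0 else 0.
have Hl l : H (lshift m l) = block_mx (G l) 0 0 0 by rewrite /H (unsplitK (inl l)).
have Hr l : H (rshift n l) = 0 by rewrite /H (unsplitK (inr l)).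
have PT : P^T = - P by rewrite PE tr_block_mx QT opp_block_mx !trmx0 !oppr0.
have Pr a l : P a (rshift n l) = 0.
  rewrite PE; case: (fintype.split_ordP a) => a' ->.
    by rewrite block_mxEur mxE.
  by rewrite block_mxEdr mxE.
rewrite -[RHS](schouten_parallel (block_connection_sym Gs Hl Hr) PT (fun=> erefl) i j k).
have e a a' a'' : \sum_l (P a l * dP l a' a'' + P a l * dP l a' a'') =
   \sum_l (P a l * (- (H l *m P) - P *m (H l)^T) a' a''
           + P a l * (- (H l *m P) - P *m (H l)^T) a' a'').
  apply: eq_bigr => l _; case: (fintype.split_ordP l) => l' ->; last by rewrite Pr !mul0r.
  rewrite dPE Hl PE tr_block_mx !mulmx_block !opp_block_mx add_block_mx.
  by rewrite !trmx0 !(mul0mx, mulmx0, addr0, oppr0).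
by rewrite !e.
Qed.

Lemma dir_pair (S : comNzRingType) (n : nat) (d : 'I_2 -> 'M[S]_n) (v : 'cV[S]_2) (i : S) :
  v 1 0 = i * v 0 0 -> dir d v = v 0 0 *: (d 0 + i *: d 1).
Proof.
move=> e; rewrite /dir !big_ord_recl big_ord0 addr0 scalerDr scalerA [v 0 0 * i]mulrC -e.
by congr (_ + _ *: d _); [congr (v _ 0)|]; apply: val_inj.
Qed.

Lemma dir_scale (S : comNzRingType) (N n : nat) (d : 'I_N -> 'M[S]_n) (v : 'cV[S]_N) (t : S) :
  dir (fun k => t *: d k) v = t *: dir d v.
Proof.
rewrite /dir scaler_sumr; apply: eq_bigr => k _.
by rewrite !scalerA mulrC.
Qed.

Lemma dir_eq0 (S : comNzRingType) (N n : nat) (d : 'I_N -> 'M[S]_n) (v : 'cV[S]_N) :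
  (forall k, d k = 0) -> dir d v = 0.
Proof. by move=> d0; rewrite /dir big1// => k _; rewrite d0 scaler0. Qed.

Lemma vertical_term_eq0 (S : comNzRingType) (n : nat) (p q d0 d1 h : 'M[S]_n) (t v i : S) :
  p *m ((d0 + i *: d1) *m h) *m q = 0 ->
  p *m (t *: (v *: (d0 *m h + i *: (d1 *m h)))) *m q = 0.
Proof.
move=> e; rewrite scalemxAl -mulmxDl -!scalemxAr -!scalemxAl e.
by rewrite !scaler0.
Qed.

(** * From hyperkahler metrics to holomorphic Poisson structures *)

Section Direct.
Variables (R : realType) (n : nat) (M : topologicalType) (A : atlas R n M).
Variables (I J K g : field A R).
Hypotheses (hM : is_manifold A) (hIJK : hypercomplex I J K)
  (hg : hyperhermitian I J K g).
Let Z := twistor_atlas A.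
Let F := twistor_complex I J K.
Let P := twistor_bivector I J K g.

Lemma mul_i_eigen (v : 'cV[R[i]]_2) : toC (mul_i R) *m v = - ('i *: v) ->
  v 1 0 = 'i * v 0 0.
Proof.
move=> /matrixP/(_ 0 0); rewrite !mxE !big_ord_recl big_ord0 !mxE /= rmorph0 rmorphN rmorph1.
rewrite mul0r add0r addr0 mulN1r => /oppr_inj <-.
by congr (v _ 0); apply: val_inj.
Qed.

Section Hyperkahler.
Hypothesis hK : hyperkahler I J K g.

Lemma hyperkahler_nabla_inv c x : dom A c x -> exists G : 'I_n -> 'M[R[i]]_n,
  [/\ forall k l i, G k i l = G l i k,
      forall k, dmx c k (cfield c I) x = cfield c I x *m G k - G k *m cfield c I x,
      forall k, dmx c k (cfield c J) x = cfield c J x *m G k - G k *m cfield c J x,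
      forall k, dmx c k (cfield c K) x = cfield c K x *m G k - G k *m cfield c K x &
      forall k, nabla_inv g c G x k = 0].
Proof.
move=> cx; have [G [Gs dI dJ dK]] := obata_at hM hIJK hg cx.
exists G; split=> // k; rewrite (nabla_invE hM hIJK hg G k cx).
by rewrite (hyperkahler_nabla hM hIJK hg cx Gs dI dJ dK hK) mulmx0 mul0mx oppr0.
Qed.

(** In [part20_lie] the first term vanishes with [nabla_inv]. The second vanishes by [proj_baseder],
    because a (0,1)-vector of the sphere is a multiple of (1, i). *)
Lemma hyperkahler_holomorphic : holomorphic_bivector F P.
Proof.
split; first exact: twistor_cbivector.
  by move=> c z cz; exact: (twistor_bivector_eigen hM hIJK hg cz).
move=> [c b] X sX FX [x a] cz; have [/= cx ab] := cz.
have [G [Gs dI dJ dK E0]] := hyperkahler_nabla_inv cx.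
have sX' : csmooth_mx (A := Z) (c, b) X by move=> i j; rewrite (ord1 j); exact: sX.
rewrite (part20_lie hM hIJK hg cx ab Gs dI dJ dK sX' FX).
have Xd : dsubmx (X (x, a)) 1 0 = 'i * dsubmx (X (x, a)) 0 0.
  apply: mul_i_eigen; have := FX (x, a) cz; rewrite /F (twistor_complexE I J K (c, b) (x, a)).
  rewrite -{1}[X (x, a)]vsubmxK mul_block_col !mul0mx add0r => /(congr1 dsubmx).
  by rewrite col_mxKd => ->; rewrite linearN linearZ.
rewrite (dir_eq0 (d := fun k => 2^-1 *: (_ *m nabla_inv g c G x k))); last first.
  by move=> k; rewrite E0 mulmx0 scaler0.
rewrite mulmx0 mul0mx add0r dir_scale (dir_pair _ Xd).
have e := proj_baseder hM hIJK hg cx ab.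
by rewrite (vertical_term_eq0 _ _ e) block_mx0.
Qed.

Lemma hyperkahler_schouten (c : idx Z) z i j k : dom Z c z -> schouten P P c z i j k = 0.
Proof.
case: c z => c b [x a] cz; have [/= cx ab] := cz.
have [G [Gs dI dJ dK E0]] := hyperkahler_nabla_inv cx.
have dP l : dmx (A := Z) (c, b) (lshift 2 l) (P (c, b)) (x, a) =
    block_mx (- (G l *m fiber_bivector I J K g c (x, a))
              - fiber_bivector I J K g c (x, a) *m (G l)^T) 0 0 0.
  rewrite (dmx_bivector hM hIJK hg cx ab).
  rewrite (dmx_fiber_bivectorl hM hIJK hg cx ab dI dJ dK).
  by rewrite E0 mulmx0 scaler0 add0r.
have e := schouten_vertical (dP := fun l => dmx (A := Z) (c, b) l (P (c, b)) (x, a)) Gs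
  (fiber_bivector_skew hIJK hg (z := (x, a)) cx) (twistor_bivectorE hM hIJK hg cz)
  dP i j k.
rewrite -[RHS]e /schouten.
by congr (_ + _ + _); apply: eq_bigr => l _; rewrite [dmx _ _ _ _ _ _]mxE.
Qed.

Lemma hyperkahler_poisson : holomorphic_poisson F P.
Proof.
by split; [exact: hyperkahler_holomorphic|move=> *; exact: hyperkahler_schouten].
Qed.

End Hyperkahler.
End Direct.

(** * The converse *)

(** Used with D = nabla g and h = g^-1, when - h D h is the covariant derivative of g^-1. Moving X
    through the three factors changes the sign three times. *)
Lemma hermitian_sandwich_skew (S : numFieldType) (n : nat) (X D h : 'M[S]_n) :
  X *m X = - 1%:M -> X^T *m D *m X = D -> h *m X^T = - (X *m h) ->
  X *m (- (h *m D *m h)) = - ((- (h *m D *m h)) *m X^T).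
Proof.
move=> XX XD hX; have e := hermitian_skew XX XD.
have hX' : X *m h = - (h *m X^T) by rewrite hX opprK.
rewrite mulmxN mulNmx !mulmxA hX' !mulNmx !opprK -!mulmxA hX !mulmxN.
by rewrite (mulmxA X^T) e mulNmx !mulmxN !mulmxA.
Qed.

(* A symmetric T anticommuting with J is killed by I + i e K = I (1 + i e J)
   only if T = - i e J T, which is both symmetric and skew. *)
Lemma parallel_of_holomorphic (S : numFieldType) (n : nat) (I J K T : 'M[S]_n) (i e : S) :
  I *m I = - 1%:M -> J *m J = - 1%:M -> I *m J = K -> J *m I = - K ->
  i * i = -1 -> e * e = 1 -> T^T = T -> J *m T = - (T *m J^T) ->
  let p := 2^-1 *: (1%:M - i *: quat I J K 0 e 0) in
  p *m (quat I J K 1 0 (i * e) *m T) *m p^T = 0 -> T = 0.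
Proof.
move=> II JJ IJ JI ii ee TT JT p.
have qJ : quat I J K 0 e 0 = e *: J by rewrite /quat !scale0r add0r addr0.
have Tp : T *m p^T = 2^-1 *: (1%:M + i *: quat I J K 0 e 0) *m T.
  have -> : p^T = 2^-1 *: (1%:M - (i * e) *: J^T).
    by rewrite /p qJ; apply/matrixP => a b; rewrite !mxE eq_sym mulrA.
  rewrite -scalemxAr mulmxBr mulmx1 -scalemxAr -[T *m _]opprK -JT scalerN opprK.
  by rewrite qJ scalerA -scalemxAl mulmxDl mul1mx -!scalemxAl.
rewrite -!mulmxA Tp !mulmxA /p -!(scalemxAl, scalemxAr).
have abc : 0 * 0 + e * e + 0 * 0 = 1 by rewrite ee; ring.
rewrite (quat_sandwich II JJ IJ JI _ _ _ ii abc).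
have -> : quat I J K (1 - (1 * 0 + 0 * e + i * e * 0) * 0 + i * (0 * 0 - i * e * e))
    (0 - (1 * 0 + 0 * e + i * e * 0) * e + i * (i * e * 0 - 1 * 0))
    (i * e - (1 * 0 + 0 * e + i * e * 0) * 0 + i * (1 * e - 0 * 0))
    = 2 *: (I *m (1%:M + (i * e) *: J)).
  have -> : 1 - (1 * 0 + 0 * e + i * e * 0) * 0 + i * (0 * 0 - i * e * e) = 2.
    by transitivity (1 - (i * i) * (e * e)); [ring|rewrite ii ee; ring].
  rewrite mulmxDr mulmx1 -scalemxAr IJ /quat scalerDr scalerA.
  have -> : 0 - (1 * 0 + 0 * e + i * e * 0) * e + i * (i * e * 0 - 1 * 0) = 0 by ring.
  by rewrite scale0r addr0; congr (_ + _ *: _); ring.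
rewrite -!scalemxAl !scalerA => /eqP; rewrite scaler_eq0 !mulf_eq0 !invr_eq0 !pnatr_eq0 /=.
rewrite -mulmxA => /eqP e0.
have e1 : T + (i * e) *: (J *m T) = 0.
  have := congr1 (mulmx I) e0; rewrite mulmx0 (mulmxA I I) II mulNmx mul1mx.
  by rewrite mulmxDl mul1mx -scalemxAl => /eqP; rewrite oppr_eq0 => /eqP.
have e2 : T - (i * e) *: (J *m T) = 0.
  have := congr1 trmx e1; rewrite trmx0 => <-.
  have -> : (T + (i * e) *: (J *m T))^T = T^T + (i * e) *: (J *m T)^T.
    by apply/matrixP => a b; rewrite !mxE.
  by rewrite trmx_mul TT -[T *m _]opprK -JT scalerN.
have : T + T = 0.
  by transitivity (T + (i * e) *: (J *m T) + (T - (i * e) *: (J *m T)));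
    [mxlin; ring|rewrite e1 e2 addr0].
by rewrite -mulr2n -scaler_nat => /eqP; rewrite scaler_eq0 pnatr_eq0 /= => /eqP.
Qed.

Lemma dir0 (S : comNzRingType) (N n : nat) (d : 'I_N -> 'M[S]_n) : dir d 0 = 0.
Proof. by rewrite /dir big1// => k _; rewrite mxE scale0r. Qed.

Lemma ulsubmx0 (S : nmodType) m1 m2 n1 n2 : ulsubmx (0 : 'M[S]_(m1 + m2, n1 + n2)) = 0.
Proof. by apply/matrixP => i j; rewrite !mxE. Qed.

Section Converse.
Variables (R : realType) (n : nat) (M : topologicalType) (A : atlas R n M).
Variables (I J K g : field A R).
Hypotheses (hM : is_manifold A) (hIJK : hypercomplex I J K)
  (hg : hyperhermitian I J K g).
Let Z := twistor_atlas A.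
Let F := twistor_complex I J K.
Let P := twistor_bivector I J K g.

Lemma sphere_point (e : R) : e * e = 1 -> exists a : sphere R,
  [/\ dom (sphere_atlas R) true a, scomp 0 a = 0, scomp 1 a = e & scomp 2 a = 0].
Proof.
(* lambda = i e has modulus one, and its point of the sphere is e J. *)
move=> ee; pose l : 'cV[R]_2 := \col_i nth 0 [:: 0; e] i.
exists (param (sphere_atlas R) true l); have [-> -> ->] := scomp_param true l.
have rl : rad l = 2^-1.
  rewrite /rad /sqnorm2 !mxE /= expr2 mul0r add0r expr2 ee.
  by congr (_^-1).
split; first exact: sphere_param_dom.
all: rewrite rl ?mxE /=.
- by rewrite mulfV ?pnatr_eq0// subrr mulr0.
- by rewrite mul1r mulrAC mulfV ?pnatr_eq0// mul1r.
- by rewrite mulr0 mul0r.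
Qed.

Section AtPoint.
Variables (c : idx A) (x : M).
Hypothesis cx : dom A c x.
Variable G : 'I_n -> 'M[R[i]]_n.
Hypotheses (Gs : forall k l i, G k i l = G l i k)
  (dI : forall k, dmx c k (cfield c I) x = cfield c I x *m G k - G k *m cfield c I x)
  (dJ : forall k, dmx c k (cfield c J) x = cfield c J x *m G k - G k *m cfield c J x)
  (dK : forall k, dmx c k (cfield c K) x = cfield c K x *m G k - G k *m cfield c K x).
Let E := nabla_inv g c G x.

Lemma nabla_inv_sym k : (E k)^T = E k.
Proof.
rewrite /E (nabla_invE hM hIJK hg G k cx) linearN/= !trmx_mul.
rewrite (nabla_metric_sym hM hg G cx) mulmxA.
by have -> : (cmetric_inv g c x)^T = cmetric_inv g c x
  by rewrite toC_tr trmx_inv (metric_sym hg cx).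
Qed.

Lemma nabla_inv_skew k : cfield c J x *m E k = - (E k *m (cfield c J x)^T).
Proof.
rewrite /E (nabla_invE hM hIJK hg G k cx).
have [_ JJ _ _ _] := cfield_alg hIJK cx.
apply: hermitian_sandwich_skew => //.
  apply: (nabla_hyperhermitian hM hIJK hg cx dI dJ dK).
  by rewrite !inE eqxx orbT.
have := quat_metric_inv hIJK hg 0 1 0 cx.
by rewrite /fquat /quat !scale0r scale1r add0r addr0.
Qed.

Hypothesis hP : holomorphic_bivector F P.

Lemma holomorphic_nabla_dir (e : R) (u : 'cV[R[i]]_n) : e * e = 1 ->
  dir E ((1%:M + 'i *: (e%:C *: cfield c J x)) *m u) = 0.
Proof.
move=> ee; have [a [ab a0 a1 a2]] := sphere_point ee.
(* 1 + i S is twice the projection onto T^{0,1} of the fibre, so this field is of type (0,1) at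
   every point of the chart and not only at [(x, a)]. Its sphere component is 0, which removes the
   second term of [part20_lie]. *)
pose X y : 'cV[R[i]]_(n + 2) :=
  col_mx ((1%:M + 'i *: fiber_structure I J K c y) *m u) 0.
have sS := csmooth_mx_fiber_structure hM hIJK hg c true.
have zP := twistor_good_chart hM ((c, true) : idx Z).
have cz : dom Z (c, true) (x, a) by [].
have sX : csmooth_mx (A := Z) (c, true) X.
  have sXu : csmooth_mx (A := Z) (c, true)
      (fun y => (1%:M + 'i *: fiber_structure I J K c y) *m u).
    apply: (csmooth_mxM zP); last exact: csmooth_mx_cst.
    apply: (csmooth_mxD zP); first exact: csmooth_mx_cst.
    by apply: (csmooth_mxZ zP) sS; exact: csmooth_cst.
  move=> i j; rewrite /X; case: (fintype.split_ordP i) => k ->.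
    by under eq_fun do rewrite col_mxEu; exact: sXu.
  by under eq_fun do rewrite col_mxEd mxE; exact: csmooth_cst.
have FX y : dom Z (c, true) y -> toC (F (c, true) y) *m X y = - ('i *: X y).
  move=> cy; have [cy1 _] := cy; rewrite /F (twistor_complexE I J K (c, true) y) /X.
  rewrite mul_block_col !mul0mx mulmx0 !addr0 scale_col_mx opp_col_mx scaler0 oppr0.
  congr col_mx; rewrite mulmxA mulmxDr mulmx1 -scalemxAr.
  have -> := fiber_structureK hIJK (z := y) cy1.
  rewrite scalemxAl -mulNmx; congr (_ *m _).
  by rewrite scalerDr scalerA -expr2 sqrCi scaleN1r scalerN opprD opprK addrC.
have := hP; case=> _ _ /(_ (c, true) X (fun i => sX i 0) FX (x, a) cz).
rewrite (part20_lie hM hIJK hg cx ab Gs dI dJ dK sX FX) /X col_mxKu col_mxKd.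
have s0 : @sc R M 0 (x, a) = 0 by rewrite /sc a0 rmorph0.
have s1 : @sc R M 1 (x, a) = e%:C by rewrite /sc a1.
have s2 : @sc R M 2 (x, a) = 0 by rewrite /sc a2 rmorph0.
have b0 : @bcoef R M 0 (x, a) = 1 by rewrite /bcoef /= s0 mulr0 subr0.
have b1 : @bcoef R M 1 (x, a) = 0 by rewrite /bcoef /= s0 s2 mul0r mulr0 oppr0 addr0.
have b2 : @bcoef R M 2 (x, a) = 'i * e%:C.
  by rewrite /bcoef /= s0 s1 mul0r oppr0 add0r.
have SE : fiber_structure I J K c (x, a) =
    quat (cfield c I x) (cfield c J x) (cfield c K x) 0 e%:C 0.
  by rewrite /fiber_structure /fquat s0 s1 s2.
have SJ : fiber_structure I J K c (x, a) = e%:C *: cfield c J x.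
  by rewrite SE /quat !scale0r add0r addr0.
rewrite b0 b1 b2 dir0 mulmx0 mul0mx addr0 SJ /fiber_proj SE => /(congr1 ulsubmx).
rewrite block_mxKul ulsubmx0 dir_scale dir_mull.
have [II JJ _ IJ JI] := cfield_alg hIJK cx.
have ii : 'i * 'i = -1 :> R[i] by rewrite -expr2 sqrCi.
have ee' : e%:C * e%:C = 1 :> R[i] by rewrite -rmorphM ee rmorph1.
rewrite -scalemxAr -scalemxAl => /eqP; rewrite scaler_eq0 invr_eq0 pnatr_eq0 /= => /eqP.
apply: (parallel_of_holomorphic II JJ IJ JI ii ee').
  by rewrite -dir_tr; apply: dir_ext; exact: nabla_inv_sym.
rewrite -dir_mull -dir_mulr -dir_opp; apply: dir_ext; exact: nabla_inv_skew.
Qed.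

Lemma holomorphic_nabla_inv k : E k = 0.
Proof.
rewrite -(dir_delta E k).
have h1 := holomorphic_nabla_dir (delta_mx k 0) (mulr1 1).
have h2 := holomorphic_nabla_dir (delta_mx k 0) (etrans (mulrNN 1 1) (mulr1 1)).
apply/eqP; have : dir E (2 *: delta_mx k 0) == 0.
  (* The cases e = 1 and e = -1 add up: (1 + iJ) + (1 - iJ) = 2. *)
  have -> : 2 *: delta_mx k 0 = (1%:M + 'i *: (1%:C *: cfield c J x)) *m delta_mx k 0
      + (1%:M + 'i *: ((-1)%:C *: cfield c J x)) *m delta_mx k 0 :> 'cV[R[i]]_n.
    rewrite -mulmxDl rmorphN rmorph1 scaleN1r scale1r scalerN addrACA subrr addr0.
    by rewrite mulmxDl mul1mx -mulr2n scaler_nat.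
  by rewrite dirD h1 h2 addr0.
by rewrite dirZ scaler_eq0 pnatr_eq0.
Qed.

Lemma holomorphic_nabla k :
  nabla G (cfield c g x) (fun k => dmx c k (cfield c g) x) k = 0.
Proof.
have := holomorphic_nabla_inv k; rewrite /E (nabla_invE hM hIJK hg G k cx).
have gh := cmetric_invK hg cx; have hg' := mulmx1C gh.
move/(congr1 (fun Y => cfield c g x *m Y *m cfield c g x)).
rewrite mulmx0 mul0mx mulmxN mulNmx !mulmxA gh mul1mx -mulmxA hg' mulmx1.
by move/eqP; rewrite oppr_eq0 => /eqP.
Qed.

End AtPoint.

Lemma holomorphic_hyperkahler : holomorphic_bivector F P -> hyperkahler I J K g.
Proof.
move=> hP.
have key c x : dom A c x -> forall i j k,
    [/\ pder c i (fun y => omega I g c y j k) x + pder c j (fun y => omega I g c y k i) x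
      + pder c k (fun y => omega I g c y i j) x = 0,
      pder c i (fun y => omega J g c y j k) x + pder c j (fun y => omega J g c y k i) x
      + pder c k (fun y => omega J g c y i j) x = 0 &
      pder c i (fun y => omega K g c y j k) x + pder c j (fun y => omega K g c y k i) x
      + pder c k (fun y => omega K g c y i j) x = 0].
  move=> cx; have [G [Gs dI dJ dK]] := obata_at hM hIJK hg cx.
  apply: (nabla_closed hM hIJK hg cx Gs dI dJ dK).
  exact: (holomorphic_nabla cx Gs dI dJ dK hP).
by split=> // c x i j k cx; have [] := key c x cx i j k.
Qed.

End Converse.

(** * Leaves *)

(** The level set through [p] is open and closed. The codomain is a bare type, so that the lemma
    applies to the projection to the sphere and to the identity map alike. *)
Lemma connected_locally_constant (T : topologicalType) (U : Type) (f : T -> U) :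
  connected [set: T] -> (forall p, \forall q \near p, f q = f p) ->
  forall p q, f p = f q.
Proof.
move=> cT lc p q; pose B := [set q | f q = f p].
have oB : open B.
  rewrite openE => r /= Br; rewrite /interior /=.
  apply: filterS (lc r) => s fs; change (f s = f r) in fs.
  by change (f s = f p); rewrite fs.
have oCB : open (~` B).
  rewrite openE => r /= Br; rewrite /interior /=.
  apply: filterS (lc r) => s fs; change (f s = f r) in fs.
  by change (~ (f s = f p)); rewrite fs.
have -> // : f q = f p.
suff : B = setT by move=> /seteqP[_ /(_ q)]; exact.
apply: cT; first by exists p.
- by exists B => //; rewrite setTI.
- by exists B; [rewrite -[B]setCK; exact: open_closedC|rewrite setTI].
Qed.

(** * Functions with vanishing partial derivatives *)

Section LocallyConstant.
Variables (R : realType) (n : nat) (f : 'cV[R]_n -> R).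

Lemma line_derive (u : 'cV[R]_n) (k : 'I_n) (s : R) :
  derivable f (u + s *: delta_mx k 0) (delta_mx k 0) ->
  is_derive s 1 (fun s => f (u + s *: delta_mx k 0))
    ('D_(delta_mx k 0) f (u + s *: delta_mx k 0)).
Proof.
set v := u + s *: _; pose phi s := f (u + s *: delta_mx k 0) => dv.
have e : (fun h : R => h^-1 *: ((phi \o shift s) (h *: 1) - phi s)) =
    (fun h => h^-1 *: ((f \o shift v) (h *: delta_mx k 0) - f v)).
  apply/funext => h; rewrite /phi /v /=; congr (_ *: (f _ - _)).
  by rewrite scalerDl [h *: 1]mulr1 addrCA.
by apply: DeriveDef; rewrite /derivable /derive e.
Qed.

Lemma line_constant (u : 'cV[R]_n) (k : 'I_n) (t : R) : 0 <= t ->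
  (forall s, 0 <= s <= t -> derivable f (u + s *: delta_mx k 0) (delta_mx k 0)) ->
  (forall s, 0 <= s <= t -> 'D_(delta_mx k 0) f (u + s *: delta_mx k 0) = 0) ->
  f (u + t *: delta_mx k 0) = f u.
Proof.
move=> t0 df d0; pose phi s := f (u + s *: delta_mx k 0).
have dphi s : 0 <= s <= t -> is_derive s 1 phi 0.
  by move=> st; rewrite -(d0 s st); exact: line_derive (df s st).
have [||s _] := @MVT_segment R phi (fun=> 0) 0 t t0.
- by move=> s; rewrite in_itv /= => /andP[s0 st]; apply: dphi; rewrite !ltW.
- apply: derivable_within_continuous => s; rewrite in_itv /= => st.
  by case: (dphi s st).
- by rewrite mul0r => /eqP; rewrite subr_eq0 /phi scale0r addr0 => /eqP.
Qed.

(** A ball of the sup norm is a box, so [v] and [w] are joined inside it by changing one coordinate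
    at a time, and the mean value theorem applies on each segment. *)
Lemma zero_partials_locally_constant (U : set 'cV[R]_n) : open U -> smooth_on U f ->
  (forall i v, U v -> 'D_(delta_mx i 0) f v = 0) ->
  forall v, U v -> \forall w \near v, f w = f v.
Proof.
move=> oU sf d0 v Uv.
have /nbhs_ballP[e /= e0 vU] := open_near oU Uv.
apply/nbhs_ballP; exists e => //= w vw.
have inU (u : 'cV[R]_n) : (forall i, `|v i 0 - u i 0| < e) -> U u.
  move=> h; apply: vU; split=> // i j; rewrite (ord1 j); exact: h.
have hw i : `|v i 0 - w i 0| < e by case: vw => _ /(_ i 0).
(* The first k coordinates already come from [w], the others still from [v]. *)
pose u k : 'cV[R]_n := \col_i (if (i < k)%N then w i 0 else v i 0).
have step (k : 'I_n) : f (u k.+1) = f (u k).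
  pose t := w k 0 - v k 0.
  have uE : u k.+1 = u k + t *: delta_mx k 0.
    apply/colP => i; rewrite !mxE ltnS leq_eqVlt eqxx andbT.
    have [->|ik] /= := eqVneq i k.
      by rewrite eqxx ltnn /t mulr1 addrC subrK.
    by rewrite -(inj_eq val_inj) /= in ik; rewrite (negbTE ik) /= mulr0 addr0.
  have uk i : u k i 0 = if (i < k)%N then w i 0 else v i 0 by rewrite mxE.
  have tE : `|t| < e by rewrite /t distrC; exact: hw.
  have line_in s : `|s| <= `|t| -> U (u k + s *: delta_mx k 0).
    move=> st; apply: inU => i; rewrite !addmxE scalemxE uk mxE eqxx andbT.
    have [->|ik] /= := eqVneq i k.
      by rewrite ltnn mulr1 opprD addrA subrr add0r normrN (le_lt_trans st).
    by rewrite mulr0 addr0; case: ifP => _; [exact: hw|rewrite subrr normr0].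
  rewrite uE; have [t0|t0] := leP 0 t.
    apply: line_constant => // s /andP[s0 st].
      by apply: (smooth_on_derivable sf); apply: line_in; rewrite !ger0_norm.
    by apply: d0; apply: line_in; rewrite !ger0_norm.
  (* For t < 0 the segment is traversed from its other end, with the positive length - t. *)
  have e1 : u k = (u k + t *: delta_mx k 0) + (- t) *: delta_mx k 0.
    by rewrite scaleNr addrK.
  rewrite [in RHS]e1; apply/esym.
  have sub s : 0 <= s <= - t -> U (u k + t *: delta_mx k 0 + s *: delta_mx k 0).
    move=> /andP[s0 st]; rewrite -addrA -scalerDl.
    have ts : t + s <= 0 by rewrite -lerBrDl sub0r.
    by apply: line_in; rewrite !ler0_norm ?(ltW t0)// lerN2 lerDl.
  by apply: line_constant => [|s st|s st]; [rewrite oppr_ge0 ltW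
    |by apply: (smooth_on_derivable sf); exact: sub|by apply: d0; exact: sub].
have fu m : (m <= n)%N -> f (u m) = f (u 0%N).
  by elim: m => // m ih mn; rewrite (step (Ordinal mn)) ih// ltnW.
have <- : u n = w by apply/colP => i; rewrite mxE ltn_ord.
have <- : u 0%N = v by apply/colP => i; rewrite mxE ltn0.
exact: fu.
Qed.

End LocallyConstant.

(** * The image of the bivector *)

(* With t = e - (e . s) s + i e x s and t' its conjugate. *)
Lemma quat_isotropic (S : fieldType) (n : nat) (I J K : 'M[S]_n) (i s0 s1 s2 : S) :
  I *m I = - 1%:M -> J *m J = - 1%:M -> I *m J = K -> J *m I = - K ->
  i * i = -1 -> s0 * s0 + s1 * s1 + s2 * s2 = 1 ->
  let q := quat I J K s0 s1 s2 in
  let t := quat I J K (1 - s0 * s0) (- (s0 * s1) - i * s2) (- (s0 * s2) + i * s1) in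
  let t' := quat I J K (1 - s0 * s0) (- (s0 * s1) + i * s2) (- (s0 * s2) - i * s1) in
  t *m t' = (- (2 * (1 - s0 * s0))) *: (1%:M - i *: q) /\ q *m t' = - (t' *m q).
Proof.
move=> II JJ IJ JI ii ss q t t'; rewrite !(quatM II JJ IJ JI).
have w0 : s0 * s0 + s1 * s1 + s2 * s2 - 1 = 0 by rewrite ss subrr.
have v0 : i * i + 1 = 0 by rewrite ii addNr.
rewrite -!(scalemx1 _ (_ + _)) /q /quat; split; apply/matrixP => a b.
  rewrite !(addmxE, oppmxE, scalemxE); apply/eqP; rewrite -subr_eq0; apply/eqP.
  set w := s0 * s0 + s1 * s1 + s2 * s2 - 1 in w0; set v := i * i + 1 in v0.
  transitivity (- ((s0 * s0 + 1) * w - v * (s1 * s1 + s2 * s2)) * (1%:M : 'M[S]_n) a b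
                + 2 * i * s0 * w * I a b); first by rewrite /w /v; ring.
  by rewrite w0 v0 !(mulr0, mul0r) subrr oppr0 mul0r addr0.
rewrite !(addmxE, oppmxE, scalemxE); apply/eqP; rewrite -subr_eq0; apply/eqP.
set w := s0 * s0 + s1 * s1 + s2 * s2 - 1 in w0.
transitivity (2 * s0 * w * (1%:M : 'M[S]_n) a b); first by rewrite /w; ring.
by rewrite w0 mulr0 mul0r.
Qed.

Section Image.
Variables (R : realType).

(** Vanishing of v^{1,0} means v = i F v, and a real vector that is i times a real vector is
    zero. *)
Lemma proj10_real_eq0 (n : nat) (F : 'M[R]_n) (v : 'cV[R]_n) :
  proj10 F *m toC v = 0 -> v = 0.
Proof.
rewrite /proj10 -scalemxAl => /eqP; rewrite scaler_eq0 invr_eq0 pnatr_eq0 /=.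
rewrite mulmxBl mul1mx -scalemxAl -map_mxM subr_eq0 => /eqP e.
apply/colP => i; rewrite [RHS]mxE; have /matrixP/(_ i 0) := e.
rewrite [LHS]mxE scalemxE [toC _ _ _]mxE; move: (v i 0) ((F *m v) i 0) => x y xy.
have : (x ^+ 2 + y ^+ 2)%:C = 0 :> R[i].
  by rewrite rmorphD !rmorphXn/= xy exprMn sqrCi mulN1r addNr.
case=> /eqP; rewrite paddr_eq0 ?sqr_ge0// => /andP[]; rewrite sqrf_eq0 => /eqP -> //.
Qed.

End Image.

(** On T^{1,0} the factor 1 - i q acts as 2, so t t' u = - 4 m u. The constants 2^-1 and (2 m)^-1
    with the outer sign compensate this factor. *)
Lemma isotropic_solve (S : fieldType) (n : nat) (t t' q g h : 'M[S]_n) (u : 'cV[S]_n)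
    (i m : S) : m != 0 -> (2 : S) != 0 -> i * i = -1 -> h *m g = 1%:M ->
  t *m t' = (- (2 * m)) *: (1%:M - i *: q) ->
  q *m u = i *: u ->
  - ((2^-1 *: (t *m h)) *m ((2 * m)^-1 *: (g *m (t' *m u)))) = u.
Proof.
move=> m0 n2 ii hg tt qu; rewrite -scalemxAl -scalemxAr.
have -> : t *m h *m (g *m (t' *m u)) = t *m t' *m u.
  by rewrite -!mulmxA (mulmxA h) hg mul1mx.
rewrite tt -scalemxAl mulmxBl mul1mx -scalemxAl qu.
rewrite [i *: (i *: u)]scalerA ii scaleN1r opprK -mulr2n -scaler_nat !scalerA -scaleNr.
rewrite (_ : - _ = 1) ?scale1r//; field.
by rewrite n2 m0.
Qed.

(** Both g and t' turn q into its negative, up to transposition for g. The covector g t' u is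
    therefore of type (1,0) whenever u is. *)
Lemma isotropic_type (S : fieldType) (n : nat) (t' q g : 'M[S]_n) (u : 'cV[S]_n)
    (i m : S) : q^T *m g = - (g *m q) -> q *m t' = - (t' *m q) -> q *m u = i *: u ->
  q^T *m (m *: (g *m (t' *m u))) = i *: (m *: (g *m (t' *m u))).
Proof.
move=> qg qt qu; rewrite -scalemxAr (mulmxA q^T g) qg mulNmx -(mulmxA g q) (mulmxA q t') qt.
by rewrite mulNmx mulmxN opprK -(mulmxA t' q) qu -!scalemxAr !scalerA mulrC.
Qed.

Section ImageOfP.
Variables (R : realType) (n : nat) (M : topologicalType) (A : atlas R n M).
Variables (I J K g : field A R).
Hypotheses (hM : is_manifold A) (hIJK : hypercomplex I J K)
  (hg : hyperhermitian I J K g).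
Let Z := twistor_atlas A.
Let F := twistor_complex I J K.
Let P := twistor_bivector I J K g.

Lemma toC_usubmx p q r (v : 'M[R]_(p + q, r)) : usubmx (toC v) = toC (usubmx v).
Proof. by apply/matrixP => i j; rewrite !mxE. Qed.
Lemma toC_dsubmx p q r (v : 'M[R]_(p + q, r)) : dsubmx (toC v) = toC (dsubmx v).
Proof. by apply/matrixP => i j; rewrite !mxE. Qed.

Lemma in_image_vertical (c : idx Z) z v : dom Z c z ->
  in_image F P c z v -> dsubmx v = 0.
Proof.
move=> cz [xi _]; rewrite /F /P (twistor_projE I J K c z) (twistor_bivectorE hM hIJK hg cz).
rewrite tr_block_mx !trmx0 -[toC v]vsubmxK -[xi]vsubmxK !mul_block_col !mul0mx !addr0 !add0r.
move=> /(congr1 dsubmx); rewrite !col_mxKd toC_dsubmx.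
exact: (@proj10_real_eq0 R 2 (mul_i R)).
Qed.

Lemma in_image_pole (c : idx Z) z v : dom Z c z ->
  twistor_proj z = lam0 R \/ twistor_proj z = laminfty R ->
  in_image F P c z v <-> v = 0.
Proof.
move=> cz zp; rewrite /in_image /P (twistor_bivector_poles hM hIJK hg cz zp) trmx0.
split=> [[xi _]|->]; first by rewrite mul0mx; exact: proj10_real_eq0.
by exists 0; rewrite ?map_mx0 !mulmx0 ?scaler0.
Qed.

Lemma quat_metric c x a1 a2 a3 : dom A c x ->
  (fquat I J K c x a1 a2 a3)^T *m cfield c g x = - (cfield c g x *m fquat I J K c x a1 a2 a3).
Proof.
move=> cx; have gh := cmetric_invK hg cx; have hg' := mulmx1C gh.
have := quat_metric_inv hIJK hg a1 a2 a3 cx.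
move=> /(congr1 (fun Y => cfield c g x *m Y *m cfield c g x)).
by rewrite mulmxA gh mul1mx mulmxN mulNmx -!mulmxA hg' mulmx1.
Qed.

Lemma in_image_generic (c : idx Z) z v : dom Z c z -> 1 - scomp 0 z.2 * scomp 0 z.2 != 0 ->
  dsubmx v = 0 -> in_image F P c z v.
Proof.
move=> cz z0 dv; have [cx _] := cz.
have [II JJ _ IJ JI] := cfield_alg hIJK cx.
have ii : 'i * 'i = -1 :> R[i] by rewrite -expr2 sqrCi.
pose m : R[i] := 1 - sc 0 z * sc 0 z.
have m0 : m != 0.
  by rewrite /m /sc -rmorphM -[1]/(1%:C) -rmorphB fmorph_eq0.
pose u := fiber_proj I J K c.1 z *m toC (usubmx v).
have qu : fiber_structure I J K c.1 z *m u = 'i *: u.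
  by rewrite /u mulmxA (fiber_proj_eigen hIJK cx) -scalemxAl.
have [tt qt] := quat_isotropic II JJ IJ JI ii (scP z).
pose t' := fquat I J K c.1 z.1 (1 - sc 0 z * sc 0 z)
  (- (sc 0 z * sc 1 z) + 'i * sc 2 z) (- (sc 0 z * sc 2 z) - 'i * sc 1 z).
set S := fiber_structure I J K c.1 z in qu *.
have qg : S^T *m cfield c.1 g z.1 = - (cfield c.1 g z.1 *m S) := quat_metric _ _ _ cx.
have qt' : S *m t' = - (t' *m S) := qt.
(* The preimage supplied by [isotropic_solve]. It exists because m = 1 - s0^2 is nonzero away from
   the poles; the sign there comes from the skewness of the bivector. *)
pose xi := (2 * m)^-1 *: (cfield c.1 g z.1 *m (t' *m u)).
exists (col_mx xi 0).
  rewrite /F (twistor_complexE I J K c z) -/S tr_block_mx !trmx0 mul_block_col.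
  rewrite !mul0mx !addr0 mulmx0.
  by rewrite addr0 scale_col_mx scaler0 /xi (isotropic_type _ qg qt' qu).
rewrite /F /P (twistor_projE I J K c z) (twistor_bivectorE hM hIJK hg cz).
rewrite tr_block_mx !trmx0 -[toC v]vsubmxK toC_dsubmx dv map_mx0 !mul_block_col.
rewrite !mul0mx !mulmx0 !addr0 (fiber_bivector_skew hIJK hg cx) mulNmx toC_usubmx -/u.
have n2 : (2 : R[i]) != 0 by rewrite pnatr_eq0.
have hg' := mulmx1C (cmetric_invK hg cx).
by rewrite -[in LHS](isotropic_solve m0 n2 ii hg' tt qu).
Qed.

End ImageOfP.

(** * The manifold with one point *)

Section Point.
Variable R : realType.

(** R^0 with the identity chart; it parametrizes the leaves over the two poles. *)
Definition point_atlas : atlas R 0 'cV[R]_0 :=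
  @Atlas R 0 'cV[R]_0 unit (fun=> setT) (fun=> id) (fun=> id).

Lemma cV0_eq (u v : 'cV[R]_0) : u = v.
Proof. by apply/colP => -[]. Qed.

Lemma point_manifold : is_manifold point_atlas.
Proof.
have allT (S : set 'cV[R]_0) u : S u -> S = setT.
  by move=> Su; apply/seteqP; split=> // v _; rewrite (cV0_eq v u).
split=> //.
- by exists 0.
- by rewrite -(allT [set 0] 0)//; exact: connected1.
- exists [set (setT : set 'cV[R]_0)]; first exact: countable1.
  split=> [_ ->|u S uS]; first exact: openT.
  by exists setT => //; rewrite (allT S u)//; exact: nbhs_singleton.
- by move=> u; exists tt.
- by move=> c; exact: openT.
- by move=> c; rewrite image_id; exact: openT.
- by move=> c u _; exact: cvg_id.
- by move=> c u _; exact: cvg_id.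
- by move=> c d [].
Qed.

End Point.

(** * Integral manifolds of the bivector *)

Section Leaves.
Variables (R : realType) (n : nat) (M : topologicalType) (A : atlas R n M).
Variables (I J K g : field A R).
Hypotheses (hM : is_manifold A) (hIJK : hypercomplex I J K)
  (hg : hyperhermitian I J K g).
Let Z := twistor_atlas A.
Let F := twistor_complex I J K.
Let P := twistor_bivector I J K g.

Definition pole_point (a : sphere R) : Prop := a = lam0 R \/ a = laminfty R.

Lemma scomp_not_pole a : ~ pole_point a -> 1 - scomp 0 a * scomp 0 a != 0.
Proof.
move=> ap; apply/eqP => e; apply: ap.
have [l0 l1 l2] := scomp_param (R := R) true 0.
have [m0 m1 m2] := scomp_param (R := R) false 0.
have r0 : rad 0 = 1 :> R by rewrite /rad /sqnorm2 !mxE expr0n addr0 addr0 invr1.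
have aP := sphereP a.
have s12 : scomp 1 a ^+ 2 + scomp 2 a ^+ 2 == 0.
  by rewrite -e -aP; apply/eqP; ring.
move: s12; rewrite paddr_eq0 ?sqr_ge0// !sqrf_eq0 => /andP[/eqP e1 /eqP e2].
have : (scomp 0 a - 1) * (scomp 0 a + 1) == 0.
  by apply/eqP; transitivity (- (1 - scomp 0 a * scomp 0 a)); [ring|rewrite e oppr0].
rewrite mulf_eq0 subr_eq0 addr_eq0 => /orP[] /eqP e0; [right|left].
  apply: sphere_eq; apply: I3_ind; rewrite ?m0 ?m1 ?m2 r0 ?e0 ?e1 ?e2 /pole ?mxE; ring.
apply: sphere_eq; apply: I3_ind; rewrite ?l0 ?l1 ?l2 r0 ?e0 ?e1 ?e2 /pole ?mxE; ring.
Qed.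

Lemma twistor_dom_open (d : idx Z) : open (dom Z d).
Proof.
have -> : dom Z d = fst @^-1` dom A d.1 `&` snd @^-1` dom (sphere_atlas R) d.2 by [].
apply: openI.
  apply: open_comp; last exact: mfd_dom_open.
  by move=> z _; exact: cvg_fst.
apply: open_comp; last exact: sphere_dom_open.
by move=> z _; exact: cvg_snd.
Qed.

Lemma twistor_cover (z : M * sphere R) : exists d : idx Z, dom Z d z.
Proof.
case: z => x a; have [c cx] := mfd_cover hM x; have [b ab] := sphere_cover a.
by exists (c, b).
Qed.

Section Integral.
Variables (r : nat) (N : topologicalType) (B : atlas R r N) (f : N -> M * sphere R).
Hypotheses (hN : is_manifold B) (fs : smooth_map B Z f)
  (fP : forall p c d, dom B c p -> dom Z d (f p) ->
          injective (mulmx (jac B Z f c d p) : 'cV[R]_r -> 'cV[R]_(n + 2)) /\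
          range (mulmx (jac B Z f c d p) : 'cV[R]_r -> 'cV[R]_(n + 2))
            = [set v | in_image F P d (f p) v]).

(** Every column of the Jacobian lies in the image of the bivector and is therefore tangent to a
    fibre. *)
Lemma integral_pder_base p c (d : idx Z) (k : 'I_2) j : dom B c p -> dom Z d (f p) ->
  pder c j (fun y => chart Z d (f y) (rshift n k) 0) p = 0.
Proof.
move=> cp dp; have [_ im] := fP cp dp.
have : range (mulmx (jac B Z f c d p) : 'cV[R]_r -> 'cV[R]_(n + 2))
    (col j (jac B Z f c d p)) by exists (delta_mx j 0); rewrite // -colE.
rewrite im => /(in_image_vertical hM hIJK hg dp) /matrixP/(_ k 0).
by rewrite !mxE.
Qed.

Lemma integral_proj_locally_constant p : \forall q \near p, (f q).2 = (f p).2.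
Proof.
have [c cp] := mfd_cover hN p; have [d dp] := twistor_cover (f p).
have [fc fd] := fs.
have cP := manifold_good_chart c hN.
pose V := dom B c `&` f @^-1` dom Z d; pose U := chart B c @` V.
have oV : open V.
  apply: openI; first exact: mfd_dom_open.
  by apply: open_comp; [move=> q _; exact: fc|exact: twistor_dom_open].
(* Writing the chart image of [V] as a preimage under the continuous [param] shows that it is
   open. *)
have UE : U = (chart B c @` dom B c) `&` (param B c) @^-1` V.
  apply/seteqP; split=> v.
    by move=> [q [cq dq] <-]; split; [exists q|rewrite /preimage /= cP.2].
  by move=> [Uv pv]; exists (param B c v) => //; exact: (paramK cP).
have oU : open U.
  rewrite openE => v Uv; rewrite /interior UE; move: Uv; rewrite UE => -[Uv pv].
  apply: filterI; first exact: open_near cP.1 Uv.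
  have cpar : param B c @ v --> param B c v := mfd_param_cont hN Uv.
  by apply: cpar; exact: open_near oV pv.
have Up : U (chart B c p) by exists p.
have loc (k : 'I_2) : \forall q \near p,
    chart Z d (f q) (rshift n k) 0 = chart Z d (f p) (rshift n k) 0.
  pose phi v := chart Z d (f (param B c v)) (rshift n k) 0.
  have dphi j v : U v -> 'D_(delta_mx j 0) phi v = 0.
    by move=> [q [cq dq] <-]; exact: integral_pder_base.
  have near_phi := zero_partials_locally_constant oU (fd c d (rshift n k)) dphi Up.
  have cchart : chart B c @ p --> chart B c p := mfd_chart_cont hN cp.
  have near_p : \forall q \near p, phi (chart B c q) = phi (chart B c p).
    exact: (cchart [set w | phi w = phi (chart B c p)]).
  apply: filterS (filterI near_p (open_near (mfd_dom_open hN c) cp)) => q [/= + cq].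
  by rewrite /phi !cP.2.
(* Close to [p] the image stays in the sphere chart [d.2], so that equal coordinates give equal
   points of the sphere. *)
apply: filterS (filterI (filterI (loc 0) (loc 1)) (open_near oV (conj cp dp))).
move=> q [[e0 e1] [cq [_ dq]]].
have [_ dp2] := dp.
rewrite -(sphere_chartK dq) -(sphere_chartK dp2); congr (param _ _ _).
apply/colP => k; move: e0 e1; rewrite /= !col_mxEd.
by move: k; apply: I2_ind.
Qed.

Lemma integral_proj_constant p q : (f p).2 = (f q).2.
Proof.
apply: (connected_locally_constant (f := fun p => (f p).2) (mfd_connected hN)).
exact: integral_proj_locally_constant.
Qed.

(** At a pole the image is 0, and the injective differential forces the dimension of [N] to be 0. A
    connected manifold of dimension 0 is a point. *)
Lemma integral_pole_point p q : pole_point (f p).2 -> p = q.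
Proof.
move=> fp; have [c cp] := mfd_cover hN p; have [d dp] := twistor_cover (f p).
have [ji im] := fP cp dp.
have col0 (v : 'cV[R]_r) : v = 0.
  apply: ji; rewrite mulmx0; have : range (mulmx (jac B Z f c d p)) (jac B Z f c d p *m v).
    by exists v.
  by rewrite im => /(in_image_pole hM hIJK hg _ dp fp).
(* All charts take their values in a space whose only vector is 0. Each chart domain has at most one
   point, and the identity of [N] is locally constant. *)
apply: (connected_locally_constant (f := id) (mfd_connected hN)) => p'.
have [c' cp'] := mfd_cover hN p'.
apply: filterS (open_near (mfd_dom_open hN c') cp') => q' cq' /=.
rewrite -(mfd_chartK hN cq') -(mfd_chartK hN cp').
by rewrite (col0 (chart B c' q')) (col0 (chart B c' p')).
Qed.

End Integral.

Lemma integral_manifold_proj L : integral_manifold F P L ->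
  exists2 a, L !=set0 & L `<=` @twistor_proj R M @^-1` [set a].
Proof.
move=> [r [N [B [f [hN fs fi <- fP]]]]]; have [p _] := mfd_nonempty hN.
exists (f p).2; first by exists (f p), p.
by move=> _ [q _ <-]; exact: (integral_proj_constant hN fs fP).
Qed.

Lemma integral_manifold_pole L z : integral_manifold F P L -> L z -> pole_point z.2 ->
  L = [set z].
Proof.
move=> [r [N [B [f [hN fs fi <- fP]]]]] [p _ <-] zp.
apply/seteqP; split=> [_ [q _ <-]|_ ->]; last by exists p.
by rewrite (integral_pole_point hN fP q zp).
Qed.

(** M itself is the parametrizing manifold, embedded by the section [twistor_sec a]. *)
Lemma integral_manifold_fiber a : ~ pole_point a ->
  integral_manifold F P (@twistor_proj R M @^-1` [set a]).
Proof.
move=> ap; exists n, M, A, (fun x => twistor_sec a x); split=> //.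
- split.
    by move=> x; exact: (cvg_pair (F := nbhs x) (f := id) (g := fun=> a) cvg_id (cvg_cst _)).
  move=> c d i; case: (fintype.split_ordP i) => k ->.
    rewrite (_ : (fun v => _) = fun v => chart A d.1 (param A c v) k 0).
      apply: (smooth_on_sub _ (mfd_smooth hM c d.1 k)) => _ [y [cy [dy _]] <-].
      by exists y.
    by apply/funext => v; rewrite /= col_mxEu.
  rewrite (_ : (fun v => _) = fun=> chart (sphere_atlas R) d.2 a k 0).
    by apply: (smooth_on_sub (@subsetT _ _) (smooth_on_cst _ _)); exact: openT.
  by apply/funext => v; rewrite /= col_mxEd.
- by move=> x y [].
- by apply/seteqP; split=> [_ [y _ <-] //|[x b] /= <-]; exists x.
move=> x c d cx dx; have [dx1 _] := dx.
have tu := transition_unit hg cx dx1.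
have jE : jac A Z (fun x => twistor_sec a x) c d x = col_mx (transition c d.1 x) 0.
  apply/matrixP => i j; rewrite mxE; case: (fintype.split_ordP i) => k ->.
    rewrite col_mxEu [RHS]mxE; congr (pder c j _ x).
    by apply/funext => y; rewrite /= col_mxEu.
  rewrite col_mxEd [RHS]mxE -[RHS](pder_cst c j (chart (sphere_atlas R) d.2 a k 0) x).
  by congr (pder c j _ x); apply/funext => y; rewrite /= col_mxEd.
rewrite jE; split.
  move=> u v; rewrite !mul_col_mx => /(congr1 usubmx); rewrite !col_mxKu => e.
  by rewrite -[u](mulKmx tu) e mulKmx.
apply/seteqP; split=> [_ [u _ <-]|v].
  apply: (in_image_generic hM hIJK hg dx (scomp_not_pole ap)).
  by rewrite mul_col_mx col_mxKd mul0mx.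
move=> /(in_image_vertical hM hIJK hg dx) dv.
exists (invmx (transition c d.1 x) *m usubmx v) => //.
by rewrite mul_col_mx mul0mx mulKVmx// -[RHS]vsubmxK dv.
Qed.

Lemma integral_manifold_point z : pole_point z.2 -> integral_manifold F P [set z].
Proof.
move=> zp; exists 0%N, 'cV[R]_0, (point_atlas R), (fun=> z); split.
- exact: point_manifold.
- split; first exact: (@cst_continuous _ _ z).
  by move=> c d i; exact: (smooth_on_sub (@subsetT _ _) (smooth_on_cst _ openT)).
- by move=> u v _; exact: cV0_eq.
- by apply/seteqP; split=> [_ [_ _ <-]//|_ ->]; exists 0.
move=> p c d _ dz; split; first by move=> u v _; exact: cV0_eq.
apply/seteqP; split=> [_ [u _ <-]|v /(in_image_pole hM hIJK hg _ dz zp) ->].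
  by apply/(in_image_pole hM hIJK hg _ dz zp); rewrite (cV0_eq u 0) mulmx0.
by exists 0; rewrite ?mulmx0.
Qed.

(** Every integral manifold lies in one fibre, and is a single point if it meets a fibre over a
    pole. So each integral manifold is contained in one of the listed sets, and these are
    maximal. *)
Lemma leafP L : is_leaf F P L <->
  (exists a, [/\ a <> lam0 R, a <> laminfty R & L = @twistor_proj R M @^-1` [set a]]) \/
  (exists z : M * sphere R, pole_point (twistor_proj z) /\ L = [set z]).
Proof.
split=> [[iL Lmax]|[[a [a0 ai ->]]|[z [zp ->]]]].
- have [a [z Lz] La] := integral_manifold_proj iL.
  have za : z.2 = a := La z Lz.
  have [ap|ap] := pselect (pole_point a); [right|left].
    by exists z; rewrite /twistor_proj za; split=> //; apply: integral_manifold_pole; rewrite ?za.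
  exists a; split; [by move=> e; apply: ap; left|by move=> e; apply: ap; right|].
  by apply/esym; apply: Lmax La; exact: integral_manifold_fiber.
- split; first by apply: integral_manifold_fiber => -[].
  move=> L' /integral_manifold_proj[b _ L'b] sub; apply/seteqP; split=> // z L'z.
  (* A point of the fibre over [a], which also lies in L', identifies the base point of L' as
     [a]. *)
  have [x _] := mfd_nonempty hM.
  have <- : b = a by apply/esym; exact: (L'b (x, a) (sub (x, a) erefl)).
  exact: L'b.
- split; first exact: integral_manifold_point.
  by move=> L' iL' sub; apply: integral_manifold_pole => //; exact: sub.
Qed.

End Leaves.

Theorem theorem5p1 (R : realType) (n : nat) (M : topologicalType)
    (A : atlas R n M) (I J K g : field A R)
    (hM : is_manifold A) (hIJK : hypercomplex I J K)
    (hg : hyperhermitian I J K g) :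
  let Z := twistor_atlas A in
  let F := twistor_complex I J K in
  let P := twistor_bivector I J K g in
  (hyperkahler I J K g ->
    [/\ holomorphic_poisson F P,
        forall (c : idx Z) (z : M * sphere R), dom Z c z ->
          twistor_proj z = lam0 R \/ twistor_proj z = laminfty R ->
          P c z = 0 &
        forall L : set (M * sphere R), is_leaf F P L <->
          (exists a : sphere R, [/\ a <> lam0 R, a <> laminfty R &
             L = @twistor_proj R M @^-1` [set a]]) \/
          (exists z : M * sphere R,
             (twistor_proj z = lam0 R \/ twistor_proj z = laminfty R) /\
             L = [set z])]) /\
  (holomorphic_poisson F P -> hyperkahler I J K g).
Proof.
move=> Z F P; split=> [hK|[hol _]]; last exact: (holomorphic_hyperkahler hM hIJK hg hol).
split.
- exact: (hyperkahler_poisson hM hIJK hg hK).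
- by move=> c z; exact: (twistor_bivector_poles hM hIJK hg).
- by move=> L; exact: (leafP hM hIJK hg).
Qed.
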